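(* For $t>0$ let $P_t$ denote the set of all partitions $\pi=\{t_0,\ldots,t_m\}$ with $0=t_0<\cdots<t_m=t$ and $m\in\mathbb N$, and for $\pi\in P_t$ and $u\in\mathrm{C}_{\mathrm b}$ set $I(\pi)u:=I(t_1-t_0)\cdots I(t_m-t_{m-1})u$. Let $S(t)u:=\inf_{n\in\mathbb N_0}I^n(t)u$. Then, for all $t>0$ and $u\in\mathrm{C}_{\mathrm b}$, $$S(t)u=\inf_{\pi\in P_t}I(\pi)u,$$ where the infima are taken pointwise.
   Context: Setting. $(X,\|\cdot\|)$ is a separable Banach space with Borel $\sigma$-algebra $\mathcal B(X)$. $K\colon X\to X$ is a fixed linear operator such that $\{Kx\colon \|x\|\le r\}$ is compact for all $r\ge 0$, $\{Kx\colon x\in X\}$ is dense in $X$, and $\|Kx\|\le\|x\|$ for all $x\in X$. Function spaces. $\mathrm{Lip}$ is the space of all $u\colon X\to\mathbb R$ with $|u(x_1)-u(x_2)|\le L\|K(x_1-x_2)\|$ for all $x_1,x_2\in X$ and some $L\ge 0$. $\mathrm{Lip}_{\mathrm b}$ is the set of $u\in\mathrm{Lip}$ with $\|u\|_\infty:=\sup_{x\in X}|u(x)|<\infty$. For bounded continuous functions $u_n\colon X\to\mathbb R$ and $u\colon X\to\mathbb R$, write $u_n\to u$ if $\sup_n\|u_n\|_\infty<\infty$ and $\lim_{n\to\infty}\sup_{\|x\|\le r}|u(x)-u_n(x)|=0$ for all $r\ge 0$. $\mathrm{C}_{\mathrm b}$ is the space of all $u\colon X\to\mathbb R$ for which there is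 a sequence $(u_n)\subset\mathrm{Lip}_{\mathrm b}$ with $u_n\to u$. Wasserstein distance. Fix $p\in(1,\infty)$. $\mathcal P_p(X)$ is the set of Borel probability measures on $X$ with finite $p$-th moment, and $\mathcal W_p(\mu,\nu)=\big(\inf_{\pi\in\mathrm{Cpl}(\mu,\nu)}\int_{X\times X}\|y-z\|^p\,\pi(dy,dz)\big)^{1/p}$, where $\mathrm{Cpl}(\mu,\nu)$ is the set of couplings of $\mu$ and $\nu$. Reference model. $(\mu_t)_{t\ge0}\subset\mathcal P_p(X)$ and $\psi_t\colon X\to X$, $t\ge 0$, are continuous maps such that for all $s,t\ge0$, $u\in\mathrm{C}_{\mathrm b}$, $x\in X$, $$\int_X u(\psi_{t+s}(x)+y)\,\mu_{t+s}(dy)=\int_X\int_X u\big(\psi_s(\psi_t(x)+y_t)+y_s\big)\,\mu_s(dy_s)\,\mu_t(dy_t).$$ Standing assumptions: (A1) there is a constant $c\ge0$ with $\|\psi_t(x_1)-\psi_t(x_2)\|\le e^{ct}\|x_1-x_2\|$ for all $t\ge0$, $x_1,x_2\in X$ (this $c$ is fixed); (A2) $K\psi_t(x)=\psi_t(Kx)$ for all $t\ge0$, $x\in X$, $\psi_0(x)=x$ for all $x\in X$, and $\lim_{h\downarrow0}\sup_{\|x\|\le r}\|\psi_h(Kx)-Kx\|=0$ for all $r\ge0$; (A3) $\lim_{h\downarrow0}\int_X\|y\|^p\,\mu_h(dy)=0$. Penalisation. $\varphi\colon[0,\infty)\to[0,\infty]$ is convex and lower semicontinuous, $\varphi(0)=0$,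 $\varphi(v)\ne0$ for some $v>0$, and $v\mapsto\varphi(v^{1/p})$ is convex. Set $\varphi_t(v)=t\varphi(e^{-ct}v/t)$ for $t>0$, $v\ge 0$, and $\varphi_0(v)=\infty$ for $v>0$, $\varphi_0(0)=0$. Operators. $(I(t)u)(x)=\sup_{\nu\in\mathcal P_p(X)}\big(\int_X u(\psi_t(x)+z)\,\nu(dz)-\varphi_t(\mathcal W_p(\mu_t,\nu))\big)$ for $t\ge 0$, $u\in\mathrm{C}_{\mathrm b}$, $x\in X$. For $n\in\mathbb N_0$, $t\ge0$: $I^n(t)u:=I(2^{-n})^kI(t-k2^{-n})u$, where $k\in\mathbb N_0$ is the largest integer with $k2^{-n}\le t$. (Products of operators denote composition.) *)

(* Defs.v *)
From HB Require Import structures.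
From mathcomp Require Import all_boot all_order all_algebra.
From mathcomp Require Import all_classical all_reals all_analysis.

Set Implicit Arguments.
Unset Strict Implicit.
Unset Printing Implicit Defensive.

Import Order.TTheory GRing.Theory Num.Theory numFieldNormedType.Exports.

Local Open Scope classical_set_scope.
Local Open Scope ring_scope.

(* X with its Borel sigma-algebra; the carrier is convertible to X.  On
   [borel X * borel X] the library puts the product sigma-algebra, which is the
   Borel sigma-algebra of the product when X is separable. *)
Notation borel X := (g_sigma_algebraType (@open X)).

Definition separable (T : topologicalType) : Prop :=
  exists2 D : set T, countable D & dense D.

Section function_spaces.
Context {R : realType} {X : completeNormedModType R}.
Implicit Types (K : X -> X) (u : X -> R).

(* The sup is taken in the extended reals, so that it is +oo when unbounded. *)
Definition supnorm u : \bar R := ereal_sup [set `|u x|%:E | x in [set: X]].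

Definition Lip K u : Prop :=
  exists2 L : R, 0 <= L & forall x1 x2, `|u x1 - u x2| <= L * `|K (x1 - x2)|.

Definition Lipb K u : Prop := Lip K u /\ (supnorm u < +oo)%E.

Definition bconv (u_ : nat -> X -> R) u : Prop :=
  (ereal_sup [set supnorm (u_ n) | n in [set: nat]] < +oo)%E /\
  forall r : R, 0 <= r ->
    ereal_sup [set `|u x - u_ n x|%:E | x in [set x | `|x| <= r]]
      @[n --> \oo] --> 0%E.

(* When |K x| <= |x|, each function in Lipb is bounded and continuous, and so is
   every limit of these in the sense of bconv. *)
Definition Cb K u : Prop :=
  exists2 u_ : nat -> X -> R, (forall n, Lipb K (u_ n)) & bconv u_ u.

End function_spaces.

Section wasserstein.
Context {R : realType} {X : completeNormedModType R}.
Implicit Types (p : R) (mu nu : probability (borel X) R).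

Definition Pp p : set (probability (borel X) R) :=
  [set mu : probability (borel X) R | (\int[mu]_y (`|y : X| `^ p)%:E < +oo)%E].

Definition Cpl mu nu : set (probability (borel X * borel X)%type R) :=
  [set pi : probability (borel X * borel X)%type R | forall A : set (borel X), measurable A ->
     pi (A `*` setT) = mu A /\ pi (setT `*` A) = nu A].

(* The infimum is finite for mu, nu in Pp p, the only case in which it is
   used. *)
Definition Wp p mu nu : R :=
  fine (ereal_inf
    [set (\int[pi]_yz (`|(yz.1 : X) - (yz.2 : X)| `^ p)%:E)%E
       | pi in Cpl mu nu]) `^ p^-1.

End wasserstein.

Section operators.
Context {R : realType} {X : completeNormedModType R}.

(* Here 0 * +oo = 0, so the endpoints a = 0 and a = 1 impose no condition. *)
Definition convex_nneg (f : R -> \bar R) : Prop :=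
  forall a v w : R, 0 <= a <= 1 -> 0 <= v -> 0 <= w ->
    (f (a * v + (1 - a) * w)%R <= a%:E * f v + (1 - a)%R%:E * f w)%E.

Definition phi_ (phi : R -> \bar R) (c t v : R) : \bar R :=
  if t == 0 then (if v == 0 then 0%E else +oo%E)
  else (t%:E * phi (expR (- (c * t)) * v / t)%R)%E.

Variables (p : R) (mu : R -> probability (borel X) R) (psi : R -> X -> X).
Variables (c : R) (phi : R -> \bar R).

(* For u in Cb and mu t in Pp p the supremum is finite: it is at most
   sup |u|, and nu := mu t contributes the integral of u (psi t x + .). *)
Definition Iop (t : R) (u : X -> R) (x : X) : R :=
  fine (ereal_sup
    [set (\int[nu]_z (u (psi t x + (z : X))%R)%:E -
          phi_ phi c t (Wp p (mu t) nu))%E | nu in Pp p]).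

Definition Idyad (n : nat) (t : R) (u : X -> R) : X -> R :=
  let h : R := 2 ^- n in
  let k := Num.truncn (t / h) in
  iter k (Iop h) (Iop (t - k%:R * h) u).

Definition Sop (t : R) (u : X -> R) (x : X) : \bar R :=
  ereal_inf [set (Idyad n t u x)%:E | n in [set: nat]].

(* The partition 0 = t_0 < ... < t_m = t is encoded by s = [:: t_1; ...; t_m],
   with [itv_partition 0 t s]; s is nonempty as soon as t != 0. *)
Definition Ipart (s : seq R) (u : X -> R) : X -> R :=
  foldr Iop u (pairmap (fun a b => b - a) 0 s).

End operators.

(* Main.v *)
Require Import Defs.
From HB Require Import structures.
From mathcomp Require Import all_boot all_order all_algebra.
From mathcomp Require Import all_classical all_reals all_analysis.
From mathcomp Require Import measurable_realfun.
From mathcomp Require Import ring lra.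

Set Implicit Arguments.
Unset Strict Implicit.
Unset Printing Implicit Defensive.

Import Order.TTheory GRing.Theory Num.Theory numFieldNormedType.Exports.

Local Open Scope classical_set_scope.
Local Open Scope ring_scope.

(** By convexity of phi the penalty is subadditive in time, which gives the merging
    inequality: I(t) I(s) u is at most I(t + s) u ([Iop_merge]). Hence I(pi) u decreases
    when pi is refined. A dyadic product is the product over a partition, so one of
    the two inequalities is immediate. For the other one, dyadic partitions do not refine
    a given partition, but a sufficiently fine grid does so up to small errors
    ([refine]): merge all dyadic steps up to the one that crosses the first point s of
    the given partition, compare I(s + b) for the small overshoot b with I(s)
    ([Iop_usc]), give the time b back to the remaining steps ([small_step]), and continue
    with the next point of the partition.

    Errors made on a ball have to pass through products of arbitrarily many operators.
    Such a product J is convex, and by merging it is dominated by a single I(t), whose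
    tails are controlled by the superlinear growth of phi. If f exceeds g by little
    on a large ball then J f exceeds J g by little on a given ball, uniformly in the
    number of factors ([stability]). By stability it suffices to argue for bounded
    K-Lipschitz functions u.

    For these, I(t) u (x) is the supremum of E u(psi_t(x) + y + d) - phi_t(a) over pairs
    of random vectors, y with law mu_t and d with p-norm at most a ([Iop_coupling_le],
    [Iop_coupling_near]). The semigroup identity of the reference model determines the law
    of psi_s(psi_t(x) + y) + y' only as far as K-Lipschitz functions can tell. The key
    to working with such laws is [transfer]: a random vector may be exchanged for another
    one with the same law in this sense while the displacement d attached to it is kept. *)

(** * Borel measurability in a separable Banach space *)

Section separable_borel.
Context {R : realType} {X : completeNormedModType R}.

Lemma separable_dense_seq : separable X ->
  exists q : nat -> X, forall (x : X) (e : R), 0 < e -> exists i, `|x - q i| < e.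
Proof.
move=> [D cD dD].
have /pfcard_geP[D0|[f]] := cD.
  by have [|z [_]] := dD setT _ openT; [exists 0|rewrite D0].
exists f => x e e0.
have [|z [xz Dz]] := dD (ball x e) _ (ball_open _ _).
  by exists x; exact: ballxx.
have [i _ fi] := 'surj_f Dz; exists i.
by rewrite fi; move: xz; rewrite -ball_normE.
Qed.

Lemma borel_open_measurable (U : set X) : open U -> measurable (U : set (borel X)).
Proof. by move=> oU; exact: sub_sigma_algebra. Qed.

Lemma measurable_fun_borel d (T : measurableType d) (f : T -> borel X) :
  (forall U : set X, open U -> measurable (f @^-1` U)) -> measurable_fun setT f.
Proof.
move=> h; apply: (@measurability _ _ T (borel X) setT f (@open X)) => //.
by move=> _ [U oU <-]; rewrite setTI; exact: h.
Qed.

Lemma measurable_fun_open d (T : measurableType d) (f : T -> R) :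
  (forall U : set R, open U -> measurable (f @^-1` U)) -> measurable_fun setT f.
Proof.
move=> h; apply: (measurability _ (RGenOpens.measurableE R)).
by move=> _ [_ [a [b ->]] <-]; rewrite setTI; exact/h/interval_open.
Qed.

Lemma continuous_borel (f : X -> X) : continuous f ->
  measurable_fun setT (f : borel X -> borel X).
Proof.
move=> /continuousP cf; apply: measurable_fun_borel => U oU.
by apply: borel_open_measurable; exact: cf.
Qed.

Lemma continuous_borel_real (f : X -> R) : continuous f ->
  measurable_fun setT (f : borel X -> R).
Proof.
move=> /continuousP cf; apply: measurable_fun_open => U oU.
by apply: borel_open_measurable; exact: cf.
Qed.

(** The product carries the product sigma-algebra, so continuity of addition is not
    enough: an open set pulls back to a union of rectangles of balls, and balls of
    radius 1/(n+1) around a dense sequence make this union countable. *)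
Lemma measurable_borelD d (T : measurableType d) (f g : T -> borel X) :
  separable X -> measurable_fun setT f -> measurable_fun setT g ->
  measurable_fun setT ((fun t => (f t : X) + (g t : X)) : T -> borel X).
Proof.
move=> /separable_dense_seq[q qd] mf mg; apply: measurable_fun_borel => U oU.
pose B i n : set X := ball (q i) n.+1%:R^-1.
pose ok (k : nat * nat * nat) := forall a b, B k.1.1 k.2 a -> B k.1.2 k.2 b -> U (a + b).
rewrite (_ : _ @^-1` _ =
   \bigcup_(k in ok) (f @^-1` B k.1.1 k.2 `&` g @^-1` B k.1.2 k.2)); last first.
  apply/seteqP; split => [t /= Ut|t [k kok [/= ? ?]]]; last exact: kok.
  have [e /= e0 eU] : exists2 e : R, 0 < e & ball ((f t : X) + (g t : X)) e `<=` U.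
    have /nbhs_ballP[e e0 ?] := open_nbhs_nbhs (conj oU Ut).
    by exists e.
  pose n := Num.truncn (4 / e).
  have ne : n.+1%:R^-1 < e / 4.
    by rewrite -[e / 4]invrK ltf_pV2 ?posrE ?invf_div ?divr_gt0// truncnS_gt.
  have n0 : 0 < n.+1%:R^-1 :> R by rewrite invr_gt0.
  have [i fi] := qd (f t) _ n0; have [j gj] := qd (g t) _ n0.
  exists (i, j, n); last by split; rewrite /B/= -ball_normE /= distrC.
  move=> a b /=; rewrite /B -!ball_normE /= => qa qb; apply: eU.
  rewrite -ball_normE /=.
  have -> : (f t : X) + g t - (a + b) =
     ((f t : X) - q i) + (q i - a) + (((g t : X) - q j) + (q j - b)).
    by rewrite !addrA !subrK opprD addrACA !addrA.
  apply: (le_lt_trans (ler_normD _ _)).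
  have h1 := ler_normD ((f t : X) - q i) (q i - a).
  have h2 := ler_normD ((g t : X) - q j) (q j - b).
  rewrite [ltRHS](_ : e = e/4 + e/4 + (e/4 + e/4)); last by field.
  by apply: ltrD; [apply: (le_lt_trans h1)|apply: (le_lt_trans h2)];
    apply: ltrD; apply: lt_trans ne.
rewrite bigcup_mkcond; apply: countable_bigcupT_measurable => // k.
case: ifP => // _; apply: measurableI;
  rewrite -[X in measurable X]setTI.
- by apply: mf => //; apply: borel_open_measurable; exact: ball_open.
- by apply: mg => //; apply: borel_open_measurable; exact: ball_open.
Qed.

End separable_borel.

(** * Expectations of bounded functions *)

Section bounded_expectation.
Context d (T : measurableType d) (R : realType).
Implicit Types (P : probability T R) (f g : T -> R).

Definition bmeas (M : R) f := measurable_fun setT f /\ forall x, `|f x| <= M.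

Lemma bmeas_int P M f : bmeas M f -> P.-integrable setT (EFin \o f).
Proof.
move=> [mf bf]; apply: measurable_bounded_integrable => //.
  exact: (le_lt_trans (probability_le1 P measurableT) (ltry 1)).
exists M; split; first exact: num_real.
by move=> a Ma x _; exact: le_trans (bf x) (ltW Ma).
Qed.

Lemma bexpE P M f : bmeas M f -> (\int[P]_x (f x)%:E)%E = (\int[P]_x f x)%:E.
Proof. by move=> /(bmeas_int P) fi; rewrite fineK//; exact: integrable_fin_num. Qed.

Lemma bexp_le P M N f g : bmeas M f -> bmeas N g -> (forall x, f x <= g x) ->
  \int[P]_x f x <= \int[P]_x g x.
Proof. by move=> bf bg fg; apply: le_Rintegral => //;
  [exact: bmeas_int bf|exact: bmeas_int bg]. Qed.

Lemma bexp_cst P a : \int[P]_x a = a.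
Proof.
rewrite Rintegral_cst// [X in fine X](_ : _ = 1%E) ?mulr1//.
exact: probability_setT.
Qed.

Lemma bmeas_cst a : bmeas `|a| (fun=> a).
Proof. by []. Qed.

Lemma bmeasD M N f g : bmeas M f -> bmeas N g -> bmeas (M + N) (fun x => f x + g x).
Proof.
move=> [mf bf] [mg bg]; split; first exact: measurable_funD.
by move=> x; apply: le_trans (ler_normD _ _) _; exact: lerD.
Qed.

Lemma bmeasZ M a f : bmeas M f -> bmeas (`|a| * M) (fun x => a * f x).
Proof.
move=> [mf bf]; split; first exact: measurable_funM.
by move=> x; rewrite normrM ler_wpM2l.
Qed.

Lemma bexpD P M N f g : bmeas M f -> bmeas N g ->
  \int[P]_x (f x + g x) = \int[P]_x f x + \int[P]_x g x.
Proof. by move=> bf bg; apply: RintegralD => //;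
  [exact: bmeas_int bf|exact: bmeas_int bg]. Qed.

Lemma bexpZ P M a f : bmeas M f -> \int[P]_x (a * f x) = a * \int[P]_x f x.
Proof. by move=> bf; apply: RintegralZl => //;
  exact: bmeas_int bf. Qed.

Lemma bexp_shift P M a f : bmeas M f -> \int[P]_x (f x + a) = \int[P]_x f x + a.
Proof. by move=> bf; rewrite (bexpD _ bf (bmeas_cst a)) bexp_cst. Qed.

Lemma bexp_norm P M f : bmeas M f -> `|\int[P]_x f x| <= M.
Proof.
move=> bf; have M0 : 0 <= M by exact: le_trans (normr_ge0 _) (bf.2 point).
rewrite ler_norml; apply/andP; split.
  rewrite -(bexp_cst P (- M)); apply: (bexp_le _ (bmeas_cst _) bf) => x.
  by have := bf.2 x; rewrite ler_norml => /andP[].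
rewrite -(bexp_cst P M); apply: (bexp_le _ bf (bmeas_cst _)) => x.
by have := bf.2 x; rewrite ler_norml => /andP[].
Qed.

Lemma bexp_near P M N f g e : bmeas M f -> bmeas N g ->
  (forall x, `|f x - g x| <= e) -> `|\int[P]_x f x - \int[P]_x g x| <= e.
Proof.
move=> bf bg fge; rewrite ler_distl; apply/andP; split.
  rewrite -(bexp_shift _ _ bg); apply: (bexp_le _ (bmeasD bg (bmeas_cst _)) bf) => x.
  by have := fge x; rewrite ler_distl => /andP[].
rewrite -(bexp_shift _ _ bg); apply: (bexp_le _ bf (bmeasD bg (bmeas_cst _))) => x.
by have := fge x; rewrite ler_distl => /andP[].
Qed.

End bounded_expectation.
Arguments bmeas_cst {d T R} a.

Section pushforward_expectation.
Context d1 d2 (T : measurableType d1) (T' : measurableType d2) (R : realType).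

Lemma bmeas_comp (phi : T -> T') M (f : T' -> R) : measurable_fun setT phi ->
  bmeas M f -> bmeas M (f \o phi).
Proof.
by move=> mphi [mf bf]; split => [|x]; [exact: measurableT_comp|exact: bf].
Qed.

Lemma law_exists (P : probability T R) (phi : T -> T') : measurable_fun setT phi ->
  exists nu : probability T' R,
    [/\ forall A, measurable A -> nu A = P (phi @^-1` A),
        forall g : T' -> \bar R, measurable_fun setT g -> (forall y, 0 <= g y)%E ->
          (\int[nu]_y g y = \int[P]_x g (phi x))%E &
        forall M (f : T' -> R), bmeas M f ->
          \int[nu]_y f y = \int[P]_x f (phi x)].
Proof.
move=> mphi.
pose phiM : {mfun T >-> T'} := HB.pack phi (isMeasurableFun.Build _ _ _ _ _ mphi).
exists (distribution P phiM); split => [//|g mg g0|M f bf].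
  exact: (@ge0_integral_distribution _ _ _ _ _ P phiM).
rewrite /Rintegral (@integral_distribution _ _ _ _ _ P phiM)//.
  by apply/measurable_EFinP; exact: bf.1.
exact: bmeas_int (bmeas_comp mphi bf).
Qed.

End pushforward_expectation.

Lemma ge0_integral_mrestr d (T : measurableType d) (R : realType)
    (m : {measure set T -> \bar R}) (D : set T) (mD : measurable D)
    (g : T -> \bar R) :
  measurable_fun setT g -> (forall x, 0 <= g x)%E ->
  (\int[mrestr m mD]_x g x = \int[m]_(x in D) g x)%E.
Proof.
move=> mg g0; rewrite (@ge0_negligible_integral _ _ _ _ setT (~` D))//.
- rewrite setTD setCK; apply: eq_measure_integral => C mC CD.
  by rewrite /= /mrestr setIidl.
- exact: measurableC.
- by rewrite /= /mrestr setICl measure0.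
Qed.

Lemma probability_of_mass1 d (T : measurableType d) (R : realType)
    (m : {measure set T -> \bar R}) :
  m setT = 1%E -> exists P : probability T R, forall A, P A = m A.
Proof.
move=> m1; exists (mnormalize m (dirac point)) => A.
by rewrite /= /mnormalize m1 onee_eq0/= invr1 mule1.
Qed.

(** * Mixtures and gluing along countable partitions *)

Section mixture.
Context d1 d2 (T : measurableType d1) (T' : measurableType d2) (R : realType).
Variables (P : probability T R) (Q : nat -> probability T' R) (k : T -> nat).
Hypothesis mk : forall i, measurable (k @^-1` [set i]).

Let A i := k @^-1` [set i].
Let D i : set (T * T') := A i `*` setT.
Let mD i : measurable (D i).
Proof. by apply: measurableX => //; exact: mk. Qed.
Let m i := mrestr (P \x Q i)%E (mD i).

Let mixture0 : set (T * T') -> \bar R := mseries m 0.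

Let integral_mrestr i (g : T * T' -> \bar R) : measurable_fun setT g ->
  (forall z, 0 <= g z)%E ->
  (\int[m i]_z g z = \int[P]_(x in A i) \int[Q (k x)]_y g (x, y))%E.
Proof.
move=> mg g0.
rewrite ge0_integral_mrestr//.
rewrite integral_mkcond fubini_tonelli1//; last 2 first.
  by apply/(measurable_restrictT _ _).1 => //; exact: measurable_funTS.
  by move=> z; rewrite patchE; case: ifP.
rewrite [RHS]integral_mkcond; apply: eq_integral => x _.
rewrite /fubini_F patchE; case: ifPn => [|] xA.
  have -> : k x = i by move: xA; rewrite inE.
  apply: eq_integral => y _; rewrite patchE ifT// inE; split => //.
  exact: set_mem.
apply: integral0_eq => y _; rewrite patchE ifF//.
by apply/negbTE; apply: contra xA; rewrite !inE => -[].
Qed.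

Lemma measurable_fun_mixture (g : T * T' -> \bar R) : measurable_fun setT g ->
  (forall z, 0 <= g z)%E ->
  measurable_fun setT (fun x => \int[Q (k x)]_y g (x, y))%E.
Proof.
move=> mg g0.
have <- : \bigcup_i A i = setT by apply/seteqP; split => // x _; exists (k x).
apply/measurable_fun_bigcup => // i.
apply: (eq_measurable_fun (fubini_F (Q i) g)).
  by move=> x; rewrite inE => <-.
by apply: measurable_funTS; exact: measurable_fun_fubini_tonelli_F.
Qed.

Let integral_mixture0 (g : T * T' -> \bar R) : measurable_fun setT g ->
  (forall z, 0 <= g z)%E ->
  (\int[mixture0]_z g z = \int[P]_x \int[Q (k x)]_y g (x, y))%E.
Proof.
move=> mg g0; rewrite /mixture0 ge0_integral_measure_series//.
under eq_eseriesr do rewrite integral_mrestr//.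
have UA : \bigcup_i A i = setT by apply/seteqP; split => // x _; exists (k x).
rewrite -[in RHS]UA ge0_integral_bigcup//.
- by rewrite UA; exact: measurable_fun_mixture.
- by move=> x _; exact: integral_ge0.
- by move=> i j _ _ [x [<- <-]].
Qed.

(** Draw x from P and then y from [Q (k x)]. Since k takes countably many values,
    the joint law is a countable sum of restrictions of product measures. *)
Lemma mixture : exists Pi : probability (T * T')%type R,
  forall g : T * T' -> \bar R, measurable_fun setT g -> (forall z, 0 <= g z)%E ->
  (\int[Pi]_z g z = \int[P]_x \int[Q (k x)]_y g (x, y))%E.
Proof.
have m1 : mixture0 setT = 1%E.
  rewrite -[LHS]mul1e -integral_cst// integral_mixture0//.
  have Q1 x : (\int[Q (k x)]_y (cst 1 (x, y)))%E = 1%E.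
    rewrite (integral_cst _ _ 1)// mul1e; exact: probability_setT.
  under eq_integral do rewrite Q1.
  by rewrite (integral_cst _ _ 1)// mul1e; exact: probability_setT.
have [Pi PiE] := probability_of_mass1 m1.
exists Pi => g mg g0; rewrite -integral_mixture0//.
by apply: eq_measure_integral => C mC _; exact: PiE.
Qed.

End mixture.

Section mixture_bounded.
Context d1 d2 (T : measurableType d1) (T' : measurableType d2) (R : realType).
Variables (P : probability T R) (Q : nat -> probability T' R) (k : T -> nat).
Hypothesis mk : forall i, measurable (k @^-1` [set i]).

Lemma bmeas_mixture M (g : T * T' -> R) : bmeas M g ->
  bmeas M (fun x => \int[Q (k x)]_y g (x, y)).
Proof.
move=> bg; have bgx x : bmeas M (fun y => g (x, y)).
  apply: (bmeas_comp _ bg); exact: measurable_pair1.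
split => [|x]; last exact: bexp_norm.
pose g' z := g z + M.
have bg' : bmeas (M + `|M|) g' := bmeasD bg (bmeas_cst M).
have := @measurable_fun_mixture _ _ _ _ _ Q k mk (fun z => (g' z)%:E).
have H1 : measurable_fun setT (fun z => (g' z)%:E) by apply/measurable_EFinP; exact: bg'.1.
have H2 z : (0 <= (g' z)%:E)%E.
  by rewrite lee_fin -lerBlDr sub0r; have := bg.2 z; rewrite ler_norml => /andP[].
move=> /(_ H1 H2) H.
apply: (eq_measurable_fun (fun x => fine (\int[Q (k x)]_y (g' (x, y))%:E) - M)).
  move=> x _; rewrite -/(Rintegral _ _ _) /g'.
  by rewrite (bexp_shift _ _ (bgx x)) addrK.
by apply: measurable_funB => //; exact: measurableT_comp.
Qed.

Lemma mixture_bexp (Pi : probability (T * T')%type R) :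
  (forall g : T * T' -> \bar R, measurable_fun setT g -> (forall z, 0 <= g z)%E ->
    (\int[Pi]_z g z = \int[P]_x \int[Q (k x)]_y g (x, y))%E) ->
  forall M (g : T * T' -> R), bmeas M g ->
    \int[Pi]_z g z = \int[P]_x \int[Q (k x)]_y g (x, y).
Proof.
move=> PiE M g bg; have bgx x : bmeas M (fun y => g (x, y)).
  apply: (bmeas_comp _ bg); exact: measurable_pair1.
pose g' z := g z + M.
have bg' : bmeas (M + `|M|) g' := bmeasD bg (bmeas_cst M).
have H1 : measurable_fun setT (fun z => (g' z)%:E) by apply/measurable_EFinP; exact: bg'.1.
have H2 z : (0 <= (g' z)%:E)%E.
  by rewrite lee_fin -lerBlDr sub0r; have := bg.2 z; rewrite ler_norml => /andP[].
have := PiE _ H1 H2.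
rewrite (bexpE _ bg') (bexp_shift _ _ bg).
under eq_integral do rewrite (bexpE _ (bmeasD (bgx _) (bmeas_cst M))) (bexp_shift _ _ (bgx _)).
rewrite (bexpE _ (bmeasD (bmeas_mixture bg) (bmeas_cst M))).
by rewrite (bexp_shift _ _ (bmeas_mixture bg)) => -[] /addIr.
Qed.

End mixture_bounded.

Section gluing.
Context d1 d2 (T : measurableType d1) (T' : measurableType d2) (R : realType).

(** The conditional law given A, multiplied out by P A so that a null set A is no
    exception. *)
Lemma conditioning (P : probability T R) (A : set T) : measurable A ->
  exists Q : probability T R, forall g : T -> \bar R,
    measurable_fun setT g -> (forall x, 0 <= g x)%E ->
    (\int[Q]_x g x * P A = \int[P]_(x in A) g x)%E.
Proof.
move=> mA; have [PA0|PA0] := eqVneq (P A) 0%E.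
  exists P => g mg g0; rewrite PA0 mule0 null_set_integral//.
  exact: measurable_funTS.
have PAfin : P A \is a fin_num by exact: fin_num_measure.
have pA : 0 < fine (P A).
  by rewrite fine_gt0// lt0e PA0 measure_ge0/= ltey_eq PAfin.
have pV : 0 <= (fine (P A))^-1 by rewrite invr_ge0 ltW.
pose c := NngNum pV.
have [Q QE] : exists Q : probability T R, forall B, Q B = mscale c (mrestr P mA) B.
  apply: probability_of_mass1.
  by rewrite /= /mscale/= /mrestr setTI -{2}(fineK PAfin) -EFinM mulVf ?gt_eqF.
exists Q => g mg g0.
rewrite (eq_measure_integral (mscale c (mrestr P mA))) => [|B _ _]; last exact: QE.
rewrite ge0_integral_mscale// ge0_integral_mrestr//= muleAC.
by rewrite -{2}(fineK PAfin) -EFinM mulVf ?mul1e ?gt_eqF.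
Qed.

Lemma ge0_integral_cells (P : probability T R) (k : T -> nat) (g : T -> \bar R) :
  (forall i, measurable (k @^-1` [set i])) ->
  measurable_fun setT g -> (forall x, 0 <= g x)%E ->
  (\int[P]_x g x = \sum_(i <oo) \int[P]_(x in k @^-1` [set i]) g x)%E.
Proof.
move=> mk mg g0.
have UA : \bigcup_i (k @^-1` [set i]) = setT.
  by apply/seteqP; split => // x _; exists (k x).
rewrite -[in LHS]UA ge0_integral_bigcup// ?UA// => i j _ _ [x [/= <- <-]] //.
Qed.

Lemma measurable_fun_cells d (U : measurableType d) (k : T -> nat) (phi : nat -> U) :
  (forall i, measurable (k @^-1` [set i])) -> measurable_fun setT (phi \o k).
Proof.
move=> mk; have <- : \bigcup_i (k @^-1` [set i]) = setT.
  by apply/seteqP; split => // x _; exists (k x).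
apply/measurable_fun_bigcup => // i.
apply: (eq_measurable_fun (cst (phi i))); last exact: measurable_cst.
by move=> x; rewrite inE /= => ->.
Qed.

Lemma ge0_integral_cells_cst (P : probability T R) (k : T -> nat) (phi : nat -> \bar R) :
  (forall i, measurable (k @^-1` [set i])) -> (forall i, 0 <= phi i)%E ->
  (\int[P]_x phi (k x) = \sum_(i <oo) phi i * P (k @^-1` [set i]))%E.
Proof.
move=> mk phi0; rewrite (ge0_integral_cells _ mk)//; last exact: measurable_fun_cells.
apply: eq_eseriesr => i _.
rewrite -integral_cst//; apply: eq_integral => x.
by rewrite inE /= => ->.
Qed.

End gluing.

(** Draw x from P, and then y from P' conditioned on carrying the same number as x.
    The second marginal is P' because numbers have the same law under P and P'. *)
Lemma gluing d1 d2 (T : measurableType d1) (T' : measurableType d2) (R : realType)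
    (P : probability T R) (P' : probability T' R) (k : T -> nat) (k' : T' -> nat) :
  (forall i, measurable (k @^-1` [set i])) ->
  (forall i, measurable (k' @^-1` [set i])) ->
  (forall i, P (k @^-1` [set i]) = P' (k' @^-1` [set i])) ->
  exists Pi : probability (T * T')%type R,
    [/\ forall g : T -> \bar R, measurable_fun setT g -> (forall x, 0 <= g x)%E ->
          (\int[Pi]_z g z.1 = \int[P]_x g x)%E,
        forall g : T' -> \bar R, measurable_fun setT g -> (forall x, 0 <= g x)%E ->
          (\int[Pi]_z g z.2 = \int[P']_y g y)%E &
        Pi [set z | k z.1 != k' z.2] = 0%E].
Proof.
move=> mk mk' kk'.
have /choice[Q QE] i := conditioning P' (mk' i).
have [Pi PiE] := mixture P Q mk.
have mne : measurable [set z : T * T' | k z.1 != k' z.2].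
  rewrite (_ : [set _ | _] = ~` \bigcup_i ((k @^-1` [set i]) `*` (k' @^-1` [set i]))).
    apply: measurableC; apply: bigcupT_measurable => i; exact: measurableX.
  apply/seteqP; split => z /=.
    by move=> /eqP kz [i _ [/= k1 k2]]; apply: kz; rewrite k1 k2.
  by move=> kz; apply/eqP => e; apply: kz; exists (k z.1).
exists Pi; split => [g mg g0|g mg g0|].
- rewrite PiE//; last exact: measurableT_comp.
  apply: eq_integral => x _; rewrite /= integral_cst//.
  by rewrite [X in (_ * X)%E](_ : _ = 1%E) ?mule1//; exact: probability_setT.
- rewrite PiE//; last exact: measurableT_comp.
  rewrite /= (ge0_integral_cells_cst P (phi := fun i => \int[Q i]_y g y)%E)//; last first.
    by move=> i; exact: integral_ge0.
  rewrite (ge0_integral_cells P' mk')//; apply: eq_eseriesr => i _.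
  by rewrite kk' QE.
- rewrite -[LHS]mul1e -[LHS]integral_cst// integral_mkcond PiE//; last 2 first.
  + by apply/(measurable_restrictT _ _).1 => //; exact: measurable_cst.
  + by move=> z; rewrite patchE; case: ifP.
  rewrite (eq_integral (fun x => \int[Q (k x)]_y
      ((cst 1%E : T' -> \bar R) \_ [set y | k' y != k x]) y)%E); last first.
    move=> x _; apply: eq_integral => y _; rewrite !patchE.
    by congr (if _ then _ else _); apply/idP/idP; rewrite !inE/= eq_sym.
  have mi i : measurable [set y | k' y != i].
    rewrite (_ : [set _ | _] = ~` (k' @^-1` [set i])); first exact: measurableC.
    by apply/seteqP; split => y /= /eqP.
  rewrite (ge0_integral_cells_cst P (phi := fun i => \int[Q i]_y
      ((cst 1%E : T' -> \bar R) \_ [set y | k' y != i]) y)%E)//; last first.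
    by move=> i; apply: integral_ge0 => y _; rewrite patchE; case: ifP.
  apply: eseries0 => i _ _; rewrite kk' QE.
  + apply: integral0_eq => y /= k'y; rewrite patchE ifF//.
    by apply/negbTE; rewrite notin_setE /= k'y eqxx.
  + by apply/(measurable_restrictT _ _).1 => //; exact: measurable_cst.
  + by move=> y; rewrite patchE; case: ifP.
Qed.

(** * Moments *)

Section moments.
Context d (T : measurableType d) (R : realType) (P : probability T R) (p : R).
Hypothesis p1 : 1 < p.
Implicit Types (f g h : T -> R) (a b : R).

(** The p-norm of f is at most a. The bound is put on p-th powers, which are
    integrals of nonnegative functions and so pass through changes of variable. *)
Definition moment_le f a :=
  0 <= a /\ (\int[P]_x (`|f x| `^ p)%:E <= (a `^ p)%:E)%E.

Let p0 : 0 < p. Proof. exact: lt_trans p1. Qed.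
Let pN0 : p != 0. Proof. by rewrite gt_eqF. Qed.

Lemma measurable_powR_norm f : measurable_fun setT f ->
  measurable_fun setT (fun x => (`|f x| `^ p)%:E).
Proof.
move=> mf; apply/measurable_EFinP.
have mnf : measurable_fun setT (fun x => `|f x|) by exact: measurableT_comp.
exact: (measurableT_comp (measurable_powR p) mnf).
Qed.

Let Lnorm_pow f :
  (Lnorm P p%:E (EFin \o f) `^ p = \int[P]_x (`|f x| `^ p)%:E)%E.
Proof.
by rewrite poweR_Lnorm//; apply: eq_integral => x _ /=; rewrite poweR_EFin.
Qed.

Let powRK a : 0 <= a -> (a `^ p) `^ p^-1 = a.
Proof. by move=> a0; rewrite -powRrM mulfV// powRr1. Qed.

Lemma moment_le_Lnorm f a :
  moment_le f a <-> 0 <= a /\ (Lnorm P p%:E (EFin \o f) <= a%:E)%E.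
Proof.
have N0 := Lnorm_ge0 P p%:E (EFin \o f).
split => -[a0 H]; split => //.
  move: H; rewrite -Lnorm_pow; case: (Lnorm _ _ _) N0 => [r||//].
    rewrite !lee_fin => r0 H.
    rewrite -(powRK r0) -(powRK a0) ge0_ler_powR ?invr_ge0 ?nnegrE ?powR_ge0//.
    exact: ltW.
  by rewrite poweRyr// leNgt ltry.
rewrite -Lnorm_pow; case: (Lnorm _ _ _) N0 H => [r||//].
  rewrite !lee_fin => r0 ra.
  by rewrite ge0_ler_powR ?nnegrE// ltW.
by move=> _; rewrite leNgt ltry.
Qed.

Lemma moment_leD f g a b : measurable_fun setT f -> measurable_fun setT g ->
  moment_le f a -> moment_le g b -> moment_le (fun x => f x + g x) (a + b).
Proof.
move=> mf mg /moment_le_Lnorm[a0 fa] /moment_le_Lnorm[b0 gb].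
apply/moment_le_Lnorm; split; first exact: addr_ge0.
apply: le_trans (minkowski_EFin P mf mg (ltW p1)) _.
by rewrite EFinD; exact: leeD.
Qed.

Lemma moment_le_dom f g a : measurable_fun setT f -> measurable_fun setT g ->
  (forall x, `|f x| <= `|g x|) -> moment_le g a -> moment_le f a.
Proof.
move=> mf mg fg [a0 H]; split => //; apply: le_trans H.
apply: ge0_le_integral => //; try exact: measurable_powR_norm.
by move=> x _; rewrite lee_fin ge0_ler_powR ?nnegrE// ltW.
Qed.

Lemma moment_leZ f a k : 0 <= k -> measurable_fun setT f ->
  moment_le f a -> moment_le (fun x => k * f x) (k * a).
Proof.
move=> k0 mf [a0 H]; split; first exact: mulr_ge0.
under eq_integral do rewrite normrM powRM// (ger0_norm k0) EFinM.
rewrite ge0_integralZl_EFin ?powR_ge0//; last exact: measurable_powR_norm.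
by rewrite powRM// EFinM lee_wpmul2l// lee_fin powR_ge0.
Qed.

Lemma moment_le1 f a : measurable_fun setT f -> moment_le f a ->
  (\int[P]_x `|f x|%:E <= a%:E)%E.
Proof.
move=> mf /moment_le_Lnorm[a0 fa]; apply: le_trans fa.
have q0 : 0 < p / (p - 1) by rewrite divr_gt0// subr_gt0.
have pq : p^-1 + (p / (p - 1))^-1 = 1.
  by rewrite invf_div -{1}(div1r p) -mulrDl subrKC mulfV.
have := hoelder P mf (measurable_cst (1 : R)) p0 q0 pq.
rewrite [X in (_ <= _ * X)%E -> _](_ : _ = 1%E); last first.
  rewrite -[X in Lnorm P _ X]/(cst 1%E) Lnorm_cst1.
  by rewrite [X in poweR X _](_ : _ = 1%E) ?poweR1r//; exact: probability_setT.
rewrite mule1; apply: le_trans; rewrite Lnorm1 le_eqVlt; apply/orP; left.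
by apply/eqP/eq_integral => x _ /=; rewrite mulr1.
Qed.

Lemma moment_exists f : (\int[P]_x (`|f x| `^ p)%:E < +oo)%E ->
  exists2 a, 0 <= a & (\int[P]_x (`|f x| `^ p)%:E = (a `^ p)%:E)%E.
Proof.
move=> foo; have I0 : (0 <= \int[P]_x (`|f x| `^ p)%:E)%E.
  by apply: integral_ge0 => x _; rewrite lee_fin powR_ge0.
exists (fine (\int[P]_x (`|f x| `^ p)%:E) `^ p^-1); first exact: powR_ge0.
by rewrite -powRrM mulVf// powRr1 ?fine_ge0// fineK// ge0_fin_numE.
Qed.

End moments.

Lemma moment_law d d' (T : measurableType d) (T' : measurableType d') (R : realType)
    (p : R) (P : probability T R) (Q : probability T' R) (h : T -> T') (f : T' -> R) a :
  measurable_fun setT f ->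
  (forall g : T' -> \bar R, measurable_fun setT g -> (forall x, 0 <= g x)%E ->
    (\int[P]_z g (h z) = \int[Q]_x g x)%E) ->
  moment_le Q p f a -> moment_le P p (fun z => f (h z)) a.
Proof.
move=> mf H [a0 fa]; split => //.
rewrite (H (fun x => (`|f x| `^ p)%:E))//; first exact: measurable_powR_norm.
Qed.

(** * Countable partitions into small cells *)

Section cells.
Context {R : realType} {X : completeNormedModType R}.
Hypothesis sepX : separable X.

Lemma measurable_fibres d (T : measurableType d) (k : T -> nat) :
  (forall n, measurable [set x | (k x < n)%N]) ->
  forall i, measurable (k @^-1` [set i]).
Proof.
move=> mk i; rewrite (_ : _ @^-1` _ =
  [set x | (k x < i.+1)%N] `\` [set x | (k x < i)%N]); first exact: measurableD.
apply/seteqP; split => x /=; first by move=> ->; rewrite ltnS leqnn ltnn.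
by rewrite ltnS => -[ki /negP]; rewrite -leqNgt => ik; apply/eqP; rewrite eqn_leq ki.
Qed.

(** Number x by the first term of a dense sequence at distance less than e: the
    points with number less than n form a finite union of balls. *)
Lemma cells_exist (e : R) : 0 < e -> exists (q : nat -> X) (k : X -> nat),
  (forall x, `|x - q (k x)| < e) /\
  (forall n x, (k x < n)%N = [exists j : 'I_n, `|x - q j| < e]).
Proof.
move=> e0; have [q qd] := separable_dense_seq sepX.
have qe x : exists i, `|x - q i| < e by exact: qd.
exists q, (fun x => ex_minn (qe x)); split => [x|n x]; case: ex_minnP => m // xm mmin.
apply/idP/existsP => [mn|[j xj]]; first by exists (Ordinal mn).
exact: leq_ltn_trans (mmin _ xj) (ltn_ord j).
Qed.

Lemma cells_measurable (e : R) (q : nat -> X) (k : X -> nat) : 0 < e ->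
  (forall n x, (k x < n)%N = [exists j : 'I_n, `|x - q j| < e]) ->
  forall n, measurable ([set x | (k x < n)%N] : set (borel X)).
Proof.
move=> e0 kE n; rewrite (_ : [set _ | _] = \bigcup_(j in `I_n) ball (q j) e).
  apply: bigcup_measurable => j _; apply: borel_open_measurable; exact: ball_open.
apply/seteqP; split => x /=; rewrite kE.
  by move=> /existsP[j xj]; exists j => //=; rewrite -ball_normE /= distrC.
move=> [j /= jn]; rewrite -ball_normE /= distrC => xj.
by apply/existsP; exists (Ordinal jn).
Qed.

Lemma cells_tail d (T : measurableType d) (P : probability T R) (k : T -> nat) (e : R) :
  (forall n, measurable [set x | (k x < n)%N]) -> 0 < e ->
  exists N, (P [set x | (N <= k x)%N] <= e%:E)%E.
Proof.
move=> mk e0.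
have mF n : measurable [set x | (n <= k x)%N].
  rewrite (_ : [set _ | _] = ~` [set x | (k x < n)%N]); first exact: measurableC.
  by apply/seteqP; split => x /=; [move=> nk; apply/negP|move/negP];
    rewrite -leqNgt.
have := @nonincreasing_cvg_mu _ T R P (fun n => [set x | (n <= k x)%N]).
rewrite (_ : \bigcap_n _ = set0); last first.
  by apply/seteqP; split => // x /(_ (k x).+1 I) /=; rewrite ltnn.
rewrite measure0 => H.
have /H {}H : (P [set x | (0 <= k x)%N] < +oo)%E.
  exact: (le_lt_trans (probability_le1 P (mF 0%N)) (ltry 1)).
have /(H mF measurable0) : nonincreasing_seq (fun n => [set x | (n <= k x)%N]).
  by move=> m n mn; apply/subsetPset => x /=; exact: leq_trans.
move=> /fine_cvgP[_] /cvgr_lt /(_ e e0) [N _ HN].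
exists N; rewrite -[leLHS]fineK ?fin_num_measure// lee_fin ltW//.
exact: (HN N (leqnn N)).
Qed.

(** The indicator of a positivity set is the increasing limit of min(1, n h), which
    inherits Lipschitz continuity from h. *)
Lemma measure_gt0_lim d (T : measurableType d) (P : probability T R) (h : T -> R) :
  measurable_fun setT h -> (forall x, 0 <= h x) ->
  P [set x | 0 < h x] =
    limn (fun n => \int[P]_x (Num.min 1 (n%:R * h x))%:E)%E.
Proof.
move=> mh h0.
have mhp : measurable [set x | 0 < h x].
  rewrite (_ : [set _ | _] = h @^-1` `]0, +oo[).
    by rewrite -[X in measurable X]setTI; exact: mh.
  by apply/seteqP; split => x /=; rewrite in_itv/= andbT.
rewrite -monotone_convergence//.
- rewrite -[LHS]mul1e -integral_cst// integral_mkcond; apply: eq_integral => x _.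
  rewrite patchE; have := h0 x; rewrite le_eqVlt => /predU1P[hx|hx].
    rewrite ifF; last by apply/negbTE; rewrite notin_setE /= -hx ltxx.
    apply/esym/cvg_lim => //; rewrite -hx.
    under eq_fun do rewrite mulr0 min_r//; exact: cvg_cst.
  rewrite ifT ?inE//; apply/esym/cvg_lim => //.
  apply: cvg_near_cst; exists (Num.truncn (h x)^-1).+1 => // n /= nx.
  apply/eqP; rewrite eqe; apply/eqP/min_l.
  rewrite -ler_pdivrMr// div1r; apply/ltW/(lt_le_trans (truncnS_gt _)).
  by rewrite ler_nat.
- move=> n; apply/measurable_EFinP; apply: measurable_minr => //.
  exact: measurable_funM.
- by move=> n x _; rewrite lee_fin le_min ler01 mulr_ge0.
- move=> x _ m n mn; rewrite lee_fin le_min !ge_min lexx/=.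
  by rewrite ler_wpM2r ?orbT// ler_nat.
Qed.

End cells.

(** * Laws tested against K-Lipschitz functions *)

Section compact_lipschitz.
Context {R : realType} {X : completeNormedModType R}.
Context (K : {linear X -> X}).
Hypothesis K_contr : forall x, `|K x| <= `|x|.
Implicit Types (L M : R) (u v : X -> R).

Definition klip L u :=
  0 <= L /\ forall x1 x2, `|u x1 - u x2| <= L * `|K (x1 - x2)|.

Definition klipb L M u := klip L u /\ forall x, `|u x| <= M.

Lemma lipschitz_continuous (V : normedModType R) L (f : X -> V) :
  (forall x1 x2, `|f x1 - f x2| <= L * `|x1 - x2|) -> continuous f.
Proof.
move=> fL x; apply/cvgrPdist_le => e e0.
near=> y; apply: (le_trans (fL _ _)).
have L0 : 0 < `|L| + 1 by rewrite ltr_wpDl.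
apply: (@le_trans _ _ ((`|L| + 1) * `|x - y|)).
  by rewrite ler_wpM2r// (le_trans (ler_norm _))// lerDl.
rewrite mulrC -ler_pdivlMr//.
near: y; apply: cvgr_dist_le; [exact: cvg_id|exact: divr_gt0].
Unshelve. all: by end_near. Qed.

Lemma K_measurable : measurable_fun setT (K : borel X -> borel X).
Proof.
apply: continuous_borel; apply: (@lipschitz_continuous _ 1) => x1 x2.
by rewrite -linearB mul1r.
Qed.

Lemma klip_dist L u x1 x2 : klip L u -> `|u x1 - u x2| <= L * `|x1 - x2|.
Proof. by move=> [L0 uL]; apply: le_trans (uL _ _) _; rewrite ler_wpM2l. Qed.

Lemma klipb_bmeas L M u : klipb L M u -> bmeas M (u : borel X -> R).
Proof.
move=> [uL uM]; split => //; apply: continuous_borel_real.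
by apply: (@lipschitz_continuous _ L) => x1 x2; exact: klip_dist.
Qed.

Lemma klipb_Lipb L M u : klipb L M u -> Lipb K u.
Proof.
move=> [[L0 uL] uM]; split; first by exists L.
apply: (@le_lt_trans _ _ M%:E); last exact: ltry.
by apply: ge_ereal_sup => _ [x _ <-]; rewrite lee_fin.
Qed.

Lemma Lipb_klipb u : Lipb K u -> exists L M, klipb L M u.
Proof.
move=> [[L L0 uL] ub]; exists L, (fine (supnorm u)); split => // x.
have ux y : ((`|u y|)%:E <= supnorm u)%E by apply: ereal_sup_ubound; exists y.
rewrite -lee_fin fineK ?ux// ge0_fin_numE//.
by apply: le_trans (ux 0); rewrite lee_fin.
Qed.

Lemma klip_comp_shift L M u a : klipb L M u -> klipb L M (fun y => u (a + y)).
Proof.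
move=> [[L0 uL] uM]; split => //; split => // x1 x2.
by have := uL (a + x1) (a + x2); rewrite opprD addrACA subrr add0r.
Qed.

(** Bounded K-Lipschitz functions see a random vector only through its image under
    K. The semigroup identity of the reference model gives equality of laws in
    this sense only. *)
Definition same_klaw d d' (T : measurableType d) (T' : measurableType d')
    (P : probability T R) (Y : T -> borel X)
    (P' : probability T' R) (Y' : T' -> borel X) :=
  forall v, Lipb K v -> \int[P]_w v (Y w) = \int[P']_w v (Y' w).

Section transfer.
Context d (T : measurableType d) (P : probability T R) (Y D : T -> borel X).
Context d' (T' : measurableType d') (P' : probability T' R) (Y' : T' -> borel X).
Hypothesis sepX : separable X.
Hypotheses (mY : measurable_fun setT Y) (mD : measurable_fun setT D).
Hypothesis mY' : measurable_fun setT Y'.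
Hypothesis YY' : same_klaw P Y P' Y'.

Lemma klaw_gt0 L (g : X -> R) : klip L g -> (forall x, 0 <= g x) ->
  P [set w | 0 < g (Y w)] = P' [set w | 0 < g (Y' w)].
Proof.
move=> gL g0.
have mg : measurable_fun setT (g : borel X -> R).
  apply: continuous_borel_real.
  by apply: (@lipschitz_continuous _ L) => x1 x2; exact: klip_dist.
have -> := measure_gt0_lim P (measurableT_comp mg mY) (fun w => g0 (Y w)).
have -> := measure_gt0_lim P' (measurableT_comp mg mY') (fun w => g0 (Y' w)).
congr (limn _); apply/funext => n.
have vn : klipb (n%:R * L) 1 (fun x => Num.min 1 (n%:R * g x)).
  split; last first.
    by move=> x; rewrite ger0_norm ?ge_min ?lexx// le_min ler01 mulr_ge0.
  split; first by rewrite mulr_ge0// gL.1.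
  move=> x1 x2; rewrite -mulrA.
  apply: (@le_trans _ _ `|n%:R * g x1 - n%:R * g x2|); last first.
    by rewrite -mulrBr normrM normr_nat ler_wpM2l// gL.2.
  rewrite !ler_norml.
  have := ler_norm (n%:R * g x1 - n%:R * g x2).
  have := ler_norm (- (n%:R * g x1 - n%:R * g x2)); rewrite normrN.
  by rewrite /Num.min; case: ifP; case: ifP; lra.
rewrite (bexpE _ (bmeas_comp mY (klipb_bmeas vn))) (YY' (klipb_Lipb vn)).
by rewrite (bexpE _ (bmeas_comp mY' (klipb_bmeas vn))).
Qed.

(** The event is the positivity set of a K-Lipschitz function of Y, namely the sum
    of the n tent functions of radius e around q 0, ..., q (n-1), taken at K Y. *)
Lemma klaw_cells (e : R) (q : nat -> X) (k : X -> nat) :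
  (forall n x, (k x < n)%N = [exists j : 'I_n, `|x - q j| < e]) ->
  forall n, P [set w | (k (K (Y w)) < n)%N] = P' [set w | (k (K (Y' w)) < n)%N].
Proof.
move=> kE n; pose g (x : X) : R := \sum_(j < n) Num.max 0 (e - `|K x - q j|).
have gL : klip n%:R g.
  split=> // x1 x2; rewrite /g -sumrB; apply: le_trans (ler_norm_sum _ _ _) _.
  rewrite mulr_natl -[X in _ *+ X](card_ord n) -sumr_const; apply: ler_sum => j _.
  rewrite linearB.
  have H : `| `|K x1 - q j| - `|K x2 - q j| | <= `|K x1 - K x2|.
    apply: le_trans (ler_dist_dist _ _) _.
    by rewrite opprB addrA subrK.
  apply: le_trans H; rewrite /Num.max.
  have := ler_norm (`|K x1 - q j| - `|K x2 - q j|).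
  have := ler_norm (- (`|K x1 - q j| - `|K x2 - q j|)); rewrite normrN ler_norml.
  by case: ifP; case: ifP; lra.
have g0 x : 0 <= g x by apply: sumr_ge0 => j _; rewrite le_max lexx.
have kg x : (k (K x) < n)%N = (0 < g x).
  rewrite kE; apply/existsP/idP => [[j xj]|].
    rewrite lt0r g0 andbT psumr_neq0//; last by move=> i _; rewrite le_max lexx.
    by apply/hasP; exists j; rewrite ?mem_index_enum//= lt_max subr_gt0 xj orbT.
  rewrite lt0r psumr_neq0 => [/andP[/hasP[j _ /=]]|i _]; last by rewrite le_max lexx.
  by rewrite lt_max ltxx/= subr_gt0 => xj _; exists j.
rewrite [X in P X](_ : _ = [set w | 0 < g (Y w)]).
  rewrite (klaw_gt0 gL g0); congr (P' _).
  by apply/seteqP; split => x /=; rewrite kg.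
by apply/seteqP; split => x /=; rewrite kg.
Qed.

(** Y may be replaced by Y' inside a K-Lipschitz function even when a further
    displacement D, correlated with Y, is added. Number the values of K by small
    cells: K Y and K Y' charge each cell equally, so the two spaces can be glued
    along the cells. Then K Y and K Y' are almost surely close, while the law of D
    is kept. *)
Lemma transfer L M (f : X -> R) (a : X) (e : R) : klipb L M f -> 0 < e ->
  exists Pi : probability (T' * T)%type R,
    [/\ forall g : T' -> \bar R, measurable_fun setT g -> (forall x, 0 <= g x)%E ->
          (\int[Pi]_z g z.1 = \int[P']_w g w)%E,
        forall g : T -> \bar R, measurable_fun setT g -> (forall x, 0 <= g x)%E ->
          (\int[Pi]_z g z.2 = \int[P]_w g w)%E &
        \int[P]_w f (a + Y w + D w) <= \int[Pi]_z f (a + Y' z.1 + D z.2) + e].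
Proof.
move=> fL e0; have M0 : 0 <= M by exact: le_trans (fL.2 0).
have L1 : 0 < L + 1 by rewrite ltr_wpDl// fL.1.1.
(* Two points of a common cell are at distance less than 2 r. *)
pose r := e / 2 / (L + 1).
have r0 : 0 < r by rewrite !divr_gt0.
have [q [k [kq kE]]] := cells_exist sepX r0.
have mk := cells_measurable r0 kE.
have mkK n : measurable [set x : borel X | (k (K x) < n)%N].
  by rewrite -[X in measurable X]setTI; exact: (K_measurable measurableT (mk n)).
have mkY n : measurable [set w | (k (K (Y w)) < n)%N].
  by rewrite -[X in measurable X]setTI; exact: (mY measurableT (mkK n)).
have mkY' n : measurable [set w | (k (K (Y' w)) < n)%N].
  by rewrite -[X in measurable X]setTI; exact: (mY' measurableT (mkK n)).
have mk1 := measurable_fibres mkY'.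
have mk2 := measurable_fibres mkY.
have kk i : P' ((fun w => k (K (Y' w))) @^-1` [set i]) =
            P ((fun w => k (K (Y w))) @^-1` [set i]).
  have H d0 (T0 : measurableType d0) (m : probability T0 R) (h : T0 -> nat) :
      (forall n, measurable [set x | (h x < n)%N]) ->
      (m (h @^-1` [set i]) = m [set x | (h x < i.+1)%N] - m [set x | (h x < i)%N])%E.
    move=> mh; rewrite [X in (_ = m X - _)%E](_ : _ =
        (h @^-1` [set i]) `|` [set x | (h x < i)%N]).
      rewrite measureU ?addeK ?fin_num_measure//; first exact: measurable_fibres.
      by apply/seteqP; split => x //= [->]; rewrite ltnn.
    apply/seteqP; split => x /=; rewrite ltnS (leq_eqVlt (h x) i).
      by move=> /orP[/eqP|]; [left|right].
    by move=> [->|->]; rewrite ?eqxx ?orbT.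
  by rewrite (H _ _ P' _ mkY') (H _ _ P _ mkY) !(klaw_cells kE).
have [Pi [Pi1 Pi2 Pi0]] := gluing mk1 mk2 kk.
have mkne : measurable [set z : T' * T | k (K (Y' z.1)) != k (K (Y z.2))].
  rewrite (_ : [set _ | _] = ~` \bigcup_i (((fun w => k (K (Y' w))) @^-1` [set i])
      `*` ((fun w => k (K (Y w))) @^-1` [set i]))).
    by apply: measurableC; apply: bigcupT_measurable => i; exact: measurableX.
  apply/seteqP; split => z /=.
    by move=> /eqP kz [i _ [/= k1 k2]]; apply: kz; rewrite k1 k2.
  by move=> kz; apply/eqP => E; apply: kz; exists (k (K (Y' z.1))).
pose ne z := \1_[set z : T' * T | k (K (Y' z.1)) != k (K (Y z.2))] z : R.
pose h1 (z : T' * T) := f (a + Y z.2 + D z.2).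
pose h2 (z : T' * T) := f (a + Y' z.1 + D z.2).
have mf := (klipb_bmeas fL).
have mcst : measurable_fun setT (fun _ : T' * T => a : borel X) by exact: measurable_cst.
have bh1 : bmeas M h1.
  apply: (bmeas_comp _ mf); apply: measurable_borelD => //; last exact: measurableT_comp.
  by apply: measurable_borelD => //; exact: measurableT_comp.
have bh2 : bmeas M h2.
  apply: (bmeas_comp _ mf); apply: measurable_borelD => //; last exact: measurableT_comp.
  by apply: measurable_borelD => //; exact: measurableT_comp.
have bne : bmeas 1 ne.
  split; first exact: measurable_indic.
  by move=> z; rewrite /ne indicE; case: (_ \in _); rewrite ?normr1 ?normr0.
have ne0 : \int[Pi]_z ne z = 0.
  rewrite /Rintegral [X in fine X](_ : _ = 0%E)// integral_indic// setIT.
  exact: Pi0.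
have h12 z : h1 z <= h2 z + (2 * M) * ne z + e.
  rewrite /ne indicE; case: (boolP (k (K (Y' z.1)) == k (K (Y z.2)))) => kz.
    rewrite memNset /= ?mulr0 ?addr0; last by rewrite /= kz.
    have := fL.1.2 (a + Y z.2 + D z.2) (a + Y' z.1 + D z.2).
    rewrite opprD addrACA subrr addr0 opprD addrACA subrr add0r linearB => H.
    have H2 : `|K (Y z.2) - K (Y' z.1)| <= 2 * r.
      have A1 := kq (K (Y z.2)); have A2 := kq (K (Y' z.1)).
      rewrite (eqP kz) in A2.
      apply: (le_trans (ler_distD (q (k (K (Y z.2)))) _ _)).
      by rewrite [X in _ + X]distrC; lra.
    have H3 : L * `|K (Y z.2) - K (Y' z.1)| <= e.
      apply: (@le_trans _ _ ((L + 1) * (2 * r))); last first.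
        by rewrite [leLHS](_ : _ = e)// /r; field; rewrite gt_eqF.
      by apply: ler_pM => //; [exact: fL.1.1|lra].
    have := ler_norm (h1 z - h2 z); rewrite /h1 /h2; lra.
  rewrite mem_set/= ?mulr1//.
  have := fL.2 (a + Y z.2 + D z.2); have := fL.2 (a + Y' z.1 + D z.2).
  by rewrite !ler_norml /h1 /h2; lra.
exists Pi; split => //.
have -> : \int[P]_w f (a + Y w + D w) = \int[Pi]_z h1 z.
  pose F w := f (a + Y w + D w).
  have bF : bmeas M F.
    apply: (bmeas_comp _ mf); apply: measurable_borelD => //.
    by apply: measurable_borelD => //; exact: measurable_cst.
  have bFM : bmeas (M + `|M|) (fun w => F w + M) := bmeasD bF (bmeas_cst M).
  have bhM : bmeas (M + `|M|) (fun z => h1 z + M) := bmeasD bh1 (bmeas_cst M).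
  apply: (addIr M); rewrite -(bexp_shift P M bF) -(bexp_shift Pi M bh1).
  rewrite /Rintegral; congr fine.
  rewrite -(Pi2 (fun w => (F w + M)%:E))//.
    by apply/measurable_EFinP; exact: bFM.1.
  by move=> w; rewrite lee_fin; have := bF.2 w; rewrite ler_norml; lra.
have B1 := bmeasD bh2 (bmeasZ (2 * M) bne).
rewrite -(bexp_shift Pi e bh2).
apply: (@le_trans _ _ (\int[Pi]_z (h2 z + 2 * M * ne z + e))).
  exact: bexp_le bh1 (bmeasD B1 (bmeas_cst e)) _.
rewrite (bexp_shift Pi e B1) (bexpD Pi bh2 (bmeasZ (2 * M) bne)) (bexpZ Pi _ bne) ne0.
by rewrite mulr0 addr0 (bexp_shift Pi e bh2).
Qed.

End transfer.
End compact_lipschitz.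

(** * The penalisation *)

Section penalty.
Context {R : realType} (p c : R) (phi : R -> \bar R).
Hypotheses (p1 : 1 < p) (c0 : 0 <= c).
Hypothesis phi_ge0 : forall v, 0 <= v -> (0 <= phi v)%E.
Hypothesis phi_convex : convex_nneg phi.
Hypothesis phi0 : phi 0 = 0%E.
Hypothesis phi_neq0 : exists2 v, 0 < v & phi v <> 0%E.
Hypothesis phi_pconvex : convex_nneg (fun v => phi (v `^ p^-1)).

Notation pen := (phi_ phi c).

Let p0 : 0 < p. Proof. exact: lt_trans p1. Qed.
Let pN0 : p != 0. Proof. by rewrite gt_eqF. Qed.
Let powRK a : 0 <= a -> (a `^ p) `^ p^-1 = a.
Proof. by move=> a0; rewrite -powRrM mulfV// powRr1. Qed.

(** Convexity on the segment from 0, where phi vanishes, to w. *)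
Lemma phi_nondecreasing v w : 0 <= v -> v <= w -> (phi v <= phi w)%E.
Proof.
move=> v0 vw; have w0 := le_trans v0 vw.
move: vw; rewrite le_eqVlt => /predU1P[->//|vw].
have wp : 0 < w by exact: le_lt_trans vw.
have a01 : 0 <= v / w <= 1 by rewrite divr_ge0//= ler_pdivrMr// mul1r ltW.
have := phi_convex a01 w0 (lexx 0).
rewrite divfK ?gt_eqF// mulr0 addr0 phi0 mule0 adde0 => /le_trans; apply.
have pw := phi_ge0 w0.
by rewrite -[leRHS]mul1e lee_wpmul2r// lee_fin; case/andP: a01.
Qed.

Lemma pen_ge0 t v : 0 <= t -> 0 <= v -> (0 <= pen t v)%E.
Proof.
move=> t0 v0; rewrite /phi_; case: ifP => _; first by case: ifP.
by rewrite mule_ge0 ?lee_fin// phi_ge0// divr_ge0// mulr_ge0// expR_ge0.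
Qed.

Lemma pen_nondecreasing t v w : 0 <= t -> 0 <= v -> v <= w -> (pen t v <= pen t w)%E.
Proof.
move=> t0 v0 vw; rewrite /phi_; case: ifPn => [_|tN0].
  case: ifPn => [_|v00]; first by case: ifP; rewrite ?leey.
  by rewrite ifF// gt_eqF// (lt_le_trans _ vw)// lt0r v00.
rewrite lee_wpmul2l ?lee_fin//; apply: phi_nondecreasing.
  by rewrite divr_ge0// mulr_ge0// expR_ge0.
by rewrite ler_wpM2r ?invr_ge0// ler_wpM2l// expR_ge0.
Qed.

Lemma pen0 t : pen t 0 = 0%E.
Proof. by rewrite /phi_ eqxx; case: ifP => // _; rewrite mulr0 mul0r phi0 mule0. Qed.

Lemma pen_time0 v : 0 < v -> pen 0 v = +oo%E.
Proof. by move=> v0; rewrite /phi_ eqxx gt_eqF. Qed.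

(** Both sides evaluate phi at the same argument; only the factor in front drops,
    from s + b to s. *)
Lemma pen_rescale s b a : 0 < s -> 0 <= b -> 0 <= a ->
  (pen s (s * expR (- (c * b)) / (s + b) * a) <= pen (s + b) a)%E.
Proof.
move=> s0 b0 a0; have sb0 : 0 < s + b by rewrite ltr_wpDr.
rewrite /phi_ (gt_eqF s0) (gt_eqF sb0).
have -> : expR (- (c * s)) * (s * expR (- (c * b)) / (s + b) * a) / s =
    expR (- (c * (s + b))) * a / (s + b).
  rewrite mulrDr opprD expRD; field; by rewrite (gt_eqF s0) (gt_eqF sb0).
rewrite lee_wpmul2r ?lee_fin ?lerDl//; apply: phi_ge0.
by apply: divr_ge0; [rewrite mulr_ge0// expR_ge0|exact: ltW].
Qed.

(** The argument of phi on the left is at most the mean of the two arguments on the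
    right with weights t / (t + s) and s / (t + s). The factor exp(- c t) in the
    penalty compensates the expansion of the first displacement by the flow. *)
Lemma pen_add t s a b : 0 <= t -> 0 <= s -> 0 <= a -> 0 <= b ->
  (pen (t + s) (expR (c * s) * a + b) <= pen t a + pen s b)%E.
Proof.
move=> t0 s0 a0 b0.
have ca0 : 0 <= expR (c * s) * a by rewrite mulr_ge0 ?expR_ge0.
have [t00|tN0] := eqVneq t 0.
  have [->|aN0] := eqVneq a 0; first by rewrite t00 add0r mulr0 add0r pen0 add0e.
  rewrite t00 pen_time0 ?lt0r ?aN0// addye ?leey//.
  by rewrite -ltNye (lt_le_trans _ (pen_ge0 _ _))// ltNyr.
have [s00|sN0] := eqVneq s 0.
  have [->|bN0] := eqVneq b 0.
    by rewrite s00 addr0 mulr0 expR0 mul1r addr0 pen0 adde0.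
  rewrite s00 pen_time0 ?lt0r ?bN0// addey ?leey//.
  by rewrite -ltNye (lt_le_trans _ (pen_ge0 _ _))// ltNyr.
have tp : 0 < t by rewrite lt0r tN0.
have sp : 0 < s by rewrite lt0r sN0.
have tsp : 0 < t + s by exact: addr_gt0.
rewrite /phi_ (gt_eqF tp) (gt_eqF sp) (gt_eqF tsp).
set v := expR (- (c * t)) * a / t; set w := expR (- (c * s)) * b / s.
have v0 : 0 <= v by rewrite divr_ge0// mulr_ge0// expR_ge0.
have w0 : 0 <= w by rewrite divr_ge0// mulr_ge0// expR_ge0.
pose al := t / (t + s).
have al01 : 0 <= al <= 1.
  by rewrite divr_ge0 ?(ltW tsp)//= ler_pdivrMr// mul1r lerDl ltW.
have al1 : 1 - al = s / (t + s) by rewrite /al; field; rewrite gt_eqF.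
have := phi_convex al01 v0 w0 => H.
have H1 : (phi (expR (- (c * (t + s))) * (expR (c * s) * a + b) / (t + s))%R <=
           phi (al * v + (1 - al) * w)%R)%E.
  apply: phi_nondecreasing.
    by rewrite divr_ge0 ?(ltW tsp)// mulr_ge0 ?expR_ge0// addr_ge0.
  rewrite al1 /al /v /w mulrDr mulrDl.
  have -> : t / (t + s) * (expR (- (c * t)) * a / t) = expR (- (c * t)) * a / (t + s).
    by field; rewrite (gt_eqF tp) (gt_eqF tsp).
  have -> : s / (t + s) * (expR (- (c * s)) * b / s) = expR (- (c * s)) * b / (t + s).
    by field; rewrite (gt_eqF sp) (gt_eqF tsp).
  rewrite mulrA -expRD; apply: lerD.
    rewrite le_eqVlt; apply/orP; left; apply/eqP; congr (expR _ * _ * _); ring.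
  rewrite ler_wpM2r ?invr_ge0 ?(ltW tsp)// ler_wpM2r// ler_expR lerN2 ler_wpM2l//.
  by rewrite lerDr.
apply: (@le_trans _ _ ((t + s)%:E * (al%:E * phi v + (1 - al)%R%:E * phi w))%E).
  by rewrite lee_wpmul2l ?lee_fin ?(ltW tsp)//; exact: le_trans H1 H.
rewrite ge0_muleDr ?mule_ge0 ?phi_ge0 ?lee_fin//; last 2 first.
- by case/andP: al01.
- by rewrite al1 divr_ge0 ?(ltW tsp).
rewrite !muleA -!EFinM al1 /al.
have -> : (t + s) * (t / (t + s)) = t by field; rewrite gt_eqF.
by have -> : (t + s) * (s / (t + s)) = s by field; rewrite gt_eqF.
Qed.

(** Transport costs are averaged through their p-th powers, which is why convexity
    of the penalty in the p-th power of the distance is wanted. *)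
Lemma pen_pconvex t : 0 <= t -> convex_nneg (fun v => pen t (v `^ p^-1)).
Proof.
move=> t0 a v w a01 v0 w0; case/andP: (a01) => a0 a1.
have b0 : 0 <= 1 - a by rewrite subr_ge0.
have [t00|tN0] := eqVneq t 0.
  rewrite t00.
  have H b x : 0 <= b -> 0 <= x -> (0 <= b%:E * pen 0 (x `^ p^-1))%E.
    by move=> ? ?; rewrite mule_ge0 ?lee_fin// pen_ge0// powR_ge0.
  have H2 b x : 0 < b -> 0 < x -> (b%:E * pen 0 (x `^ p^-1) = +oo)%E.
    by move=> b1 x0; rewrite pen_time0 ?powR_gt0// gt0_muley.
  have [avw|avw] := eqVneq (a * v + (1 - a) * w) 0.
    by rewrite avw powR0 ?invr_neq0// pen0 adde_ge0// H.
  have : 0 < a * v \/ 0 < (1 - a) * w.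
    apply/orP; apply: contraT; rewrite negb_or -!leNgt => /andP[h1 h2].
    move/negP: avw; rewrite paddr_eq0 ?mulr_ge0// !eq_le h1 h2 !mulr_ge0//.
  case=> h.
    rewrite H2 ?addye ?leey//.
    - by rewrite -ltNye (lt_le_trans _ (H _ _ _ _))// ltNyr.
    - by rewrite lt0r a0 andbT; apply: contraTneq h => ->; rewrite mul0r ltxx.
    - by rewrite lt0r v0 andbT; apply: contraTneq h => ->; rewrite mulr0 ltxx.
  rewrite [X in (_ <= _ + X)%E]H2 ?addey ?leey//.
  - by rewrite -ltNye (lt_le_trans _ (H _ _ _ _))// ltNyr.
  - by rewrite lt0r b0 andbT; apply: contraTneq h => ->; rewrite mul0r ltxx.
  - by rewrite lt0r w0 andbT; apply: contraTneq h => ->; rewrite mulr0 ltxx.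
rewrite /phi_ (negbTE tN0).
pose k := expR (- (c * t)) / t.
have k0 : 0 <= k by rewrite divr_ge0// expR_ge0.
have kE x : 0 <= x -> expR (- (c * t)) * x `^ p^-1 / t = (k `^ p * x) `^ p^-1.
  by move=> x0; rewrite powRM ?powR_ge0// powRK// /k mulrAC.
rewrite !kE ?addr_ge0 ?mulr_ge0//.
rewrite muleCA [X in (_ <= _ + X)%E]muleCA -ge0_muleDr; last 2 first.
- by rewrite mule_ge0 ?lee_fin// phi_ge0// powR_ge0.
- by rewrite mule_ge0 ?lee_fin// phi_ge0// powR_ge0.
rewrite lee_wpmul2l ?lee_fin// mulrDr mulrCA [X in (_ + X)%R]mulrCA.
by apply: phi_pconvex; rewrite // mulr_ge0// powR_ge0.
Qed.

(** By induction on normalised partial sums; the bounds r keep infinite values of g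
    out of the sums. *)
Lemma finite_jensen (g : R -> \bar R) n (w v r : nat -> R) : convex_nneg g ->
  (forall i, 0 <= w i) -> (forall i, 0 <= v i) -> (forall i, (g (v i) <= (r i)%:E)%E) ->
  \sum_(i < n) w i = 1 ->
  (g (\sum_(i < n) w i * v i)%R <= (\sum_(i < n) w i * r i)%R%:E)%E.
Proof.
move=> gc w0 v0 gr w1.
suff H m : 0 < \sum_(i < m) w i ->
    (g ((\sum_(i < m) w i * v i) / \sum_(i < m) w i)%R <=
     ((\sum_(i < m) w i * r i) / \sum_(i < m) w i)%R%:E)%E.
  by have := H n; rewrite w1 ltr01 !divr1; exact.
elim: m => [|m IH]; first by rewrite big_ord0 ltxx.
rewrite !big_ord_recr /=; set W := \sum_(i < m) w i.
set V := \sum_(i < m) w i * v i; set S := \sum_(i < m) w i * r i => W'.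
have W0 : 0 <= W by exact: sumr_ge0.
have V0 : 0 <= V by apply: sumr_ge0 => i _; exact: mulr_ge0.
move: W0; rewrite le_eqVlt => /predU1P[W00|Wp].
  have wi (i : 'I_m) : w i = 0.
    apply/eqP; move/esym/eqP: W00; rewrite /W psumr_eq0// => /allP/(_ i).
    by rewrite mem_index_enum; exact.
  have -> : V = 0 by rewrite /V big1// => i _; rewrite wi mul0r.
  have -> : S = 0 by rewrite /S big1// => i _; rewrite wi mul0r.
  rewrite -W00 !add0r [w m * v m]mulrC [w m * r m]mulrC !mulfK//;
  by rewrite gt_eqF//; rewrite -W00 add0r in W'.
have a01 : 0 <= W / (W + w m) <= 1.
  by rewrite divr_ge0 ?(ltW Wp) ?(ltW W')//= ler_pdivrMr// mul1r lerDl.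
have a1 : 1 - W / (W + w m) = w m / (W + w m) by field; rewrite gt_eqF.
have VW : 0 <= V / W by rewrite divr_ge0// ltW.
have := gc _ _ _ a01 VW (v0 m); rewrite a1.
have -> : W / (W + w m) * (V / W) + w m / (W + w m) * v m = (V + w m * v m) / (W + w m).
  by field; rewrite (gt_eqF Wp) (gt_eqF W').
move=> /le_trans; apply.
have -> : (S + w m * r m) / (W + w m) = W / (W + w m) * (S / W) + w m / (W + w m) * r m.
  by field; rewrite (gt_eqF Wp) (gt_eqF W').
rewrite EFinD !EFinM; apply: leeD; apply: lee_wpmul2l; rewrite ?lee_fin.
- by case/andP: a01.
- exact: IH.
- by rewrite -a1 subr_ge0; case/andP: a01.
- exact: gr.
Qed.

(** As a function of the p-th power of v, phi is convex, vanishes at 0 and is not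
    identically 0, so it grows at least linearly; hence phi grows at least like
    the p-th power of v, and p > 1. *)
Lemma phi_superlinear l : 0 <= l ->
  exists2 C, 0 <= C & forall v, 0 <= v -> ((l * v - C)%:E <= phi v)%E.
Proof.
move=> l0; have [v0 v0p phiv0] := phi_neq0.
have [m m0 mphi] : exists2 m, 0 < m & (m%:E <= phi v0)%E.
  have := phi_ge0 (ltW v0p); case: (phi v0) phiv0 => [r rN0|_ _|//].
    rewrite lee_fin => r0; exists r => //.
    by rewrite lt0r r0 andbT; apply/eqP => r00; apply: rN0; rewrite r00.
  by exists 1; rewrite ?leey.
have growth v : v0 <= v -> ((m * (v / v0) `^ p)%:E <= phi v)%E.
  move=> vv; have vp := lt_le_trans v0p vv.
  (* Convexity in the p-th power on the segment from 0 to v, at v0. *)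
  pose a := (v0 / v) `^ p.
  have a0 : 0 < a by rewrite powR_gt0// divr_gt0.
  have a1 : a <= 1.
    have -> : 1 = 1 `^ p by rewrite powR1.
    rewrite /a ge0_ler_powR ?nnegrE ?divr_ge0 ?(ltW p0) ?(ltW v0p) ?(ltW vp)//.
    by rewrite ler_pdivrMr// mul1r.
  have a01 : 0 <= a <= 1 by rewrite ltW.
  have := phi_pconvex a01 (powR_ge0 v p) (lexx 0).
  rewrite mulr0 addr0 powR0 ?invr_neq0// phi0 mule0 adde0 powRK ?(ltW vp)//.
  rewrite /a -powRM ?divr_ge0 ?(ltW v0p) ?(ltW vp)// powRK ?mulr_ge0 ?invr_ge0 ?(ltW vp) ?(ltW v0p)//.
  rewrite divfK ?gt_eqF// => H; have := le_trans mphi H.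
  have -> : (v / v0) `^ p = a^-1.
    apply: (mulfI (lt0r_neq0 a0)); rewrite mulfV ?lt0r_neq0//.
    rewrite /a -powRM ?divr_ge0 ?(ltW v0p) ?(ltW vp)//.
    have -> : v0 / v * (v / v0) = 1 by field; rewrite (gt_eqF v0p) (gt_eqF vp).
    by rewrite powR1.
  rewrite -/a; case: (phi v) (phi_ge0 (ltW vp)) => [r _|_ _|//]; last by rewrite leey.
  by rewrite -EFinM !lee_fin => mar; rewrite ler_pdivrMr// mulrC.
(* Beyond V the bound m (v / v0)^p exceeds l v. *)
pose V := v0 + v0 * (l * v0 / m) `^ (p - 1)^-1.
have V0 : v0 <= V by rewrite lerDl mulr_ge0 ?powR_ge0// ltW.
have V00 : 0 <= V := le_trans (ltW v0p) V0.
exists (l * V); first exact: mulr_ge0.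
move=> v vp; have [vV|Vv] := leP v V.
  apply: (@le_trans _ _ 0%E); last exact: phi_ge0.
  by rewrite lee_fin subr_le0 ler_wpM2l.
apply: (le_trans _ (growth v (le_trans V0 (ltW Vv)))).
rewrite lee_fin; apply: (@le_trans _ _ (l * v)).
  by rewrite gerBl mulr_ge0.
have vv0 : 0 < v / v0 by rewrite divr_gt0// (le_lt_trans V00 Vv).
have pp : 0 < p - 1 by rewrite subr_gt0.
have big : l * v0 / m <= (v / v0) `^ (p - 1).
  have lm0 : 0 <= l * v0 / m by rewrite !mulr_ge0 ?invr_ge0// ltW.
  have xv : (l * v0 / m) `^ (p - 1)^-1 <= v / v0.
    by rewrite ler_pdivlMr//; move: Vv; rewrite /V; lra.
  rewrite -[leLHS](powRr1 lm0) -[X in _ `^ X <= _](mulVf (lt0r_neq0 pp)) powRrM.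
  by rewrite ge0_ler_powR ?nnegrE ?powR_ge0 ?(ltW pp) ?(ltW vv0).
have -> : (v / v0) `^ p = (v / v0) `^ (p - 1) * (v / v0).
  by rewrite -[X in _ = _ * X](powRr1 (ltW vv0)) -powRD ?subrK// (gt_eqF vv0) implybT.
have -> : l * v = m * (l * v0 / m * (v / v0)).
  by field; rewrite (gt_eqF v0p) (gt_eqF m0).
by rewrite ler_wpM2l ?(ltW m0)// ler_wpM2r// ltW.
Qed.

Lemma pen_lower l T : 0 <= l -> exists2 C, 0 <= C &
  forall t v, 0 <= t -> t <= T -> 0 <= v -> ((l * v - t * C)%:E <= pen t v)%E.
Proof.
move=> l0; have lc0 : 0 <= l * expR (c * T) by rewrite mulr_ge0 ?expR_ge0.
have [C C0 HC] := phi_superlinear lc0; exists C => // t v t0 tT v0.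
have [t00|tN0] := eqVneq t 0.
  rewrite t00 mul0r subr0; move: v0; rewrite le_eqVlt => /predU1P[<-|vp].
    by rewrite pen0 mulr0.
  by rewrite pen_time0 ?leey.
have tp : 0 < t by rewrite lt0r tN0.
rewrite /phi_ (negbTE tN0); set w := expR (- (c * t)) * v / t.
have w0 : 0 <= w by rewrite divr_ge0// mulr_ge0// expR_ge0.
apply: (@le_trans _ _ (t%:E * (l * expR (c * T) * w - C)%:E)%E); last first.
  by rewrite lee_wpmul2l ?lee_fin//; exact: HC.
rewrite -EFinM lee_fin mulrBr lerD2r.
have -> : t * (l * expR (c * T) * w) = l * (expR (c * T) * expR (- (c * t))) * v.
  by rewrite /w; field.
rewrite -expRD ler_wpM2r// -{1}[l]mulr1 ler_wpM2l//.
by rewrite -expR0 ler_expR subr_ge0 ler_wpM2l.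
Qed.

End penalty.

(** * The Wasserstein distance *)

Section wasserstein_distance.
Context {R : realType} {X : completeNormedModType R}.
Hypothesis sepX : separable X.
Variable p : R.
Hypothesis p1 : 1 < p.
Implicit Types (mu nu : probability (borel X) R).

Let p0 : 0 < p. Proof. exact: lt_trans p1. Qed.

Lemma measurable_borel_norm d (T : measurableType d) (f : T -> borel X) :
  measurable_fun setT f -> measurable_fun setT (fun t => `|(f t : X)|).
Proof.
move=> mf; apply: (measurableT_comp (f := fun x : borel X => `|(x : X)|)) => //.
by apply: continuous_borel_real => x; exact: norm_continuous.
Qed.

Lemma measurable_borelB d (T : measurableType d) (f g : T -> borel X) :
  measurable_fun setT f -> measurable_fun setT g ->
  measurable_fun setT ((fun t => (f t : X) - (g t : X)) : T -> borel X).
Proof.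
move=> mf mg; apply: measurable_borelD => //.
apply: (measurableT_comp (f := (fun x : borel X => - (x : X)) : borel X -> borel X)) => //.
by apply: continuous_borel => x; exact: opp_continuous.
Qed.

Lemma Cpl_fst mu nu pi : Cpl mu nu pi ->
  forall g : borel X -> \bar R, measurable_fun setT g -> (forall x, 0 <= g x)%E ->
    (\int[pi]_z g z.1 = \int[mu]_x g x)%E.
Proof.
move=> cpl g mg g0.
have [m [mE mI _]] := law_exists pi (measurable_fst : measurable_fun setT fst).
rewrite -mI//; apply: eq_measure_integral => A mA _.
apply: (eq_trans (mE A mA)); apply: (eq_trans _ (cpl A mA).1); congr (pi _).
by apply/seteqP; split => z //= -[].
Qed.

Lemma Cpl_snd mu nu pi : Cpl mu nu pi ->
  forall g : borel X -> \bar R, measurable_fun setT g -> (forall x, 0 <= g x)%E ->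
    (\int[pi]_z g z.2 = \int[nu]_x g x)%E.
Proof.
move=> cpl g mg g0.
have [m [mE mI _]] := law_exists pi (measurable_snd : measurable_fun setT snd).
rewrite -mI//; apply: eq_measure_integral => A mA _.
apply: (eq_trans (mE A mA)); apply: (eq_trans _ (cpl A mA).2); congr (pi _).
by apply/seteqP; split => z //= -[].
Qed.

Notation cost pi a := (moment_le pi p (fun z => `|(z.1 : X) - (z.2 : X)|) a).

Lemma costE (pi : probability (borel X * borel X)%type R) :
  (\int[pi]_z (`| `|(z.1 : X) - (z.2 : X)| | `^ p)%:E =
   \int[pi]_z (`|(z.1 : X) - (z.2 : X)| `^ p)%:E)%E.
Proof. by apply: eq_integral => z _; rewrite normr_id. Qed.

Lemma Wp_ge0 mu nu : 0 <= Wp p mu nu. Proof. exact: powR_ge0. Qed.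

Let inf_ge0 mu nu : (0 <= ereal_inf
    [set (\int[pi]_yz (`|(yz.1 : X) - (yz.2 : X)| `^ p)%:E)%E | pi in Cpl mu nu])%E.
Proof.
apply: le_ereal_inf_tmp => _ [pi _ <-]; apply: integral_ge0 => z _.
by rewrite lee_fin powR_ge0.
Qed.

Lemma Wp_le mu nu pi a : Cpl mu nu pi -> cost pi a -> Wp p mu nu <= a.
Proof.
move=> cpl [a0 ca]; rewrite costE in ca.
have H : (ereal_inf [set (\int[pi]_yz (`|(yz.1 : X) - (yz.2 : X)| `^ p)%:E)%E
    | pi in Cpl mu nu] <= (a `^ p)%:E)%E.
  by apply: le_trans ca; apply: ereal_inf_lbound; exists pi.
rewrite /Wp -[leRHS](powRr1 a0) -[X in _ <= _ `^ X](mulfV (lt0r_neq0 p0)) powRrM.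
rewrite ge0_ler_powR ?invr_ge0 ?nnegrE ?powR_ge0 ?(ltW p0) ?fine_ge0//.
rewrite -lee_fin fineK// ge0_fin_numE//; exact: le_lt_trans H (ltry _).
Qed.

Lemma measurable_cost : measurable_fun setT
  (fun z : (borel X * borel X)%type => `|(z.1 : X) - (z.2 : X)|).
Proof. by apply: measurable_borel_norm; exact: measurable_borelB. Qed.

(** The product coupling has finite cost, so that the infimum is a real number and
    is approximated. *)
Lemma Wp_approx mu nu e : Pp p mu -> Pp p nu -> 0 < e ->
  exists2 pi, Cpl mu nu pi & cost pi (Wp p mu nu + e).
Proof.
move=> mup nup e0.
have mn : measurable_fun setT (fun y : borel X => `|(y : X)|) by exact: measurable_borel_norm.
have mp : measurable_fun setT (fun y : borel X => (`| `|(y : X)| | `^ p)%:E).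
  exact: measurable_powR_norm.
have normK (m : probability (borel X) R) : Pp p m ->
    (\int[m]_y (`| `|(y : X)| | `^ p)%:E < +oo)%E.
  by under eq_integral do rewrite normr_id.
have [a a0 aE] := moment_exists p1 (normK _ mup).
have [b b0 bE] := moment_exists p1 (normK _ nup).
pose pi : probability (borel X * borel X)%type R := (mu \x nu)%E.
have cpl : Cpl mu nu pi.
  move=> A mA; rewrite /pi/= !product_measure1E//.
  by split; [rewrite -[RHS]mule1|rewrite -[RHS]mul1e]; congr (_ * _)%E;
    exact: probability_setT.
have m1 : moment_le pi p (fun z => `|(z.1 : X)|) a.
  by split=> //; rewrite (Cpl_fst cpl (g := fun y => (`| `|(y : X)| | `^ p)%:E))// aE.
have m2 : moment_le pi p (fun z => `|(z.2 : X)|) b.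
  by split=> //; rewrite (Cpl_snd cpl (g := fun y => (`| `|(y : X)| | `^ p)%:E))// bE.
have mn1 : measurable_fun setT (fun z : (borel X * borel X)%type => `|(z.1 : X)|).
  exact: (measurableT_comp mn measurable_fst).
have mn2 : measurable_fun setT (fun z : (borel X * borel X)%type => `|(z.2 : X)|).
  exact: (measurableT_comp mn measurable_snd).
have cfin : cost pi (a + b).
  apply: (moment_le_dom p1 measurable_cost _ _ (moment_leD p1 mn1 mn2 m1 m2)).
    exact: measurable_funD.
  by move=> z; rewrite normr_id ger0_norm ?addr_ge0// ler_normB.
pose S := [set (\int[pi]_yz (`|(yz.1 : X) - (yz.2 : X)| `^ p)%:E)%E | pi in Cpl mu nu].
have infin : ereal_inf S \is a fin_num.
  rewrite ge0_fin_numE; last exact: inf_ge0.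
  apply: (@le_lt_trans _ _ ((a + b) `^ p)%:E); last exact: ltry.
  by apply: (le_trans _ cfin.2); rewrite costE; apply: ereal_inf_lbound; exists pi.
have WE : Wp p mu nu `^ p = fine (ereal_inf S).
  by rewrite /Wp -powRrM mulVf ?powRr1 ?fine_ge0 ?lt0r_neq0//; exact: inf_ge0.
have : (ereal_inf S < ((Wp p mu nu + e) `^ p)%:E)%E.
  rewrite -(fineK infin) -WE lte_fin gt0_ltr_powR ?nnegrE ?Wp_ge0//.
    by rewrite addr_ge0 ?Wp_ge0// ltW.
  by rewrite ltrDl.
move=> /ereal_inf_lt[_ [pi' cpl' <-]] H; exists pi' => //; split.
  by rewrite addr_ge0 ?Wp_ge0// ltW.
by rewrite costE ltW.
Qed.

Lemma Pp_moment mu : Pp p mu -> exists2 a, 0 <= a &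
  moment_le mu p (fun y : borel X => `|(y : X)|) a.
Proof.
move=> mup; have [|a a0 aE] := @moment_exists _ _ _ mu p p1 (fun y : borel X => `|(y : X)|).
  by under eq_integral do rewrite normr_id.
by exists a => //; split => //; rewrite aE.
Qed.

Lemma moment_Pp mu a : moment_le mu p (fun y : borel X => `|(y : X)|) a -> Pp p mu.
Proof.
move=> [_ H]; apply: (@le_lt_trans _ _ (a `^ p)%:E); last exact: ltry.
by apply: le_trans H; under [leRHS]eq_integral do rewrite normr_id.
Qed.

Lemma Wp_refl mu : Wp p mu mu = 0.
Proof.
have mdiag : measurable_fun setT (fun y : borel X => (y, y)).
  by apply: measurable_fun_pair; exact: measurable_id.
have [pi [piE piI _]] := law_exists mu mdiag.
apply/eqP; rewrite eq_le Wp_ge0 andbT; apply: (@Wp_le _ _ pi).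
  move=> A mA; rewrite !piE; [|exact: measurableX|exact: measurableX].
  by split; congr (mu _); apply/seteqP; split => y //= -[].
split => //; rewrite piI; last 2 first.
- by apply: measurable_powR_norm; exact: measurable_cost.
- by move=> z; rewrite lee_fin powR_ge0.
by rewrite integral0_eq ?powR0 ?lt0r_neq0// => y _; rewrite subrr normr0 normr0 powR0 ?lt0r_neq0.
Qed.

(** Along a coupling, z is at most y plus the distance from y to z; first moments
    are bounded by p-norms. *)
Lemma Wp_moment1 mu nu m : Pp p mu -> Pp p nu ->
  moment_le mu p (fun y : borel X => `|(y : X)|) m ->
  (\int[nu]_z (`|(z : X)|)%:E <= (m + Wp p mu nu)%:E)%E.
Proof.
move=> mup nup mm.
have mn : measurable_fun setT (fun y : borel X => `|(y : X)|) by exact: measurable_borel_norm.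
apply/lee_addgt0Pr => e e0; rewrite -EFinD.
have [pi cpl cpi] := Wp_approx mup nup e0.
have mn1 : measurable_fun setT (fun z : (borel X * borel X)%type => `|(z.1 : X)|).
  exact: (measurableT_comp mn measurable_fst).
have m1 : moment_le pi p (fun z => `|(z.1 : X)|) m.
  split; first exact: mm.1.
  rewrite (Cpl_fst cpl (g := fun y => (`| `|(y : X)| | `^ p)%:E))//; first exact: mm.2.
  exact: measurable_powR_norm.
rewrite -(Cpl_snd cpl (g := fun z => (`|(z : X)|)%:E))//; last exact/measurable_EFinP.
have := moment_leD p1 mn1 measurable_cost m1 cpi.
move=> /(moment_le1 p1 (measurable_funD mn1 measurable_cost)).
rewrite -addrA; apply: le_trans; apply: ge0_le_integral => //.
- by apply/measurable_EFinP; exact: (measurableT_comp mn measurable_snd).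
- apply/measurable_EFinP; apply: measurableT_comp => //.
  by apply: measurable_funD => //; exact: measurable_cost.
- move=> z _; rewrite lee_fin ger0_norm ?addr_ge0//.
  by apply: (le_trans _ (ler_normB _ _)); rewrite opprB addrC subrK.
Qed.

End wasserstein_distance.

(** * Functions constant on finitely many cells *)

Section finitely_many_cells.
Context d (T : measurableType d) (R : realType) (P : probability T R).
Variables (k : T -> nat) (N : nat) (f : nat -> R).
Hypothesis mk : forall i, measurable (k @^-1` [set i]).
Hypothesis kN : forall x, (k x < N)%N.

Lemma bmeas_cells : bmeas (\sum_(i < N) `|f i|) (fun x => f (k x)).
Proof.
split; first exact: measurable_fun_cells.
move=> x; rewrite (bigD1 (Ordinal (kN x)))//= lerDl.
by apply: sumr_ge0 => i _; exact: normr_ge0.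
Qed.

Lemma bexp_cells :
  \int[P]_x f (k x) = \sum_(i < N) fine (P (k @^-1` [set (i : nat)])) * f i.
Proof.
pose g (i : nat) x := f i * (\1_(k @^-1` [set i]) x : R).
have bg i : bmeas (`|f i| * 1) (g i).
  apply: bmeasZ; split; first exact: measurable_indic.
  by move=> x; rewrite indicE; case: (_ \in _); rewrite ?normr1 ?normr0.
have H m : exists2 B, bmeas B (fun x => \sum_(i < m) g i x) &
    \int[P]_x (\sum_(i < m) g i x) = \sum_(i < m) fine (P (k @^-1` [set (i : nat)])) * f i.
  elim: m => [|m [B bB IH]].
    exists `|0 : R|; first by under eq_fun do rewrite big_ord0; exact: bmeas_cst.
    by under eq_Rintegral do rewrite big_ord0; rewrite bexp_cst big_ord0.
  exists (B + `|f m| * 1).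
    by under eq_fun do rewrite big_ord_recr /=; exact: bmeasD.
  under eq_Rintegral do rewrite big_ord_recr /=.
  rewrite (bexpD P bB (bg m)) IH big_ord_recr /=; congr (_ + _).
  rewrite (@bexpZ _ _ _ P 1); last first.
    split; first exact: measurable_indic.
    by move=> x; rewrite indicE; case: (_ \in _); rewrite ?normr1 ?normr0.
  by rewrite mulrC /Rintegral integral_indic// setIT.
have [B _ <-] := H N; apply: eq_Rintegral => x _.
rewrite (bigD1 (Ordinal (kN x)))//= /g indicE mem_set// mulr1 big1 ?addr0// => i ik.
rewrite indicE memNset ?mulr0//= => ki; case/eqP: ik.
by apply/val_inj; rewrite /= ki.
Qed.

End finitely_many_cells.

(** * Accounting for errors *)

Lemma merge_errors_cell (R : realFieldType) (FG Fq In Hz o e L : R) :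
  Fq <= In - o + e -> FG <= Fq + L * e -> In - Hz <= L * e ->
  FG <= Hz + -1 * o + (2 * L + 1) * e.
Proof. lra. Qed.

Lemma merge_errors_total (R : realFieldType) (A B Iz IH Ii r ro e L M : R) :
  A <= Iz - r + e -> Iz <= IH + -1 * ro + 2 * M * Ii + (2 * L + 1) * e ->
  IH - (r + ro) <= B -> 2 * M * Ii <= 2 * M * e ->
  A <= B + (2 * L + 2 * M + 2) * e.
Proof. lra. Qed.

Lemma stability_errors (R : realFieldType) (f g h g' M lam eta q b : R) :
  0 < lam -> lam < 1 ->
  f <= lam * h + (1 - lam) * g' -> g' <= g + lam / (1 - lam) * M -> - M <= g ->
  h <= eta / lam + q * b / lam -> f <= g + 2 * (lam * M) + eta + q * b.
Proof.
move=> l0 l1 H1 H2 H3 H4.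
have A : (1 - lam) * g' <= (1 - lam) * g + lam * M.
  have -> : (1 - lam) * g + lam * M = (1 - lam) * (g + lam / (1 - lam) * M).
    by field; rewrite subr_eq0 gt_eqF.
  by rewrite ler_wpM2l// subr_ge0 ltW.
have B : lam * h <= eta + q * b.
  by rewrite mulrC -ler_pdivlMr// mulrDl.
have C : - (lam * g) <= lam * M by have := ler_wpM2l (ltW l0) H3; lra.
lra.
Qed.

Lemma chain_halves (R : realFieldType) (a b c d e : R) :
  a <= b + e / 2 -> b <= c -> c <= d + e / 2 -> a <= d + e.
Proof. lra. Qed.

Lemma dist_halves (R : realFieldType) (a b c e : R) :
  a <= b + e / 2 -> b <= a + e / 2 -> `|c - b| <= e / 2 -> `|a - c| <= e.
Proof. rewrite !ler_norml; lra. Qed.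

Lemma usc_errors_total (R : realFieldType) (A B w1 w2 w3 r e : R) :
  A <= w1 - r + e / 8 -> w1 <= w2 + e / 8 -> w2 <= w3 + e / 2 -> w3 - r <= B ->
  0 <= e -> A <= B + e.
Proof. lra. Qed.

Lemma usc_penalty_bound (R : realFieldType) (I M w r e : R) :
  - M <= I -> I <= w - r + e -> w <= M -> r <= 2 * M + e.
Proof. lra. Qed.

Lemma usc_pointwise_near (R : realFieldType) (L e x y z th Mq u : R) :
  0 <= Mq * (x + y) ->
  L * (e + z + (1 - th) * u) <= L * e + Mq * x + (Mq * y + L * z + L * (1 - th) * u).
Proof.
rewrite mulrDr => H; rewrite -subr_ge0; apply: (le_trans H).
by rewrite le_eqVlt; apply/orP; left; apply/eqP; ring.
Qed.

Lemma usc_pointwise_far (R : realFieldType) (h1 h2 M Mq x y A B D : R) :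
  h1 <= M -> - M <= h2 -> 2 * M <= Mq * (x + y) -> 0 <= A + B + D ->
  h1 - h2 <= A + Mq * x + (Mq * y + B + D).
Proof. rewrite mulrDr; lra. Qed.

Lemma usc_errors (R : realFieldType) (a b d f g e : R) :
  a <= e / 8 -> b <= e / 8 -> d + f <= e / 8 -> g <= e / 8 ->
  a + d + (f + b + g) <= e / 2.
Proof. lra. Qed.

Lemma chain_quarters (R : realFieldType) (a b d f g e : R) : 0 <= e ->
  a <= b -> b <= d + e / 4 -> d <= f + e / 4 -> f <= g + e / 4 -> a <= g + e.
Proof. lra. Qed.

(** * Lists of time steps *)

(** The list g is cut at its first step q that reaches time s, with overshoot b. *)
Lemma splitting (R : realDomainType) (g : seq R) s T : all (>= 0) g -> 0 < s -> 0 <= T ->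
  \sum_(i <- g) i = s + T -> exists P q l b,
    [/\ g = P ++ q :: l, \sum_(i <- P) i + q = s + b, 0 <= b, b <= q &
        b + \sum_(i <- l) i = T].
Proof.
elim: g s => [|q g IH] s /=.
  by rewrite big_nil => _ s0 T0 E; have := ltr_wpDr T0 s0; rewrite -E ltxx.
move=> /andP[q0 g0] s0 T0; rewrite big_cons => E.
have [sq|qs] := leP s q.
  exists [::], q, g, (q - s); split => //.
  - by rewrite big_nil add0r addrC subrK.
  - by rewrite subr_ge0.
  - by rewrite gerBl ltW.
  - by rewrite addrAC E addrAC subrr add0r.
have [||P [q' [l [b [-> E' b0 bq E2]]]]] := IH (s - q) g0 _ T0.
- by rewrite subr_gt0.
- by apply: (addrI q); rewrite E addrA [q + _]addrC subrK.
exists (q :: P), q', l, b; split => //.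
by rewrite big_cons -addrA E' addrA [q + _]addrC subrK.
Qed.

Lemma increments_partition (R : realType) (a t : R) s : itv_partition a t s ->
  all (> 0) (pairmap (fun a b => b - a) a s) /\
  \sum_(i <- pairmap (fun a b => b - a) a s) i = t - a.
Proof.
elim: s a => [|b s IH] a /=.
  by move=> [_ /eqP <-]; rewrite big_nil subrr.
move=> [/= /andP[ab bs] E]; have [H1 H2] := IH b (conj bs E).
by rewrite subr_gt0 ab big_cons H2 addrC addrA subrK.
Qed.

Lemma scanl_partition (R : realType) (a : R) l : all (> 0) l ->
  itv_partition a (a + \sum_(i <- l) i) (scanl +%R a l).
Proof.
elim: l a => [a _|q l IH a /= /andP[q0 l0]]; first by split; rewrite //= big_nil addr0.
by have [H1 H2] := IH (a + q) l0; split; rewrite /= ?ltrDl ?q0// big_cons addrA.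
Qed.

Lemma half_pow_lt (R : realType) (e : R) : 0 < e -> exists n, 2 ^- n < e.
Proof.
move=> e0; exists (Num.truncn e^-1).+1; rewrite invf_plt ?posrE ?exprn_gt0//.
apply: (lt_le_trans (truncnS_gt _)); rewrite -natrX ler_nat.
exact: ltnW (ltn_expl _ (isT : (1 < 2)%N)).
Qed.

Lemma dyadic_steps (R : realType) n (t del : R) (k := Num.truncn (t / 2 ^- n))
    (g := rcons (nseq k (2 ^- n)) (t - k%:R * 2 ^- n)) : 0 <= t -> 2 ^- n < del ->
  [/\ all (>= 0) g, all (< del) g & \sum_(i <- g) i = t].
Proof.
move=> t0; rewrite {}/g; set h : R := 2 ^- n => hd.
have h0 : 0 < h by rewrite invr_gt0 exprn_gt0.
have kh : k%:R * h <= t by rewrite -ler_pdivlMr// truncn_le// divr_ge0// ltW.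
rewrite !all_rcons !all_nseq /= hd (ltW h0) !orbT subr_ge0 kh !andbT; split => //.
  apply: lt_trans hd; rewrite ltrBlDr -[X in X + _]mul1r -mulrDl nat1r.
  by rewrite -ltr_pdivrMr//; exact: truncnS_gt.
by rewrite big_rcons big_nseq iter_addr_0 /= mulr_natl addrC subrK.
Qed.

(** * The operators as suprema over measures *)

Section semigroup.
Context {R : realType} {X : completeNormedModType R}.
Hypothesis X_separable : separable X.
Variable K : {linear X -> X}.
Hypothesis K_contr : forall x, `|K x| <= `|x|.
Variable p : R.
Hypothesis p_gt1 : 1 < p.
Variable mu : R -> probability (borel X) R.
Hypothesis mu_Pp : forall t, 0 <= t -> Pp p (mu t).
Variable psi : R -> X -> X.
Hypothesis psi_continuous : forall t, 0 <= t -> continuous (psi t).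
Hypothesis mu_psi : forall (s t : R) (u : X -> R) (x : X),
  0 <= s -> 0 <= t -> Cb K u ->
  (\int[mu (t + s)%R]_y (u (psi (t + s) x + (y : X))%R)%:E =
   \int[mu t]_yt \int[mu s]_ys
     (u (psi s (psi t x + (yt : X)) + (ys : X))%R)%:E)%E.
Variable c : R.
Hypothesis c_ge0 : 0 <= c.
Hypothesis psi_lip : forall t x1 x2, 0 <= t ->
  `|psi t x1 - psi t x2| <= expR (c * t) * `|x1 - x2|.
Hypothesis K_psi : forall t x, 0 <= t -> K (psi t x) = psi t (K x).
Hypothesis psi0 : forall x, psi 0 x = x.
Hypothesis psi_cvg : forall r : R, 0 <= r ->
  ereal_sup [set `|psi h (K x) - K x|%:E | x in [set x | `|x| <= r]]
    @[h --> 0^'+] --> 0%E.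
Hypothesis mu_cvg : (\int[mu h]_y (`|y : X| `^ p)%:E)%E @[h --> 0^'+] --> 0%E.
Variable phi : R -> \bar R.
Hypothesis phi_ge0 : forall v, 0 <= v -> (0 <= phi v)%E.
Hypothesis phi_convex : convex_nneg phi.
Hypothesis phi0 : phi 0 = 0%E.
Hypothesis phi_neq0 : exists2 v, 0 < v & phi v <> 0%E.
Hypothesis phi_pconvex : convex_nneg (fun v => phi (v `^ p^-1)).

Notation I := (Iop p mu psi c phi).
Notation pen := (phi_ phi c).
Notation W t nu := (Wp p (mu t) nu).
Notation norm := (fun y : borel X => `|(y : X)|).

Let pen_nneg t nu : 0 <= t -> (0 <= pen t (W t nu))%E.
Proof. by move=> t0; apply: pen_ge0 => //; exact: Wp_ge0. Qed.

Lemma bmeas_shift M (f : X -> R) (a : X) : bmeas M (f : borel X -> R) ->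
  bmeas M (fun z : borel X => f (a + z)).
Proof.
move=> bf; apply: (bmeas_comp (phi := fun z : borel X => (a + (z : X)) : borel X) _ bf).
by apply: measurable_borelD => //; exact: measurable_cst.
Qed.

(** Equality of laws on nonnegative functions extends to bounded ones by adding a
    constant. *)
Lemma expectation_law d d' (T : measurableType d) (T' : measurableType d')
    (P : probability T R) (Q : probability T' R) (h : T -> T') :
  measurable_fun setT h ->
  (forall g : T' -> \bar R, measurable_fun setT g -> (forall x, 0 <= g x)%E ->
    (\int[P]_z g (h z) = \int[Q]_x g x)%E) ->
  forall M f, bmeas M f -> \int[P]_z f (h z) = \int[Q]_x f x.
Proof.
move=> mh H M f bf.
have bh := bmeas_comp mh bf.
apply: (addIr M); rewrite -(bexp_shift P M bh) -(bexp_shift Q M bf) /Rintegral.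
congr fine; rewrite -H//.
  by apply/measurable_EFinP; exact: (bmeasD bf (bmeas_cst M)).1.
by move=> x; rewrite lee_fin; have := bf.2 x; rewrite ler_norml; lra.
Qed.

Section sup_formula.
Variables (t M : R) (f : X -> R).
Hypotheses (t0 : 0 <= t) (bf : bmeas M (f : borel X -> R)).

Notation val x nu := (\int[nu]_z (f (psi t x + (z : X))%R)%:E - pen t (W t nu))%E.
Notation S x := (ereal_sup [set val x nu | nu in Pp p]).

Let valE x (nu : probability (borel X) R) :
  val x nu = ((\int[nu]_z f (psi t x + (z : X)))%:E - pen t (W t nu))%E.
Proof. by rewrite (bexpE nu (bmeas_shift (psi t x) bf)). Qed.

Let M_bound x (nu : probability (borel X) R) : `|\int[nu]_z f (psi t x + (z : X))| <= M.
Proof. exact: bexp_norm (bmeas_shift (psi t x) bf). Qed.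

Let S_le x : (S x <= M%:E)%E.
Proof.
apply: ge_ereal_sup => _ [nu nup <-]; rewrite valE.
have := M_bound x nu; rewrite ler_norml => /andP[_ H].
by rewrite -[leRHS]adde0 leeD ?lee_fin// leeNl oppe0 pen_nneg.
Qed.

Let S_ge x : ((- M)%:E <= S x)%E.
Proof.
apply: (@le_trans _ _ (val x (mu t))); last first.
  by apply: ereal_sup_ubound; exists (mu t) => //; exact: mu_Pp.
rewrite valE Wp_refl// pen0// sube0 lee_fin.
by have := M_bound x (mu t); rewrite ler_norml => /andP[].
Qed.

Let S_fin x : S x \is a fin_num.
Proof.
rewrite fin_numE; apply/andP; split.
  by rewrite -ltNye (lt_le_trans _ (S_ge x))// ltNyr.
by rewrite -ltey (le_lt_trans (S_le x))// ltry.
Qed.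

Lemma Iop_norm x : `|I t f x| <= M.
Proof.
by rewrite ler_norml /Iop -!lee_fin fineK ?S_fin// S_le S_ge.
Qed.

Lemma Iop_ub x (nu : probability (borel X) R) r : Pp p nu ->
  (pen t (W t nu) <= r%:E)%E -> \int[nu]_z f (psi t x + (z : X)) - r <= I t f x.
Proof.
move=> nup pr; rewrite /Iop -lee_fin fineK ?S_fin//.
apply: (@le_trans _ _ (val x nu)); last by apply: ereal_sup_ubound; exists nu.
by rewrite valE EFinB leeB.
Qed.

Lemma Iop_lub x a :
  (forall (nu : probability (borel X) R) r, Pp p nu -> 0 <= r ->
    pen t (W t nu) = r%:E -> \int[nu]_z f (psi t x + (z : X)) - r <= a) ->
  I t f x <= a.
Proof.
move=> H; rewrite /Iop -lee_fin fineK ?S_fin//.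
apply: ge_ereal_sup => _ [nu nup <-]; rewrite valE.
case E : (pen t (W t nu)) (pen_nneg nu t0) => [r| |//] pr.
  by rewrite -EFinB lee_fin H// -lee_fin -E.
by rewrite addeNy leNye.
Qed.

Lemma Iop_near x e : 0 < e -> exists (nu : probability (borel X) R) r,
  [/\ Pp p nu, 0 <= r, pen t (W t nu) = r%:E &
      I t f x <= \int[nu]_z f (psi t x + (z : X)) - r + e].
Proof.
move=> e0; apply: contrapT => H.
have : I t f x <= I t f x - e.
  apply: Iop_lub => nu r nup r0 E; rewrite leNgt; apply/negP => lt.
  by apply: H; exists nu, r; split => //; lra.
lra.
Qed.

End sup_formula.

Lemma Iop_le_pt t M N (f g : X -> R) x y a : 0 <= t ->
  bmeas M (f : borel X -> R) -> bmeas N (g : borel X -> R) ->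
  (forall z, f (psi t x + z) <= g (psi t y + z) + a) -> I t f x <= I t g y + a.
Proof.
move=> t0 bf bg fg; apply: (Iop_lub t0 bf) => nu r nup r0 E.
have pr : (pen t (W t nu) <= r%:E)%E by rewrite E.
have H := Iop_ub t0 bg y nup pr.
suff : \int[nu]_z f (psi t x + (z : X)) <= \int[nu]_z g (psi t y + (z : X)) + a by lra.
have bgx := bmeas_shift (psi t y) bg.
rewrite -(bexp_shift nu a bgx).
by apply: (bexp_le _ (bmeas_shift (psi t x) bf) (bmeasD bgx (bmeas_cst a))) => z.
Qed.

Lemma Iop_le_add t M N (f g : X -> R) a : 0 <= t ->
  bmeas M (f : borel X -> R) -> bmeas N (g : borel X -> R) ->
  (forall x, f x <= g x + a) -> forall x, I t f x <= I t g x + a.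
Proof. by move=> t0 bf bg fg x; apply: (Iop_le_pt t0 bf bg) => z; exact: fg. Qed.

Lemma Iop_convex t M N (f g : X -> R) a : 0 <= t -> 0 <= a <= 1 ->
  bmeas M (f : borel X -> R) -> bmeas N (g : borel X -> R) ->
  forall x, I t (fun y => a * f y + (1 - a) * g y) x <= a * I t f x + (1 - a) * I t g x.
Proof.
move=> t0 /andP[a0 a1] bf bg x.
have bfg := bmeasD (bmeasZ a bf) (bmeasZ (1 - a) bg).
apply: (Iop_lub t0 bfg) => nu r nup r0 E.
have pr : (pen t (W t nu) <= r%:E)%E by rewrite E.
have Hf := Iop_ub t0 bf x nup pr; have Hg := Iop_ub t0 bg x nup pr.
have bfx := bmeas_shift (psi t x) bf; have bgx := bmeas_shift (psi t x) bg.
rewrite (bexpD nu (bmeasZ a bfx) (bmeasZ (1 - a) bgx)) (bexpZ nu a bfx) (bexpZ nu (1 - a) bgx).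
have := ler_wpM2l a0 Hf; have := @ler_wpM2l _ (1 - a) _ _ _ Hg; rewrite subr_ge0.
by move=> /(_ a1); lra.
Qed.

Definition mom t := fine (\int[mu t]_y (`|y : X| `^ p)%:E)%E `^ p^-1.

Lemma mom_le t : 0 <= t -> moment_le (mu t) p norm (mom t).
Proof.
move=> t0; have [a a0 aE] := Pp_moment p_gt1 (mu_Pp t0).
have p0 : 0 < p := lt_trans ltr01 p_gt1.
have I0 : (0 <= \int[mu t]_y (`|y : X| `^ p)%:E)%E.
  by apply: integral_ge0 => y _; rewrite lee_fin powR_ge0.
split; first exact: powR_ge0.
rewrite /mom -powRrM mulVf ?lt0r_neq0// powRr1 ?fine_ge0// fineK ?ge0_fin_numE//.
  by under eq_integral do rewrite normr_id.
exact: mu_Pp.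
Qed.

Lemma bexp_affine t (nu : probability (borel X) R) M (f : borel X -> R) A B :
  0 <= t -> Pp p nu -> bmeas M f -> 0 <= A -> 0 <= B ->
  (forall z, f z <= A + B * `|(z : X)|) ->
  \int[nu]_z f z <= A + B * (mom t + W t nu).
Proof.
move=> t0 nup bf A0 B0 fAB.
pose g z := Num.max 0 (f z).
have bg : bmeas `|M| g.
  split; first by apply: measurable_maxr => //; exact: bf.1.
  move=> z; have := bf.2 z; have := ler_norm M; rewrite /g /Num.max.
  by case: ifP; rewrite ?normr0//; lra.
apply: (@le_trans _ _ (\int[nu]_z g z)).
  by apply: (bexp_le _ bf bg) => z; rewrite le_max lexx orbT.
have mn : measurable_fun setT norm by exact: measurable_borel_norm.
rewrite -lee_fin -(bexpE nu bg).
apply: (@le_trans _ _ (\int[nu]_z (A%:E + B%:E * (`|(z : X)|)%:E))%E).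
  apply: ge0_le_integral => //.
  - by move=> z _; rewrite lee_fin le_max lexx.
  - by apply/measurable_EFinP; exact: bg.1.
  - apply: emeasurable_funD => //; apply: emeasurable_funM => //.
    exact/measurable_EFinP.
  - by move=> z _; rewrite -EFinM -EFinD lee_fin /g ge_max fAB andbT addr_ge0// mulr_ge0.
rewrite ge0_integralD//; last 2 first.
- by move=> z _; rewrite mule_ge0// lee_fin.
- by apply: emeasurable_funM => //; exact/measurable_EFinP.
rewrite integral_cst// ge0_integralZl_EFin//; last exact/measurable_EFinP.
rewrite [X in (_ * X + _)%E](_ : _ = 1%E); last exact: probability_setT.
rewrite mule1 EFinD EFinM leeD2l// lee_wpmul2l ?lee_fin//.
exact: (Wp_moment1 X_separable p_gt1 (mu_Pp t0) nup (mom_le t0)).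
Qed.

(** A measure gains at most C outside the ball of radius r. By Markov's inequality
    this gain is at most C / r times a first moment, hence C / r times the transport
    distance up to a constant. As C / r <= 1, the superlinear penalty absorbs the
    distance. *)
Lemma Iop_tail t : 0 <= t -> exists2 a, 0 <= a &
  forall N (h : X -> R) eta C r x, bmeas N (h : borel X -> R) ->
    0 < r -> 0 <= C -> C <= r ->
    (forall y, `|y| <= r -> h y <= eta) -> (forall y, h y <= eta + C) ->
    I t h x <= eta + C / r * (`|psi t x| + a).
Proof.
move=> t0.
have [k k0 kH] := pen_lower p_gt1 c_ge0 phi_ge0 phi0 phi_neq0 phi_pconvex t ler01.
exists (mom t + t * k).
  by rewrite addr_ge0// ?mulr_ge0//; exact: (mom_le t0).1.
move=> N h eta C r x bh r0 C0 Cr hr hC.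
have Cr0 : 0 <= C / r by rewrite divr_ge0// ltW.
have Cr1 : C / r <= 1 by rewrite ler_pdivrMr// mul1r.
apply: (Iop_lub t0 bh) => nu q nup q0 E.
have bhx := bmeas_shift (psi t x) bh.
have H1 : \int[nu]_z (h (psi t x + (z : X)) - eta) <=
    C / r * `|psi t x| + C / r * (mom t + W t nu).
  apply: (bexp_affine t0 nup (bmeasD bhx (bmeas_cst (- eta)))) => // [|z].
    by rewrite mulr_ge0.
  rewrite -mulrDr; have [zr|zr] := leP `|psi t x + (z : X)| r.
    have := hr _ zr; have : 0 <= C / r * (`|psi t x| + `|(z : X)|).
      by rewrite mulr_ge0// addr_ge0.
    lra.
  have : C <= C / r * (`|psi t x| + `|(z : X)|).
    rewrite mulrAC ler_pdivlMr// ler_wpM2l// (le_trans (ltW zr))//.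
    exact: ler_normD.
  by have := hC (psi t x + (z : X)); lra.
rewrite (bexp_shift nu (- eta) bhx) in H1.
have := kH t _ t0 (lexx t) (Wp_ge0 p (mu t) nu); rewrite E lee_fin mul1r => H2.
have : C / r * (W t nu - t * k) <= q.
  have [neg|pos] := leP (W t nu - t * k) 0.
    by apply: le_trans q0; rewrite mulr_ge0_le0.
  by apply: le_trans H2; rewrite ler_piMl// ltW.
nra.
Qed.

(** * The supremum over displacements of the reference sample *)

Lemma K_psi_lip t x1 x2 : 0 <= t ->
  `|K (psi t x1 - psi t x2)| <= expR (c * t) * `|K (x1 - x2)|.
Proof. by move=> t0; rewrite !linearB !K_psi//; exact: psi_lip. Qed.

(** Moving x moves K (psi t x) by at most exp(c t) times the motion of K x, because
    the flow commutes with K; the competing measures do not change. *)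
Lemma Iop_klipb t L M u : 0 <= t -> klipb K L M u ->
  klipb K (L * expR (c * t)) M (I t u).
Proof.
move=> t0 uL; have bu := klipb_bmeas K_contr uL; have L0 := uL.1.1.
split; last by move=> x; exact: Iop_norm t0 bu x.
split; first by rewrite mulr_ge0 ?expR_ge0.
have H x1 x2 : I t u x1 <= I t u x2 + L * expR (c * t) * `|K (x1 - x2)|.
  apply: (Iop_le_pt t0 bu bu) => z.
  have := uL.1.2 (psi t x1 + z) (psi t x2 + z).
  rewrite opprD addrACA subrr addr0 => H1.
  have H2 := ler_wpM2l L0 (K_psi_lip x1 x2 t0).
  have := ler_norm (u (psi t x1 + z) - u (psi t x2 + z)); lra.
move=> x1 x2; have := H x1 x2; have := H x2 x1.
rewrite -[x2 - x1]opprB linearN normrN ler_norml; lra.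
Qed.

(** A random vector Y with the K-law of [mu t], displaced by D, is an admissible
    competitor for the supremum although its law need not come from a coupling with
    [mu t]: replace Y by a sample of [mu t] and keep D. *)
Lemma Iop_coupling_le d (T : measurableType d) (P : probability T R)
    (Y D : T -> borel X) t L M f x a r : 0 <= t -> klipb K L M f ->
  measurable_fun setT Y -> measurable_fun setT D -> same_klaw K P Y (mu t) id ->
  moment_le P p (fun w => `|(D w : X)|) a -> (pen t a <= r%:E)%E ->
  \int[P]_w f (psi t x + Y w + D w) - r <= I t f x.
Proof.
move=> t0 fL mY mD Ymu Da par; apply/ler_addgt0Pr => e e0.
have mid : measurable_fun setT (id : borel X -> borel X) by exact: measurable_id.
have [Pi [Pi1 Pi2 /= H]] := transfer K_contr X_separable mY mD mid Ymu (psi t x) fL e0.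
have bf := klipb_bmeas K_contr fL.
have mD2 : measurable_fun setT (fun z : borel X * T => D z.2).
  exact: measurableT_comp.
have mz : measurable_fun setT (fun z : borel X * T => (z.1 : X) + (D z.2 : X) : borel X).
  exact: measurable_borelD.
have mpair : measurable_fun setT
    (fun z : borel X * T => (z.1, (z.1 : X) + (D z.2 : X) : borel X)).
  exact: measurable_fun_pair.
have [nu [nuE nuI nuR]] := law_exists Pi mz.
have [cp [cpE cpI _]] := law_exists Pi mpair.
have mnorm : measurable_fun setT norm by exact: measurable_borel_norm.
have mDn : measurable_fun setT (fun w => `|(D w : X)|) by exact: measurable_borel_norm.
have D2a : moment_le Pi p (fun z => `|(D z.2 : X)|) a.
  split; first exact: Da.1.
  rewrite (Pi2 (fun w => (`| `|(D w : X)| | `^ p)%:E)); first exact: Da.2.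
    exact: measurable_powR_norm.
  by move=> w; rewrite lee_fin powR_ge0.
have m1 : moment_le Pi p (fun z => `|(z.1 : X)|) (mom t).
  split; first exact: (mom_le t0).1.
  rewrite (Pi1 (fun w => (`| `|(w : X)| | `^ p)%:E)); first exact: (mom_le t0).2.
    exact: measurable_powR_norm.
  by move=> w; rewrite lee_fin powR_ge0.
have mn1 : measurable_fun setT (fun z : borel X * T => `|(z.1 : X)|).
  exact: (measurableT_comp mnorm measurable_fst).
have mn2 : measurable_fun setT (fun z : borel X * T => `|(D z.2 : X)|).
  exact: measurable_borel_norm.
have nup : Pp p nu.
  apply: (@moment_Pp _ _ p nu (mom t + a)); split.
    by rewrite addr_ge0 ?(mom_le t0).1 ?Da.1.
  rewrite nuI//; last exact: measurable_powR_norm.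
  have [_] := moment_leD p_gt1 mn1 mn2 m1 D2a.
  apply: le_trans; apply: ge0_le_integral => //.
  - by apply: measurable_powR_norm; exact: measurable_borel_norm.
  - by apply: measurable_powR_norm; exact: measurable_funD.
  - move=> z _; rewrite lee_fin ge0_ler_powR ?nnegrE//.
      by rewrite ltW// (lt_trans _ p_gt1).
    by rewrite normr_id [leRHS]ger0_norm ?addr_ge0// ler_normD.
have Wa : W t nu <= a.
  apply: (Wp_le p_gt1 (pi := cp)).
    move=> A mA; rewrite !cpE; [|exact: measurableX|exact: measurableX]; split.
      have mA1 : measurable (fst @^-1` A : set (borel X * T)).
        by rewrite -[X in measurable X]setTI; exact: measurable_fst.
      apply: (@eq_trans _ _ (\int[Pi]_z (\1_A z.1)%:E)%E); last first.
        rewrite (Pi1 (fun x => (\1_A x)%:E)).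
        - by rewrite integral_indic// setIT.
        - by apply/measurable_EFinP; exact: measurable_indic.
        - by move=> y; rewrite lee_fin.
      rewrite (eq_integral (fun z => (\1_(fst @^-1` A : set (borel X * T)) z)%:E)).
        by rewrite integral_indic// setIT.
      by move=> z _; rewrite !indicE; congr ((nat_of_bool _)%:R%:E); apply/idP/idP; rewrite !inE.
    by rewrite nuE//; congr (Pi _); apply/seteqP; split => z //= -[].
  split; first exact: Da.1.
  rewrite cpI//; last by apply: measurable_powR_norm; exact: measurable_cost.
  apply: le_trans D2a.2; rewrite le_eqVlt; apply/orP; left; apply/eqP.
  by apply: eq_integral => z _ /=; rewrite opprD addrA subrr add0r normrN.
have := Iop_ub t0 bf x nup (le_trans (pen_nondecreasing c phi_ge0 phi_convex phi0 t0
   (Wp_ge0 _ _ _) Wa) par).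
rewrite (nuR _ _ (bmeas_shift (psi t x) bf)).
under [X in X - _ <= _ -> _]eq_Rintegral do rewrite addrA.
lra.
Qed.

(** [pi] is the law of a pair (y, d): a sample y of [mu t] and a displacement d of
    p-norm at most a, penalised by at most r. *)
Definition displacement t (pi : probability (borel X * borel X)%type R) a r :=
  [/\ 0 <= r, forall g : borel X -> \bar R, measurable_fun setT g ->
        (forall x, 0 <= g x)%E -> (\int[pi]_z g z.1 = \int[mu t]_x g x)%E,
      moment_le pi p (fun z => `|(z.2 : X)|) a & (pen t a <= r%:E)%E].

Lemma displacement0 t : exists pi, displacement t pi 0 0.
Proof.
have m0 : measurable_fun setT (fun y : borel X => (y, 0 : borel X)).
  by apply: measurable_fun_pair => //; exact: measurable_cst.
have [pi [_ piI _]] := law_exists (mu t) m0.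
have p0 : p != 0 by rewrite gt_eqF// (lt_trans _ p_gt1).
exists pi; split => [//|g mg g0||]; last by rewrite pen0.
  by rewrite (piI (fun z => g z.1))//; exact: (measurableT_comp mg measurable_fst).
split => //; rewrite (piI (fun z => (`| `|(z.2 : X)| | `^ p)%:E))//.
  by rewrite integral0_eq ?powR0// => y _; rewrite /= !normr0 powR0.
apply: measurable_powR_norm; apply: measurable_borel_norm; exact: measurable_snd.
Qed.

(** Near-optimal couplings exceed the transport distance slightly, and the penalty
    may jump to infinity there. Shrinking the displacements by a factor close to 1
    brings their p-norm down to the distance itself, at a small cost for the
    Lipschitz function f. *)
Lemma Iop_coupling_near t L M f x e : 0 <= t -> klipb K L M f -> 0 < e ->
  exists pi a r, displacement t pi a r /\
    I t f x <= \int[pi]_z f (psi t x + z.1 + z.2) - r + e.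
Proof.
move=> t0 fL e0; have bf := klipb_bmeas K_contr fL.
have e20 : 0 < e / 2 by rewrite divr_gt0.
have [nu [r [nup r0 E H]]] := Iop_near t0 bf x e20.
have L1 : 0 < L + 1 by rewrite ltr_wpDl// fL.1.1.
pose e' := e / 2 / (L + 1); have e'0 : 0 < e' by rewrite divr_gt0.
have [q cplq cq] := Wp_approx X_separable p_gt1 (mu_Pp t0) nup e'0.
have W0 : 0 <= W t nu := Wp_ge0 p (mu t) nu.
have We : 0 < W t nu + e' by rewrite ltr_wpDl.
(* With this factor, cost W + e' shrinks to W. *)
pose th := W t nu / (W t nu + e').
have th0 : 0 <= th by rewrite divr_ge0// ltW.
have th1 : 1 - th = e' / (W t nu + e') by rewrite /th; field; rewrite gt_eqF.
have th1' : 0 <= 1 - th by rewrite th1 divr_ge0// ltW.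
have mdiff : measurable_fun setT
    (fun z : (borel X * borel X)%type => (z.2 : X) - (z.1 : X) : borel X).
  by apply: measurable_borelB.
have msc : measurable_fun setT
    (fun z : (borel X * borel X)%type => th *: ((z.2 : X) - (z.1 : X)) : borel X).
  apply: (measurableT_comp (f := (fun y : borel X => th *: (y : X)) : borel X -> borel X) _ mdiff).
  by apply: continuous_borel => y; exact: scaler_continuous.
have mpair : measurable_fun setT
    (fun z : (borel X * borel X)%type => (z.1, th *: ((z.2 : X) - (z.1 : X)) : borel X)).
  exact: measurable_fun_pair.
have [pi [_ piI piR]] := law_exists q mpair.
have mnd : measurable_fun setT
    (fun z : (borel X * borel X)%type => `|(z.1 : X) - (z.2 : X)|) by exact: measurable_cost.
exists pi, (W t nu), r; split.
  split=> [//|g mg g0||]; last by rewrite E.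
    rewrite (piI (fun z => g z.1))//; last exact: (measurableT_comp mg measurable_fst).
    exact: Cpl_fst cplq g mg g0.
  have [_] := moment_leZ th0 mnd cq.
  rewrite {2}/th divfK ?gt_eqF// => mth; split => //.
  rewrite (piI (fun z => (`| `|(z.2 : X)| | `^ p)%:E))//; last first.
    by apply: measurable_powR_norm; apply: measurable_borel_norm; exact: measurable_snd.
  apply: le_trans mth; rewrite le_eqVlt; apply/orP; left; apply/eqP.
  by apply: eq_integral => z _ /=; rewrite normrZ (ger0_norm th0) distrC.
apply: (le_trans H).
suff : \int[nu]_z f (psi t x + (z : X)) <=
       \int[pi]_z f (psi t x + z.1 + z.2) + e / 2 by lra.
have b2 : bmeas M (fun z : (borel X * borel X)%type => f (psi t x + z.1 + z.2)).
  apply: (bmeas_comp (phi := fun z : (borel X * borel X)%type =>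
    psi t x + (z.1 : X) + (z.2 : X) : borel X) _ bf).
  apply: measurable_borelD => //; apply: measurable_borelD => //; exact: measurable_cst.
rewrite (piR _ _ b2).
rewrite -(expectation_law measurable_snd (Cpl_snd cplq) (bmeas_shift (psi t x) bf)).
pose h1 (z : (borel X * borel X)%type) := f (psi t x + z.2).
pose h2 (z : (borel X * borel X)%type) := f (psi t x + z.1 + th *: ((z.2 : X) - (z.1 : X))).
have bh1 : bmeas M h1 := bmeas_comp measurable_snd (bmeas_shift (psi t x) bf).
have bh2 : bmeas M h2 := bmeas_comp mpair b2.
have k0 : 0 <= L * (1 - th) by rewrite mulr_ge0// fL.1.1.
pose g z := `|h1 z - h2 z|.
have bg : bmeas (M + M) g.
  have [md bd] := bmeasD bh1 (bmeasZ (-1) bh2).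
  have gE : g = fun z => `|h1 z + -1 * h2 z| by apply/funext => z; rewrite /g mulN1r.
  split; first by rewrite gE; exact: measurableT_comp.
  by move=> z; rewrite gE normr_id; have := bd z; rewrite normrN1 mul1r.
have g_le z : g z <= L * (1 - th) * `|(z.1 : X) - (z.2 : X)|.
  apply: (le_trans (klip_dist K_contr _ _ fL.1)).
  have -> : psi t x + z.2 - (psi t x + z.1 + th *: ((z.2 : X) - (z.1 : X))) =
      (1 - th) *: ((z.2 : X) - (z.1 : X)).
    by rewrite scalerBl scale1r -[psi t x + z.1 + _]addrA opprD addrACA subrr add0r
      opprD addrA.
  by rewrite normrZ (ger0_norm th1') distrC mulrA.
have Ig : \int[q]_z g z <= e / 2.
  rewrite -lee_fin -(bexpE q bg).
  apply: (@le_trans _ _ (\int[q]_z ((L * (1 - th))%:E * (`|(z.1 : X) - (z.2 : X)|)%:E))%E).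
    apply: ge0_le_integral => //.
    - by move=> z _; rewrite lee_fin normr_ge0.
    - by apply/measurable_EFinP; exact: bg.1.
    - apply: emeasurable_funM; first exact: measurable_cst.
      by apply/measurable_EFinP; exact: mnd.
    - by move=> z _; rewrite -EFinM lee_fin.
  rewrite ge0_integralZl_EFin//; last by apply/measurable_EFinP; exact: mnd.
  have H1 : (\int[q]_z (`|(z.1 : X) - (z.2 : X)|)%:E <= (W t nu + e')%:E)%E.
    apply: (le_trans _ (moment_le1 p_gt1 mnd cq)); rewrite le_eqVlt; apply/orP; left.
    by apply/eqP; apply: eq_integral => z _; rewrite normr_id.
  apply: (@le_trans _ _ ((L * (1 - th))%:E * (W t nu + e')%:E)%E).
    by rewrite lee_wpmul2l ?lee_fin.
  rewrite -EFinM lee_fin th1 -mulrA divfK ?gt_eqF// /e' mulrA ler_pdivrMr//.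
  by rewrite [leLHS]mulrC ler_wpM2l ?(ltW e20)// lerDl.
apply: (@le_trans _ _ (\int[q]_z (h2 z + g z))).
  apply: (bexp_le _ bh1 (bmeasD bh2 bg)) => z.
  by have := ler_norm (h1 z - h2 z); rewrite /g; lra.
by rewrite (bexpD _ bh2 bg) lerD2l.
Qed.

(** * Merging two steps *)

Lemma expectation_semigroup s t v x : 0 <= s -> 0 <= t -> Lipb K v ->
  \int[mu t]_y \int[mu s]_z v (psi s (psi t x + (y : X)) + (z : X)) =
  \int[mu (t + s)]_y v (psi (t + s) x + (y : X)).
Proof.
move=> s0 t0 vL; have [L [M vLM]] := Lipb_klipb vL.
have bv := klipb_bmeas K_contr vLM.
have vC : Cb K v.
  exists (fun=> v) => //; split.
    apply: (@le_lt_trans _ _ M%:E); last exact: ltry.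
    apply: ge_ereal_sup => _ [n _ <-]; apply: ge_ereal_sup => _ [y _ <-].
    by rewrite lee_fin vLM.2.
  move=> r r0; apply: cvg_near_cst; near=> n.
  rewrite (_ : [set _ | _ in _] = [set 0%E]) ?ereal_sup1//.
  apply/seteqP; split => [_ [y _ <-]|_ ->]; first by rewrite /= subrr normr0.
  by exists 0; rewrite /= ?normr0// subrr normr0.
rewrite /Rintegral (mu_psi x s0 t0 vC); congr fine; apply: eq_integral => y _.
by rewrite (bexpE (mu s) (bmeas_shift _ bv)).
Unshelve. all: by end_near. Qed.

Local Notation TT := (borel X * borel X)%type.

(** Take a near-optimal displaced sample for the first step. Depending on the cell
    in which it lands, take a near-optimal displaced sample for the second step, and
    glue. The resulting point differs from the undisplaced two-step sample, which has
    the K-law of [mu (t + s)], by at most exp(c s) times the first displacement plus the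
    second one. Its penalty is at most the sum of the penalties, by [pen_add] and by
    Jensen's inequality over the cells. All but finitely many cells carry small
    mass and receive no second displacement. *)
Lemma Iop_merge t s L M u x : 0 <= t -> 0 <= s -> klipb K L M u ->
  I t (I s u) x <= I (t + s) u x.
Proof.
move=> t0 s0 uL; have ts0 : 0 <= t + s by rewrite addr_ge0.
have bu := klipb_bmeas K_contr uL.
have FL := Iop_klipb s0 uL; have bF := klipb_bmeas K_contr FL.
set F := I s u in FL bF *; set L1 := L * expR (c * s) in FL.
have L10 : 0 <= L1 := FL.1.1.
have M0 : 0 <= M by exact: le_trans (uL.2 0).
have p0 : 0 < p := lt_trans ltr01 p_gt1.
(* Ct e is the total error of the estimates below, each of order e. *)
pose Ct := 2 * L1 + 2 * M + 2.
have Ct0 : 0 < Ct by rewrite ltr_wpDl// addr_ge0// mulr_ge0.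
apply/ler_addgt0Pr => e0 e00.
pose e := e0 / Ct; have e_gt0 : 0 < e by rewrite divr_gt0.
have [pi [a [r [[r0 pi1 pia par] H]]]] := Iop_coupling_near x t0 FL e_gt0.
pose G (z : TT) : borel X := psi t x + (z.1 : X) + (z.2 : X).
have mG : measurable_fun setT G.
  apply: measurable_borelD => //; apply: measurable_borelD => //; exact: measurable_cst.
have [q [k [kq kE]]] := cells_exist X_separable e_gt0.
have mk := cells_measurable e_gt0 kE.
have mkG n : measurable [set z : TT | (k (G z) < n)%N].
  by rewrite -[X in measurable X]setTI; exact: (mG measurableT _ (mk n)).
have [N HN] := cells_tail pi mkG e_gt0.
(* All cells from number N on are merged into one, on which nothing is displaced. *)
pose k' (z : TT) := minn (k (G z)) N.
have mk'n n : measurable [set z : TT | (k' z < n)%N].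
  rewrite (_ : [set _ | _] = if (N < n)%N then setT else [set z | (k (G z) < n)%N]).
    by case: ifP.
  by apply/seteqP; split => z /=; rewrite /k' gtn_min; case: ifP => //=; rewrite ?orbT ?orbF.
have mk' := measurable_fibres mk'n.
have k'N z : (k' z < N.+1)%N by rewrite ltnS geq_minr.
have /choice[Qar QarP] : forall i : nat, exists Q : probability TT R * R * R,
    displacement s Q.1.1 Q.1.2 Q.2 /\
    ((i < N)%N -> F (q i) <= \int[Q.1.1]_z u (psi s (q i) + z.1 + z.2) - Q.2 + e) /\
    (~~ (i < N)%N -> Q.2 = 0).
  move=> i; case: (ltnP i N) => iN.
    have [Q [b [w [dQ HQ]]]] := Iop_coupling_near (q i) s0 uL e_gt0.
    by exists (Q, b, w).
  by have [Q dQ] := displacement0 s; exists (Q, 0, 0).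
pose Q i := (Qar i).1.1; pose b i := (Qar i).1.2; pose o i := (Qar i).2.
have dQ i : displacement s (Q i) (b i) (o i) := (QarP i).1.
have [Pi PiE] := mixture pi Q mk'.
have PiR := mixture_bexp mk' PiE.
pose Y (w : (TT * TT)%type) : borel X :=
  psi s (psi t x + (w.1.1 : X)) + (w.2.1 : X) - psi (t + s) x.
pose D (w : (TT * TT)%type) : borel X :=
  psi s (G w.1) + (w.2.2 : X) - psi s (psi t x + (w.1.1 : X)).
have mpsi : measurable_fun setT (psi s : borel X -> borel X).
  by apply: continuous_borel; exact: psi_continuous.
have m11 : measurable_fun setT (fun w : (TT * TT)%type => w.1.1).
  exact: (measurableT_comp measurable_fst measurable_fst).
have m12 : measurable_fun setT (fun w : (TT * TT)%type => w.1.2).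
  exact: (measurableT_comp measurable_snd measurable_fst).
have m21 : measurable_fun setT (fun w : (TT * TT)%type => w.2.1).
  exact: (measurableT_comp measurable_fst measurable_snd).
have m22 : measurable_fun setT (fun w : (TT * TT)%type => w.2.2).
  exact: (measurableT_comp measurable_snd measurable_snd).
have mpt : measurable_fun setT (fun w : (TT * TT)%type =>
    psi s (psi t x + (w.1.1 : X)) : borel X).
  apply: (measurableT_comp (f := psi s : borel X -> borel X) mpsi).
  by apply: measurable_borelD => //; exact: measurable_cst.
have mpG : measurable_fun setT (fun w : (TT * TT)%type => psi s (G w.1) : borel X).
  apply: (measurableT_comp (f := psi s : borel X -> borel X) mpsi).
  exact: (measurableT_comp mG measurable_fst).
have mY : measurable_fun setT Y.
  exact: (measurable_borelB X_separable (measurable_borelD X_separable mpt m21)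
    (measurable_cst _)).
have mD : measurable_fun setT D.
  exact: (measurable_borelB X_separable (measurable_borelD X_separable mpG m22) mpt).
have Ylaw : same_klaw K Pi Y (mu (t + s)) id.
  move=> v vL; have [Lv [Mv vLM]] := Lipb_klipb vL.
  have vsL := klip_comp_shift (- psi (t + s) x) vLM.
  have bv := klipb_bmeas K_contr vLM.
  rewrite (PiR _ _ (bmeas_comp mY bv)).
  pose h (y z : borel X) := v (- psi (t + s) x + (psi s (psi t x + (y : X)) + (z : X))).
  have bh y : bmeas Mv (h y) := bmeas_shift _ (klipb_bmeas K_contr vsL).
  have -> : \int[pi]_z0 \int[Q (k' z0)]_z v (Y (z0, z)) =
      \int[pi]_z0 \int[mu s]_z h z0.1 z.
    apply: eq_Rintegral => z0 _; have [_ Q1 _ _] := dQ (k' z0).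
    rewrite -(expectation_law measurable_fst Q1 (bh z0.1)).
    by apply: eq_Rintegral => z _; rewrite /h /Y /= addrC.
  have bhh : bmeas Mv (fun y => \int[mu s]_z h y z).
    have mm : forall i : nat, measurable ((fun=> 0%N) @^-1` [set i] : set (borel X)).
      by move=> i; rewrite preimage_cst; case: ifP.
    apply: (bmeas_mixture (fun=> mu s) mm (g := fun yz => h yz.1 yz.2)).
    apply: (bmeas_comp (phi := fun yz : TT =>
        psi s (psi t x + (yz.1 : X)) + (yz.2 : X) : borel X) _
        (klipb_bmeas K_contr vsL)).
    apply: measurable_borelD => //.
    apply: (measurableT_comp (f := psi s : borel X -> borel X) mpsi).
    by apply: measurable_borelD => //; exact: measurable_cst.
  rewrite (expectation_law measurable_fst pi1 bhh) /h.
  rewrite (expectation_semigroup x s0 t0 (klipb_Lipb vsL)).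
  by apply: eq_Rintegral => y _; rewrite addKr.
pose w i := fine (pi (k' @^-1` [set i])).
have w0 i : 0 <= w i by rewrite fine_ge0.
have w1 : \sum_(i < N.+1) w i = 1.
  have := bexp_cells pi (fun=> 1) mk' k'N; rewrite bexp_cst => ->.
  by apply: eq_bigr => i _; rewrite mulr1.
have b0 i : 0 <= b i by have [_ _ [h _] _] := dQ i.
pose bb := (\sum_(i < N.+1) w i * (b i `^ p)) `^ p^-1.
have sb0 : 0 <= \sum_(i < N.+1) w i * (b i `^ p).
  by apply: sumr_ge0 => i _; rewrite mulr_ge0// powR_ge0.
have bbp : bb `^ p = \sum_(i < N.+1) w i * (b i `^ p).
  by rewrite /bb -powRrM mulVf ?powRr1// gt_eqF.
have mn22 : measurable_fun setT (fun w : (TT * TT)%type => `|(w.2.2 : X)|).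
  exact: measurable_borel_norm.
have mn12 : measurable_fun setT (fun w : (TT * TT)%type => `|(w.1.2 : X)|).
  exact: measurable_borel_norm.
have D12 : moment_le Pi p (fun w => `|(w.1.2 : X)|) a.
  split; first exact: pia.1.
  rewrite PiE//; last exact: measurable_powR_norm.
  apply: le_trans pia.2; rewrite le_eqVlt; apply/orP; left; apply/eqP.
  apply: eq_integral => z0 _; rewrite /= integral_cst//.
  by rewrite [X in (_ * X)%E](_ : _ = 1%E) ?mule1//; exact: probability_setT.
have D22 : moment_le Pi p (fun w => `|(w.2.2 : X)|) bb.
  split; first exact: powR_ge0.
  rewrite PiE//; last exact: measurable_powR_norm.
  rewrite bbp -(bexp_cells pi (fun i => b i `^ p) mk' k'N).
  have bc := bmeas_cells (fun i => b i `^ p) mk' k'N.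
  rewrite -(bexpE pi bc); apply: ge0_le_integral => //.
  - by move=> z0 _; apply: integral_ge0 => z _; rewrite lee_fin powR_ge0.
  - apply: (measurable_fun_mixture Q mk'
      (g := fun w => (`| `|(w.2.2 : X)| | `^ p)%:E)) => //.
    exact: measurable_powR_norm.
  - by apply/measurable_EFinP; exact: bc.1.
  - by move=> z0 _; have [_ _ [_ h] _] := dQ (k' z0).
have mDn : measurable_fun setT (fun w => `|(D w : X)|) by exact: measurable_borel_norm.
have ec0 : 0 <= expR (c * s) := expR_ge0 _.
have DD : moment_le Pi p (fun w => `|(D w : X)|) (expR (c * s) * a + bb).
  have D12' := moment_leZ ec0 mn12 D12.
  have mec : measurable_fun setT (fun w : (TT * TT)%type => expR (c * s) * `|(w.1.2 : X)|).
    exact: measurable_funM.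
  apply: (moment_le_dom p_gt1 mDn _ _ (moment_leD p_gt1 mec mn22 D12' D22)).
    exact: measurable_funD.
  move=> z; rewrite normr_id ger0_norm ?addr_ge0 ?mulr_ge0//.
  rewrite /D addrAC; apply: (le_trans (ler_normD _ _)); rewrite lerD2r.
  apply: (le_trans (psi_lip _ _ s0)); rewrite ler_wpM2l//.
  by rewrite /G addrAC subrr add0r.
pose ro := \sum_(i < N.+1) w i * o i.
have pen_bb : (pen s bb <= ro%:E)%E.
  apply: (finite_jensen (g := fun v => pen s (v `^ p^-1)) (v := fun i => b i `^ p)) => //.
  - exact: pen_pconvex.
  - by move=> i; exact: powR_ge0.
  - move=> i; rewrite -powRrM mulfV ?gt_eqF// powRr1//.
    by have [_ _ _ h] := dQ i.
have pen_tot : (pen (t + s) (expR (c * s) * a + bb) <= (r + ro)%:E)%E.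
  apply: (le_trans (pen_add c_ge0 phi_ge0 phi_convex phi0 t0 s0 pia.1 (powR_ge0 _ _))).
  by rewrite EFinD; exact: leeD.
have HI := Iop_coupling_le x ts0 uL mY mD Ylaw DD pen_tot.
pose g (w : (TT * TT)%type) := u (psi s (G w.1) + (w.2.1 : X) + (w.2.2 : X)).
have bg : bmeas M g.
  apply: (bmeas_comp (phi := fun w : (TT * TT)%type =>
     psi s (G w.1) + (w.2.1 : X) + (w.2.2 : X) : borel X) _ bu).
  by apply: measurable_borelD => //; exact: measurable_borelD.
have gE : \int[Pi]_w u (psi (t + s) x + Y w + D w) = \int[Pi]_w g w.
  apply: eq_Rintegral => w' _; rewrite /g /Y /D; congr (u _).
  rewrite [psi (t + s) x + _]addrC subrK.
  by rewrite [_ + w'.2.1]addrC -addrA [X in _ + X]addrC subrK addrCA addrA.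
rewrite gE (PiR _ _ bg) in HI.
pose ind (z : TT) := \1_[set z : TT | (N <= k (G z))%N] z : R.
have mind : measurable [set z : TT | (N <= k (G z))%N].
  rewrite (_ : [set _ | _] = ~` [set z : TT | (k (G z) < N)%N]); first exact: measurableC.
  by apply/seteqP; split => z /=; [move=> nk; apply/negP|move/negP]; rewrite -leqNgt.
have bind : bmeas 1 ind.
  split; first exact: measurable_indic.
  by move=> z; rewrite /ind indicE; case: (_ \in _); rewrite ?normr1 ?normr0.
have Eind : \int[pi]_z ind z <= e.
  rewrite -lee_fin -(bexpE pi bind) integral_indic// setIT; exact: HN.
pose Hz z := \int[Q (k' z)]_y g (z, y).
have bH : bmeas M Hz := bmeas_mixture Q mk' bg.
have bo := bmeas_cells o mk' k'N.
have bFG : bmeas M (fun z => F (G z)) := bmeas_comp mG bF.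
have pointwise z : F (G z) <= Hz z + -1 * o (k' z) + 2 * M * ind z + (2 * L1 + 1) * e.
  rewrite /ind indicE; case: (ltnP (k (G z)) N) => kz; last first.
    rewrite mem_set//= mulr1; have -> : o (k' z) = 0.
      by apply: (QarP (k' z)).2.2; rewrite -leqNgt /k' (minn_idPr kz).
    have := bF.2 (G z); have := bH.2 z; rewrite !ler_norml => /andP[h1 _] /andP[_ h2].
    have E0 : 0 <= (2 * L1 + 1) * e by rewrite mulr_ge0 ?(ltW e_gt0)// addr_ge0// mulr_ge0.
    rewrite mulr0 addr0; apply: (le_trans h2).
    rewrite [leLHS](_ : M = - M + 2 * M); last by ring.
    by rewrite -[leLHS]addr0; apply: lerD => //; rewrite lerD2r.
  rewrite memNset ?mulr0 ?addr0; last by rewrite /= leqNgt kz.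
  have k'E : k' z = k (G z) by rewrite /k' (minn_idPl (ltnW kz)).
  have := (QarP (k (G z))).2.1 kz; rewrite -/(Q _) -/(o _) -k'E.
  set i := k' z => h1.
  have Gq : `|G z - q i| < e by rewrite /i k'E; exact: kq.
  have h2 : F (G z) <= F (q i) + L1 * e.
    rewrite -lerBlDl; apply: (le_trans (ler_norm _)).
    by apply: (le_trans (klip_dist K_contr _ _ FL.1)); rewrite ler_wpM2l// ltW.
  have bq : bmeas M (fun y : TT => u (psi s (q i) + y.1 + y.2)).
    apply: (bmeas_comp (phi := fun y : TT => psi s (q i) + (y.1 : X) + (y.2 : X) : borel X) _ bu).
    apply: measurable_borelD => //; apply: measurable_borelD => //; exact: measurable_cst.
  have bGz : bmeas M (fun y : TT => g (z, y)).
    apply: (bmeas_comp _ bg); exact: measurable_pair1.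
  have h3 : `|\int[Q i]_y u (psi s (q i) + y.1 + y.2) - Hz z| <= L1 * e.
    apply: (bexp_near _ bq bGz) => y.
    apply: (le_trans (klip_dist K_contr _ _ uL.1)).
    rewrite /L1 -mulrA ler_wpM2l ?uL.1.1//.
    have -> : psi s (q i) + y.1 + y.2 - (psi s (G (z, y).1) + (z, y).2.1 + (z, y).2.2) =
        psi s (q i) - psi s (G z).
      by rewrite /= opprD addrACA subrr addr0 opprD addrACA subrr addr0.
    apply: (le_trans (psi_lip _ _ s0)); rewrite ler_wpM2l// distrC; exact: ltW.
  move: h3; rewrite ler_norml => /andP[_ h3]; exact: merge_errors_cell h1 h2 h3.
have total : \int[pi]_z F (G z) <=
    \int[pi]_z Hz z + -1 * ro + 2 * M * \int[pi]_z ind z + (2 * L1 + 1) * e.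
  have B1 := bmeasD bH (bmeasZ (-1) bo).
  have B2 := bmeasD B1 (bmeasZ (2 * M) bind).
  have B3 := bmeasD B2 (bmeas_cst ((2 * L1 + 1) * e)).
  apply: (le_trans (bexp_le pi bFG B3 pointwise)).
  rewrite (bexp_shift pi _ B2) (bexpD pi B1 (bmeasZ (2 * M) bind)).
  rewrite (bexpD pi bH (bmeasZ (-1) bo)) (bexpZ pi (-1) bo) (bexpZ pi (2 * M) bind).
  by rewrite (bexp_cells pi o mk' k'N).
have fin : 2 * M * \int[pi]_z ind z <= 2 * M * e by rewrite ler_wpM2l// mulr_ge0.
have eE : e0 = (2 * L1 + 2 * M + 2) * e by rewrite /e /Ct; field; rewrite gt_eqF.
rewrite eE; exact: (merge_errors_total H total HI fin).
Qed.

(** * Approximable functions and stability *)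

(** Functions in Cb bounded by M, through the form of approximation in which they
    are used: on each ball, uniformly, by K-Lipschitz functions with the same bound. *)
Definition Cbm M u := forall r e, 0 < r -> 0 < e ->
  exists L v, klipb K L M v /\ forall x, `|x| <= r -> `|u x - v x| <= e.

Lemma klipb_Cbm L M u : klipb K L M u -> Cbm M u.
Proof.
move=> uL r e r0 e0; exists L, u; split=> // x _.
by rewrite subrr normr0 ltW.
Qed.

Lemma Cbm_norm M u x : Cbm M u -> `|u x| <= M.
Proof.
move=> uM; apply/ler_addgt0Pr => e e0.
have [L [v [vL uv]]] := uM (`|x| + 1) e (ltr_wpDl (normr_ge0 x) ltr01) e0.
have := uv x; rewrite lerDl ler01 => /(_ isT) H.
have := vL.2 x; have := ler_normD (u x - v x) (v x); rewrite subrK; lra.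
Qed.

Lemma Cbm_ge0 M u : Cbm M u -> 0 <= M.
Proof. by move=> /(Cbm_norm 0); exact: le_trans. Qed.

Lemma Cbm_bmeas M u : Cbm M u -> bmeas M (u : borel X -> R).
Proof.
move=> uM; split; last by move=> x; exact: Cbm_norm.
have n0 (n : nat) : 0 < n.+1%:R :> R by rewrite ltr0n.
have nV0 (n : nat) : 0 < n.+1%:R^-1 :> R by rewrite invr_gt0.
have /choice[v vP] : forall n : nat, exists v : X -> R, (exists L, klipb K L M v) /\
    forall x, `|x| <= n.+1%:R -> `|u x - v x| <= n.+1%:R^-1.
  by move=> n; have [L [v [vL uv]]] := uM _ _ (n0 n) (nV0 n); exists v; split; [exists L|].
apply: (@measurable_fun_cvg _ _ _ setT (v : nat -> borel X -> R)).
  by move=> n; have [[L vL] _] := vP n; exact: (klipb_bmeas K_contr vL).1.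
move=> x _; apply/cvgrPdist_le => e e0.
near=> n; apply: (le_trans ((vP n).2 x _)).
  have : (Num.truncn `|x| <= n)%N by near: n; exact: nbhs_infty_ge.
  move=> xn; apply: (le_trans (ltW (truncnS_gt _))); by rewrite ler_nat ltnS.
rewrite invf_ple ?posrE//.
have : (Num.truncn e^-1 <= n)%N by near: n; exact: nbhs_infty_ge.
by move=> xn; apply: (le_trans (ltW (truncnS_gt _))); rewrite ler_nat ltnS.
Unshelve. all: by end_near. Qed.

Lemma CbmD M N u v : Cbm M u -> Cbm N v -> Cbm (M + N) (fun x => u x + v x).
Proof.
move=> uM vN r e r0 e0; have e20 : 0 < e / 2 by rewrite divr_gt0.
have [L [u' [[[L0 u'L] u'M] uu']]] := uM r _ r0 e20.
have [L' [v' [[[L'0 v'L] v'N] vv']]] := vN r _ r0 e20.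
exists (L + L'), (fun x => u' x + v' x); split.
  split; last by move=> x; apply: le_trans (ler_normD _ _) _; exact: lerD.
  split; first exact: addr_ge0.
  move=> x1 x2; rewrite opprD addrACA mulrDl.
  by apply: le_trans (ler_normD _ _) _; exact: lerD.
move=> x xr; rewrite opprD addrACA [e](splitr e).
by apply: le_trans (ler_normD _ _) _; apply: lerD; [exact: uu'|exact: vv'].
Qed.

Lemma CbmZ M u a : Cbm M u -> Cbm (`|a| * M) (fun x => a * u x).
Proof.
move=> uM r e r0 e0; have a1 : 0 < `|a| + 1 by rewrite ltr_wpDl.
have [L [v [[[L0 vL] vM] uv]]] := uM r (e / (`|a| + 1)) r0 (divr_gt0 e0 a1).
exists (`|a| * L), (fun x => a * v x); split.
  split; last by move=> x; rewrite normrM ler_wpM2l.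
  split; first exact: mulr_ge0.
  by move=> x1 x2; rewrite -mulrBr normrM -mulrA ler_wpM2l.
move=> x xr; rewrite -mulrBr normrM.
apply: (@le_trans _ _ (`|a| * (e / (`|a| + 1)))); first by rewrite ler_wpM2l// uv.
by rewrite mulrA ler_pdivrMr// [leLHS]mulrC ler_wpM2l ?(ltW e0)// lerDl.
Qed.

(** What the stability estimate needs to know of an operator J. Products of the
    operators [I s] with total time t satisfy this whatever their number. *)
Definition tame (J : (X -> R) -> X -> R) t :=
  [/\ forall M f x, Cbm M f -> `|J f x| <= M,
      forall M N f g b, Cbm M f -> Cbm N g -> (forall y, f y <= g y + b) ->
        forall x, J f x <= J g x + b,
      forall M N f g a, 0 <= a <= 1 -> Cbm M f -> Cbm N g -> forall x,
        J (fun y => a * f y + (1 - a) * g y) x <= a * J f x + (1 - a) * J g x &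
      forall M h x, Cbm M h -> J h x <= I t h x].

Lemma tame_I t : 0 <= t -> tame (I t) t.
Proof.
move=> t0; split => //.
- by move=> M f x /Cbm_bmeas bf; exact: Iop_norm t0 bf x.
- by move=> M N f g b /Cbm_bmeas bf /Cbm_bmeas bg fg x; exact: (Iop_le_add t0 bf bg).
- by move=> M N f g a a01 /Cbm_bmeas bf /Cbm_bmeas bg x; exact: (Iop_convex t0 a01 bf bg).
Qed.

(** Write f as the convex combination of weights lam and 1 - lam of (f - g) / lam and
    g / (1 - lam). Convexity bounds J f by the second term, close to J g for small
    lam, plus lam times J of the first. The latter is dominated by [I t], where
    [Iop_tail] applies. The radius and the tolerance depend on t but not on J, so
    the estimate serves products of arbitrarily many factors. *)
Lemma stability t M rho e : 0 <= t -> 0 <= M -> 0 <= rho -> 0 < e ->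
  exists r del, [/\ 0 < r, 0 < del & forall J, tame J t -> forall f g,
    Cbm M f -> Cbm M g -> (forall y, `|y| <= r -> f y <= g y + del) ->
    forall x, `|x| <= rho -> J f x <= J g x + e].
Proof.
move=> t0 M0 rho0 e0.
have [a a0 tail] := Iop_tail t0.
have den : 0 < 2 * e + 6 * M by rewrite ltr_pwDl ?mulr_ge0// mulr_gt0.
(* The final bound contains the errors 2 lam M and (2 M / r) B. *)
have [lam [l0 l1 lM]] : exists lam, [/\ 0 < lam, lam < 1 & 2 * (lam * M) <= e / 3].
  exists (e / (2 * e + 6 * M)); split; first exact: divr_gt0.
    by rewrite ltr_pdivrMr// mul1r; lra.
  rewrite [X in 2 * X]mulrAC mulrA ler_pdivrMr//.
  have : 0 <= e * e by rewrite mulr_ge0// ltW.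
  lra.
(* B bounds the moment term of the tail estimate for x in the ball of radius rho. *)
pose B := `|psi t 0| + expR (c * t) * rho + a.
have B0 : 0 <= B by rewrite addr_ge0// addr_ge0// mulr_ge0// expR_ge0.
have Ml : 0 <= 2 * M / lam by apply: divr_ge0; [apply: mulr_ge0|apply: ltW].
have MB : 0 <= 6 * M * B / e by apply: divr_ge0; [rewrite !mulr_ge0|apply: ltW].
pose r := 2 * M / lam + 6 * M * B / e + 1.
have r0 : 0 < r by rewrite ltr_wpDl// addr_ge0.
exists r, (e / 3); split => [//||J [Jn Jm Jc JI] f g fM gM fg x xr].
  by rewrite divr_gt0.
pose h y := lam^-1 * (f y + -1 * g y).
pose g' y := (1 - lam)^-1 * g y.
have ol0 : 0 < 1 - lam by rewrite subr_gt0.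
have hC := CbmZ lam^-1 (CbmD fM (CbmZ (-1) gM)).
have g'C := CbmZ (1 - lam)^-1 gM.
have l01 : 0 <= lam <= 1 by rewrite !ltW.
have hg' : (fun y => lam * h y + (1 - lam) * g' y) = f.
  by apply/funext => y; rewrite /h /g' !mulVKf ?gt_eqF// mulN1r subrK.
have := Jc _ _ h g' lam l01 hC g'C x; rewrite hg' => H1.
have H2 : J g' x <= J g x + lam / (1 - lam) * M.
  apply: (Jm _ _ _ _ _ g'C gM) => y.
  have -> : (1 - lam)^-1 * g y = g y + lam / (1 - lam) * g y by field; rewrite gt_eqF.
  rewrite lerD2l ler_wpM2l ?divr_ge0 ?(ltW l0) ?(ltW ol0)//.
  exact: le_trans (ler_norm _) (Cbm_norm y gM).
have H3 : - M <= J g x by have := Jn _ _ x gM; rewrite ler_norml => /andP[].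
have H4 : J h x <= e / 3 / lam + 2 * M / r * B / lam.
  apply: (le_trans (JI _ _ x hC)).
  have lV : 0 <= lam^-1 by rewrite invr_ge0 ltW.
  have T := tail _ h (e / 3 / lam) (2 * M / lam) r x (Cbm_bmeas hC) r0 Ml.
  apply: (le_trans (T _ _ _)).
  - by rewrite /r -addrA lerDl addr_ge0.
  - move=> y yr; rewrite /h mulrC ler_wpM2r// mulN1r lerBlDl; exact: fg.
  - move=> y; rewrite /h mulrC -mulrDl ler_wpM2r//.
    have := Cbm_norm y fM; have := Cbm_norm y gM; rewrite !ler_norml => /andP[h1 _] /andP[_ h2].
    have : 0 < e / 3 by rewrite divr_gt0.
    lra.
  rewrite lerD2l.
  have -> : 2 * M / r * B / lam = 2 * M / lam / r * B by field; rewrite !gt_eqF.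
  apply: ler_wpM2l; first by apply: divr_ge0 => //; exact: ltW.
  rewrite /B lerD2r.
  have := psi_lip x 0 t0; rewrite subr0 => P1.
  have P2 := ler_normD (psi t x - psi t 0) (psi t 0); rewrite subrK in P2.
  have P3 := ler_wpM2l (expR_ge0 (c * t)) xr.
  lra.
have := stability_errors l0 l1 H1 H2 H3 H4.
have : 2 * M / r * B <= e / 3.
  rewrite mulrAC ler_pdivrMr//.
  have : e / 3 * (6 * M * B / e) <= e / 3 * r.
    apply: ler_wpM2l; first by apply: divr_ge0 => //; exact: ltW.
    by rewrite /r -addrA [leRHS]addrCA lerDl addr_ge0.
  have -> : e / 3 * (6 * M * B / e) = 2 * M * B by field; rewrite gt_eqF.
  by [].
lra.
Qed.

(** By stability, approximation of u on a large ball passes to [I t u]. *)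
Lemma Iop_Cbm t M u : 0 <= t -> Cbm M u -> Cbm M (I t u).
Proof.
move=> t0 uM r e r0 e0; have M0 := Cbm_ge0 uM.
have [r' [del [r'0 del0 st]]] := stability t0 M0 (ltW r0) e0.
have [L [v [vL uv]]] := uM r' del r'0 del0.
exists (L * expR (c * t)), (I t v); split; first exact: Iop_klipb.
have vM := klipb_Cbm vL; have tt := tame_I t0.
move=> x xr; rewrite ler_distl; apply/andP; split.
  rewrite lerBlDr; apply: (st _ tt v u vM uM _ x xr) => y yr.
  by have := uv y yr; rewrite ler_distl => /andP[+ _]; rewrite lerBlDr.
apply: (st _ tt u v uM vM _ x xr) => y yr.
by have := uv y yr; rewrite ler_distl => /andP[].
Qed.

Lemma Iop_merge_Cbm t s M u x : 0 <= t -> 0 <= s -> Cbm M u ->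
  I t (I s u) x <= I (t + s) u x.
Proof.
move=> t0 s0 uM; have M0 := Cbm_ge0 uM; have ts0 : 0 <= t + s by exact: addr_ge0.
apply/ler_addgt0Pr => e e0; have e20 : 0 < e / 2 by rewrite divr_gt0.
have x0 : 0 <= `|x| by [].
have [r1 [d1 [r10 d10 st1]]] := stability t0 M0 x0 e20.
have [r2 [d2 [r20 d20 st2]]] := stability s0 M0 (ltW r10) d10.
have [r3 [d3 [r30 d30 st3]]] := stability ts0 M0 x0 e20.
have r0 : 0 < Num.max r2 r3 by rewrite lt_max r20.
have d0 : 0 < Num.min d2 d3 by rewrite lt_min d20.
have [L [v [vL uv]]] := uM _ _ r0 d0; have vM := klipb_Cbm vL.
have H1 : I t (I s u) x <= I t (I s v) x + e / 2.
  apply: (st1 _ (tame_I t0) _ _ (Iop_Cbm s0 uM) (Iop_Cbm s0 vM) _ x (lexx _)) => y yr.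
  apply: (st2 _ (tame_I s0) u v uM vM _ y yr) => z zr.
  have := uv z; rewrite le_max zr => /(_ isT); rewrite ler_distl => /andP[_ H].
  by apply: (le_trans H); rewrite lerD2l ge_min lexx.
have H2 : I (t + s) v x <= I (t + s) u x + e / 2.
  apply: (st3 _ (tame_I ts0) v u vM uM _ x (lexx _)) => z zr.
  have := uv z; rewrite le_max zr orbT => /(_ isT); rewrite ler_distl => /andP[H _].
  by rewrite lerBlDr in H; apply: (le_trans H); rewrite lerD2l ge_min lexx orbT.
exact: chain_halves H1 (Iop_merge x t0 s0 vL) H2.
Qed.

(** * Short steps *)

Lemma kernel_near h L M u x : 0 <= h -> klipb K L M u ->
  `|\int[mu h]_z u (psi h x + (z : X)) - u x| <=
  L * (`|psi h (K x) - K x| + mom h).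
Proof.
move=> h0 uL; have bu := klipb_bmeas K_contr uL; have L0 := uL.1.1.
have bux := bmeas_shift (psi h x) bu.
have dist z : `|u (psi h x + z) - u x| <= L * `|psi h (K x) - K x| + L * `|z|.
  apply: (le_trans (uL.1.2 _ _)); rewrite -mulrDr ler_wpM2l// addrAC linearD linearB K_psi//.
  by apply: (le_trans (ler_normD _ _)); rewrite lerD2l.
have A0 : 0 <= L * `|psi h (K x) - K x| by rewrite mulr_ge0.
have E : L * (`|psi h (K x) - K x| + mom h) =
         L * `|psi h (K x) - K x| + L * (mom h + W h (mu h)).
  by rewrite Wp_refl// addr0 mulrDr.
have up : \int[mu h]_z (u (psi h x + (z : X)) - u x) <= L * (`|psi h (K x) - K x| + mom h).
  rewrite E; apply: (bexp_affine h0 (mu_Pp h0) (bmeasD bux (bmeas_cst (- u x)))) => // z.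
  by apply: le_trans (dist z); exact: ler_norm.
have dn : \int[mu h]_z (-1 * u (psi h x + (z : X)) + u x) <=
    L * (`|psi h (K x) - K x| + mom h).
  rewrite E; apply: (bexp_affine h0 (mu_Pp h0) (bmeasD (bmeasZ (-1) bux) (bmeas_cst (u x)))) => // z.
  by apply: le_trans (dist z); rewrite mulN1r addrC -normrN opprB ler_norm.
rewrite (bexp_shift _ _ bux) in up.
rewrite (bexp_shift _ _ (bmeasZ (-1) bux)) (bexpZ _ _ bux) mulN1r in dn.
by rewrite ler_norml; apply/andP; split; lra.
Qed.

(** The reference measure itself is a competitor with penalty 0. *)
Lemma kernel_le_Iop h M u x : 0 <= h -> bmeas M (u : borel X -> R) ->
  \int[mu h]_z u (psi h x + (z : X)) <= I h u x.
Proof.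
move=> h0 bu; rewrite -[leLHS]subr0; apply: (Iop_ub h0 bu) (mu_Pp h0) _.
by rewrite Wp_refl// pen0.
Qed.

Lemma small_time r e : 0 <= r -> 0 < e -> exists2 del, 0 < del &
  forall h, 0 < h -> h < del ->
    mom h <= e /\ forall x, `|x| <= r -> `|psi h (K x) - K x| <= e.
Proof.
move=> r0 e0; have p0 : 0 < p := lt_trans ltr01 p_gt1.
have ep0 : 0 < e `^ p by exact: powR_gt0.
have near1 := psi_cvg r0.
have near2 := mu_cvg.
move/fine_cvgP: near1 => [fin1 /cvgr_lt /(_ e e0) lt1].
move/fine_cvgP: near2 => [fin2 /cvgr_lt /(_ _ ep0) lt2].
have : \forall h \near 0^'+, [/\
    ereal_sup [set `|psi h (K x) - K x|%:E | x in [set x | `|x| <= r]] \is a fin_num,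
    fine (ereal_sup [set `|psi h (K x) - K x|%:E | x in [set x | `|x| <= r]]) < e &
    fine (\int[mu h]_y (`|y : X| `^ p)%:E)%E < e `^ p].
  near=> h; split; near: h; [exact: fin1|exact: lt1|exact: lt2].
rewrite near_withinE => /nbhs_ballP[del /= del0 Hdel].
exists del => // h h0 hdel.
have [|sfin slt mlt] := Hdel h _ h0.
  by rewrite /ball /= sub0r normrN gtr0_norm.
split.
  rewrite /mom -[leRHS](powRr1 (ltW e0)) -[X in _ <= _ `^ X](mulfV (lt0r_neq0 p0)) powRrM.
  rewrite ge0_ler_powR ?invr_ge0 ?nnegrE ?powR_ge0 ?(ltW p0) ?(ltW mlt)//.
  by rewrite fine_ge0// integral_ge0// => y _; rewrite lee_fin powR_ge0.
move=> x xr; apply: le_trans (ltW slt); rewrite -lee_fin fineK//.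
by apply: ereal_sup_ubound; exists x.
Unshelve. all: by end_near. Qed.

(** By the semigroup identity, u and its average over [mu 0] have the same average
    over short times h, and both averages converge as h tends to 0. *)
Lemma kernel0 L M u x : klipb K L M u -> \int[mu 0]_z u (x + (z : X)) = u x.
Proof.
move=> uL; have bu := klipb_bmeas K_contr uL; have L0 := uL.1.1.
pose v w := \int[mu 0]_z u (w + (z : X)).
have vL : klipb K L M v.
  split; last by move=> w; exact: bexp_norm (bmeas_shift w bu).
  split => // w1 w2; apply: (bexp_near _ (bmeas_shift w1 bu) (bmeas_shift w2 bu)) => z.
  apply: (le_trans (uL.1.2 _ _)); by rewrite opprD addrACA subrr addr0.
suff : `|v x - u x| <= 0 by rewrite normr_le0 subr_eq0 => /eqP.
apply/ler_addgt0Pr => e e0; rewrite add0r.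
have L1 : 0 < 4 * (L + 1) by rewrite mulr_gt0// ltr_wpDl.
have [del del0 small] := small_time (normr_ge0 x) (divr_gt0 e0 L1).
pose h := del / 2; have h0 : 0 < h by rewrite divr_gt0.
have hd : h < del by rewrite /h ltr_pdivrMr// mulr_natr mulr2n ltrDl.
have [m1 /(_ x (lexx _)) m2] := small h h0 hd.
have E := expectation_semigroup x (lexx 0) (ltW h0) (klipb_Lipb uL).
rewrite addr0 in E.
have N1 := kernel_near x (ltW h0) uL; rewrite -E in N1.
have N2 := kernel_near x (ltW h0) vL.
have EE : \int[mu h]_y \int[mu 0]_z u (psi 0 (psi h x + (y : X)) + (z : X)) =
    \int[mu h]_y v (psi h x + (y : X)).
  by apply: eq_Rintegral => y _; rewrite psi0.
rewrite EE in N1.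
have bnd : L * (`|psi h (K x) - K x| + mom h) <= e / 2.
  apply: (@le_trans _ _ ((L + 1) * (2 * (e / (4 * (L + 1)))))).
    apply: ler_pM => //; first by rewrite addr_ge0// (mom_le (ltW h0)).1.
      by rewrite lerDl.
    by rewrite mulr_natl mulr2n; exact: lerD.
  rewrite le_eqVlt; apply/orP; left; apply/eqP; field.
  by rewrite gt_eqF// ltr_wpDl.
have N3 := le_trans N1 bnd; have N4 := le_trans N2 bnd.
rewrite distrC in N4.
have := lerD N4 N3; rewrite -splitr; apply: le_trans.
by apply: le_trans (ler_normD _ _); rewrite addrA subrK.
Qed.

Lemma bexp_moment d (T : measurableType d) (P : probability T R) M (g f : T -> R) A a :
  bmeas M g -> measurable_fun setT f -> 0 <= A -> (forall w, 0 <= f w) ->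
  (forall w, g w <= A + f w) -> moment_le P p f a -> \int[P]_w g w <= A + a.
Proof.
move=> bg mf A0 f0 gAf fa.
pose g' w := Num.max 0 (g w).
have bg' : bmeas `|M| g'.
  split; first by apply: measurable_maxr => //; exact: bg.1.
  move=> w; have := bg.2 w; have := ler_norm M; rewrite /g' /Num.max.
  by case: ifP; rewrite ?normr0//; lra.
apply: (@le_trans _ _ (\int[P]_w g' w)).
  by apply: (bexp_le _ bg bg') => z; rewrite le_max lexx orbT.
rewrite -lee_fin -(bexpE P bg').
apply: (@le_trans _ _ (\int[P]_w (A%:E + (`|f w|)%:E))%E).
  apply: ge0_le_integral => //.
  - by move=> z _; rewrite lee_fin le_max lexx.
  - by apply/measurable_EFinP; exact: bg'.1.
  - apply: emeasurable_funD => //; apply/measurable_EFinP; exact: measurableT_comp.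
  - by move=> w _; rewrite -EFinD lee_fin /g' ge_max (ger0_norm (f0 w)) gAf andbT addr_ge0.
rewrite ge0_integralD//; last by apply/measurable_EFinP; exact: measurableT_comp.
rewrite integral_cst// [X in (_ * X + _)%E](_ : _ = 1%E); last exact: probability_setT.
by rewrite mule1 EFinD leeD2l//; exact: (moment_le1 p_gt1 mf fa).
Qed.

(** At time 0 only the displacement 0 has a finite penalty, and averaging over
    [mu 0] does nothing. *)
Lemma Iop0 M u x : Cbm M u -> I 0 u x = u x.
Proof.
have klip_case L v y : klipb K L M v -> I 0 v y = v y.
  move=> vL; have bv := klipb_bmeas K_contr vL.
  apply/eqP; rewrite eq_le; apply/andP; split; last first.
    by have := kernel_le_Iop y (lexx 0) bv; rewrite psi0 (kernel0 y vL).
  apply/ler_addgt0Pr => e e0.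
  have [pi [a [r [[r0 pi1 pia par] H]]]] := Iop_coupling_near y (lexx 0) vL e0.
  have a0 : a = 0.
    apply/eqP; rewrite eq_le pia.1 andbT leNgt; apply/negP => ap.
    by move: par; rewrite pen_time0// leNgt ltry.
  apply: (le_trans H); rewrite lerD2r lerBlDr ler_wpDr//.
  have mfst : measurable_fun setT (fun z : TT => z.1) by exact: measurable_fst.
  have bvy := bmeas_comp mfst (bmeas_shift y bv).
  have bvd : bmeas M (fun z : TT => v (psi 0 y + z.1 + z.2)).
    apply: (bmeas_comp (phi := fun z : TT => psi 0 y + (z.1 : X) + (z.2 : X) : borel X) _ bv).
    apply: measurable_borelD => //; apply: measurable_borelD => //; exact: measurable_cst.
  rewrite -[leRHS](kernel0 y vL) -(expectation_law mfst pi1 (bmeas_shift y bv)).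
  have mL : measurable_fun setT (fun z : TT => `|(z.2 : X)|).
    by apply: measurable_borel_norm; exact: measurable_snd.
  have LL : moment_le pi p (fun z => L * `|(z.2 : X)|) (L * a).
    exact: moment_leZ vL.1.1 mL pia.
  have bdiff := bmeasD bvd (bmeasZ (-1) bvy).
  have mLL : measurable_fun setT (fun z : TT => L * `|(z.2 : X)|) by exact: measurable_funM.
  have := bexp_moment bdiff mLL (lexx 0) _ _ LL.
  rewrite a0 mulr0 addr0 (bexpD _ bvd (bmeasZ (-1) bvy)) (bexpZ _ _ bvy) mulN1r subr_le0.
  apply => z; first by rewrite mulr_ge0// vL.1.1.
  rewrite add0r mulN1r psi0; apply: (le_trans (ler_norm _)).
  by apply: (le_trans (klip_dist K_contr _ _ vL.1)); rewrite /= addrAC subrr add0r.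
move=> uM; suff : `|I 0 u x - u x| <= 0 by rewrite normr_le0 subr_eq0 => /eqP.
apply/ler_addgt0Pr => e e0; rewrite add0r.
have e20 : 0 < e / 2 by rewrite divr_gt0.
have [r [del [r0 del0 st]]] := stability (lexx 0) (Cbm_ge0 uM) (normr_ge0 x) e20.
have rx : 0 < Num.max r `|x| by rewrite lt_max r0.
have dm : 0 < Num.min del (e / 2) by rewrite lt_min del0.
have [L [v [vL uv]]] := uM _ _ rx dm; have vM := klipb_Cbm vL.
have uv' y : `|y| <= r -> `|u y - v y| <= del.
  by move=> yr; apply: le_trans (uv y _) _; rewrite ?le_max ?yr// ge_min lexx.
have uvx : `|u x - v x| <= e / 2.
  by apply: le_trans (uv x _) _; rewrite ?le_max ?lexx ?orbT// ge_min lexx orbT.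
have h1 : I 0 u x <= I 0 v x + e / 2.
  apply: (st _ (tame_I (lexx 0)) u v uM vM _ x (lexx _)) => y yr.
  by have := uv' y yr; rewrite ler_distl => /andP[].
have h2 : I 0 v x <= I 0 u x + e / 2.
  apply: (st _ (tame_I (lexx 0)) v u vM uM _ x (lexx _)) => y yr.
  by have := uv' y yr; rewrite ler_distl => /andP[+ _]; rewrite lerBlDr.
rewrite (klip_case _ _ _ vL) in h1 h2; exact: dist_halves h1 h2 uvx.
Qed.

(** * Products of steps *)

Definition steps (l : seq R) u := foldr I u l.

Lemma steps_Cbm l M u : all (>= 0) l -> Cbm M u -> Cbm M (steps l u).
Proof.
elim: l => [//|s l IH] /= /andP[s0 l0] uM; apply: Iop_Cbm => //; exact: IH.
Qed.

Lemma steps_klipb l L M u : all (>= 0) l -> klipb K L M u ->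
  klipb K (L * expR (c * \sum_(s <- l) s)) M (steps l u).
Proof.
elim: l => [|s l IH] /=; first by rewrite big_nil mulr0 expR0 mulr1.
move=> /andP[s0 l0] uL; rewrite big_cons mulrDr expRD [expR (c * s) * _]mulrC mulrA.
exact: Iop_klipb (IH l0 uL).
Qed.

(** Domination by a single operator is the merging inequality, used repeatedly. *)
Lemma tame_steps l : all (>= 0) l -> tame (steps l) (\sum_(s <- l) s).
Proof.
elim: l => [_|s l IH /= /andP[s0 l0]].
  rewrite big_nil; split => //.
  - by move=> M f x; exact: Cbm_norm.
  - by move=> M h x hM; rewrite (Iop0 x hM).
have [Jn Jm Jc JI] := IH l0; have [_ Im Ic _] := tame_I s0.
have S0 : 0 <= \sum_(s <- l) s.
  by rewrite big_seq sumr_ge0// => i il; exact: (allP l0).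
split.
- by move=> M f x fM; apply: Cbm_norm; exact: Iop_Cbm s0 (steps_Cbm l0 fM).
- move=> M N f g b fM gN fg x /=.
  by apply: (Im _ _ _ _ _ (steps_Cbm l0 fM) (steps_Cbm l0 gN)) => y; exact: Jm fM gN fg y.
- move=> M N f g a a01 fM gN x /=.
  have fgC := CbmD (CbmZ a fM) (CbmZ (1 - a) gN).
  have JfgC := CbmD (CbmZ a (steps_Cbm l0 fM)) (CbmZ (1 - a) (steps_Cbm l0 gN)).
  apply: le_trans (Ic _ _ _ _ _ a01 (steps_Cbm l0 fM) (steps_Cbm l0 gN) x).
  rewrite -[leRHS]addr0; apply: (Im _ _ _ _ _ (steps_Cbm l0 fgC) JfgC) => y.
  by rewrite addr0; exact: Jc a01 fM gN y.
- move=> M h x hM /=; rewrite big_cons.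
  apply: le_trans (Iop_merge_Cbm x s0 S0 hM).
  rewrite -[leRHS]addr0; apply: (Im _ _ _ _ _ (steps_Cbm l0 hM) (Iop_Cbm S0 hM)) => y.
  by rewrite addr0; exact: JI hM.
Qed.

(** * Upper semicontinuity in the length of a step *)

(** The law of independent samples of [mu s] and [mu b]. *)
Lemma product_law s b : exists P : probability TT R,
  forall g : TT -> \bar R, measurable_fun setT g -> (forall z, 0 <= g z)%E ->
    (\int[P]_z g z = \int[mu s]_y \int[mu b]_z g (y, z))%E.
Proof.
apply: (mixture (mu s) (fun=> mu b) (k := fun=> 0%N)) => i.
by rewrite preimage_cst; case: ifP.
Qed.

Lemma rescale_bound s b : 0 < s -> 0 <= b ->
  let th := s * expR (- (c * b)) / (s + b) in
  [/\ 0 <= th, th <= 1 & 1 - th <= b * ((1 + s * c) / s)].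
Proof.
move=> s0 b0 th; have sb0 : 0 < s + b by rewrite ltr_wpDr.
have e1 : expR (- (c * b)) <= 1.
  by rewrite -[leRHS]expR0 ler_expR oppr_le0 mulr_ge0.
have e2 : 1 - c * b <= expR (- (c * b)) := expR_ge1Dx (- (c * b)).
split.
- by apply: divr_ge0; [rewrite mulr_ge0 ?expR_ge0 ?(ltW s0)|exact: ltW].
- by rewrite ler_pdivrMr// mul1r (le_trans (ler_wpM2l (ltW s0) e1))// mulr1 lerDl.
rewrite lerBlDl -lerBlDr /th ler_pdivlMr//.
have -> : (1 - b * ((1 + s * c) / s)) * (s + b) =
    s * (1 - c * b) - b * (b * ((1 + s * c) / s)).
  by field; rewrite gt_eqF.
apply: (@le_trans _ _ (s * (1 - c * b))); last by rewrite ler_wpM2l// ltW.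
rewrite gerBl; apply: mulr_ge0 => //; apply: mulr_ge0 => //.
by apply: divr_ge0; [rewrite addr_ge0// mulr_ge0// ltW | exact: ltW].
Qed.

(** Take a near-optimal displaced sample (y, d) for time s + b. By the semigroup
    identity, y may be replaced by psi b (psi s x + y1) + y2 - psi (s + b) x with
    independent samples y1 of [mu s] and y2 of [mu b]. Shrinking d to th d makes it
    affordable in time s by [pen_rescale]. Then y1 and th d compete in [I s w x], and
    the two points are K-close: psi b is K-close to the identity on balls, y2 is small
    in p-norm, and th is close to 1. The bound on w takes care of large
    psi s x + y1. The same b works for all w with given Lipschitz constant and
    bound. *)
Lemma Iop_usc s L M rho e : 0 < s -> 0 <= L -> 0 <= M -> 0 <= rho -> 0 < e ->
  exists2 del, 0 < del & forall b w x, 0 <= b -> b < del -> klipb K L M w ->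
    `|x| <= rho -> I (s + b) w x <= I s w x + e.
Proof.
move=> s0 L0 M0 rho0 e0; have s0' := ltW s0.
have e80 : 0 < e / 8 by rewrite divr_gt0.
have [C C0 HC] := pen_lower p_gt1 c_ge0 phi_ge0 phi0 phi_neq0 phi_pconvex (s + 1) ler01.
(* A bounds the displacement of a near-optimal sample for times up to s + 1. *)
pose A := 2 * M + e / 8 + (s + 1) * C.
have A0 : 0 <= A.
  apply: addr_ge0; first by apply: addr_ge0; [exact: mulr_ge0|exact: ltW].
  by apply: mulr_ge0 => //; exact: addr_ge0.
(* B / q bounds the probability that psi s x + y1 leaves the ball of radius q. *)
pose B := `|psi s 0| + expR (c * s) * rho + mom s.
have B0 : 0 <= B.
  by rewrite addr_ge0 ?(mom_le s0').1// addr_ge0// mulr_ge0// expR_ge0.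
pose q := 2 * M * B / (e / 8) + 1.
have q0 : 0 < q by rewrite ltr_wpDl// divr_ge0 ?(ltW e80)// !mulr_ge0.
have L1 : 0 < L + 1 by rewrite ltr_wpDl.
have [d1 d10 small] := small_time (ltW q0) (divr_gt0 e80 L1).
have A1 : 0 < A + 1 by rewrite ltr_wpDl.
have sc : 0 < (1 + s * c) / s by rewrite divr_gt0// ltr_pwDl// mulr_ge0.
pose d2 := e / 8 / ((L + 1) * (A + 1) * ((1 + s * c) / s)).
have d20 : 0 < d2 by apply: divr_gt0 => //; apply: mulr_gt0 => //; exact: mulr_gt0.
exists (Num.min 1 (Num.min d1 d2)); first by rewrite !lt_min ltr01 d10.
move=> b w x b0; rewrite !lt_min => /andP[b1 /andP[bd1 bd2]] wL xr.
move: b0; rewrite le_eqVlt => /predU1P[<-|bp].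
  by rewrite addr0 lerDl ltW.
have b0 := ltW bp; have sb0 : 0 <= s + b by rewrite addr_ge0.
have bw := klipb_bmeas K_contr wL.
have [mb gb] := small b bp bd1.
have [pi [a [r [[r0 pi1 pia par] H]]]] := Iop_coupling_near x sb0 wL e80.
have bpi : bmeas M (fun z : TT => w (psi (s + b) x + z.1 + z.2)).
  apply: (bmeas_comp (phi := fun z : TT => psi (s + b) x + (z.1 : X) + (z.2 : X) : borel X) _ bw).
  apply: measurable_borelD => //; apply: measurable_borelD => //; exact: measurable_cst.
have aA : a <= A.
  have rM : r <= 2 * M + e / 8.
    have := Iop_norm sb0 bw x; rewrite ler_norml => /andP[h1 _].
    have := bexp_norm pi bpi; rewrite ler_norml => /andP[_ h2].
    exact: usc_penalty_bound h1 H h2.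
  have := HC (s + b) a sb0 _ pia.1; rewrite lerD2l => /(_ (ltW b1)) h3.
  have := le_trans h3 par; rewrite lee_fin mul1r lerBlDr => h4.
  apply: (le_trans h4); rewrite /A; apply: lerD => //.
  by rewrite ler_wpM2r// lerD2l ltW.
have [P' P'E] := product_law s b.
have mk0 : forall i : nat, measurable ((fun=> 0%N) @^-1` [set i] : set (borel X)).
  by move=> i; rewrite preimage_cst; case: ifP.
have P'R := mixture_bexp (Q := fun=> mu b) mk0 P'E.
have mfst : measurable_fun setT (fun z : TT => z.1) by exact: measurable_fst.
have msnd : measurable_fun setT (fun z : TT => z.2) by exact: measurable_snd.
pose Y' (v : TT) : borel X := psi b (psi s x + (v.1 : X)) + (v.2 : X) - psi (s + b) x.
have mpsi : measurable_fun setT (psi b : borel X -> borel X).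
  by apply: continuous_borel; exact: psi_continuous.
have mYs : measurable_fun setT (fun v : TT => psi b (psi s x + (v.1 : X)) + (v.2 : X) : borel X).
  apply: measurable_borelD => //.
  apply: (measurableT_comp (f := psi b : borel X -> borel X) mpsi).
  by apply: measurable_borelD => //; exact: measurable_cst.
have mY' : measurable_fun setT Y'.
  exact: (measurable_borelB X_separable mYs (measurable_cst _)).
have klaw : same_klaw K pi fst P' Y'.
  move=> v vL; have [Lv [Mv vLM]] := Lipb_klipb vL.
  have vsL := klip_comp_shift (- psi (s + b) x) vLM.
  have bv := klipb_bmeas K_contr vLM.
  rewrite (P'R _ _ (bmeas_comp mY' bv)) (expectation_law mfst pi1 bv).
  have := expectation_semigroup x b0 s0' (klipb_Lipb vsL).
  under [X in _ = X -> _]eq_Rintegral do rewrite addKr.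
  move=> <-; apply: eq_Rintegral => y _; apply: eq_Rintegral => z _.
  by rewrite /Y' /= addrC.
have [Pi [Pi1 Pi2 HT]] :=
  transfer K_contr X_separable mfst msnd mY' klaw (psi (s + b) x) wL e80.
have [th0 th1 thb] := rescale_bound s0 b0.
set th := s * expR (- (c * b)) / (s + b) in th0 th1 thb.
have law11 (g : borel X -> \bar R) : measurable_fun setT g -> (forall y, 0 <= g y)%E ->
    (\int[Pi]_z g z.1.1 = \int[mu s]_y g y)%E.
  move=> mg g0; rewrite (Pi1 (fun v => g v.1))//; last exact: measurableT_comp.
  rewrite P'E//; last exact: measurableT_comp.
  apply: eq_integral => y _; rewrite /= integral_cst//.
  by rewrite [X in (_ * X)%E](_ : _ = 1%E) ?mule1//; exact: probability_setT.
have law12 (g : borel X -> \bar R) : measurable_fun setT g -> (forall y, 0 <= g y)%E ->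
    (\int[Pi]_z g z.1.2 = \int[mu b]_y g y)%E.
  move=> mg g0; rewrite (Pi1 (fun v => g v.2))//; last exact: measurableT_comp.
  rewrite P'E//; last exact: measurableT_comp.
  rewrite /= integral_cst// [X in (_ * X)%E](_ : _ = 1%E) ?mule1//; exact: probability_setT.
have mn : measurable_fun setT norm by exact: measurable_borel_norm.
have m11 : measurable_fun setT (fun z : (TT * TT)%type => z.1.1).
  exact: (measurableT_comp measurable_fst measurable_fst).
have m12 : measurable_fun setT (fun z : (TT * TT)%type => z.1.2).
  exact: (measurableT_comp measurable_snd measurable_fst).
have m22 : measurable_fun setT (fun z : (TT * TT)%type => z.2.2).
  exact: (measurableT_comp measurable_snd measurable_snd).
have n11 : measurable_fun setT (fun z : (TT * TT)%type => `|(z.1.1 : X)|).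
  exact: measurable_borel_norm.
have n12 : measurable_fun setT (fun z : (TT * TT)%type => `|(z.1.2 : X)|).
  exact: measurable_borel_norm.
have n22 : measurable_fun setT (fun z : (TT * TT)%type => `|(z.2.2 : X)|).
  exact: measurable_borel_norm.
have M11 : moment_le Pi p (fun z => `|(z.1.1 : X)|) (mom s).
  exact: (moment_law mn law11 (mom_le s0')).
have M12 : moment_le Pi p (fun z => `|(z.1.2 : X)|) (mom b).
  exact: (moment_law mn law12 (mom_le b0)).
have ns : measurable_fun setT (fun z : TT => `|(z.2 : X)|) by exact: measurable_borel_norm.
have M22 : moment_le Pi p (fun z => `|(z.2.2 : X)|) a := moment_law ns Pi2 pia.
have msc : measurable_fun setT (fun z : (TT * TT)%type => th *: (z.2.2 : X) : borel X).
  apply: (measurableT_comp (f := (fun y : borel X => th *: (y : X)) : borel X -> borel X) _ m22).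
  by apply: continuous_borel => y; exact: scaler_continuous.
have Msc : moment_le Pi p (fun z => `|th *: (z.2.2 : X)|) (th * a).
  have mth : measurable_fun setT (fun z : (TT * TT)%type => th * `|(z.2.2 : X)|).
    exact: measurable_funM.
  apply: (moment_le_dom p_gt1 _ mth _ (moment_leZ th0 n22 M22)).
    exact: measurable_borel_norm.
  by move=> z; rewrite normrZ (ger0_norm th0).
have Ylaw : same_klaw K Pi (fun z : (TT * TT)%type => z.1.1) (mu s) id.
  move=> v vL; have [Lv [Mv vLM]] := Lipb_klipb vL.
  exact: (expectation_law m11 law11 (klipb_bmeas K_contr vLM)).
have pth : (pen s (th * a) <= r%:E)%E.
  exact: (le_trans (pen_rescale c phi_ge0 s0 b0 pia.1) par).
have HI := Iop_coupling_le x s0' wL m11 msc Ylaw Msc pth.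
pose h1 (z : (TT * TT)%type) := w (psi (s + b) x + Y' z.1 + z.2.2).
pose h2 (z : (TT * TT)%type) := w (psi s x + z.1.1 + th *: z.2.2).
have mYz : measurable_fun setT (fun z : (TT * TT)%type => Y' z.1).
  exact: (measurableT_comp mY' measurable_fst).
have bh1 : bmeas M h1.
  apply: (bmeas_comp (phi := fun z : (TT * TT)%type =>
    psi (s + b) x + (Y' z.1 : X) + (z.2.2 : X) : borel X) _ bw).
  apply: measurable_borelD => //; apply: measurable_borelD => //; exact: measurable_cst.
have bh2 : bmeas M h2.
  apply: (bmeas_comp (phi := fun z : (TT * TT)%type =>
    psi s x + (z.1.1 : X) + (th *: (z.2.2 : X)) : borel X) _ bw).
  apply: measurable_borelD => //; apply: measurable_borelD => //; exact: measurable_cst.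
pose f (z : (TT * TT)%type) :=
  2 * M / q * `|(z.1.1 : X)| + L * `|(z.1.2 : X)| + L * (1 - th) * `|(z.2.2 : X)|.
have Mq : 0 <= 2 * M / q by rewrite divr_ge0 ?(ltW q0)// mulr_ge0.
have Lth : 0 <= L * (1 - th) by rewrite mulr_ge0// subr_ge0.
have k11 : measurable_fun setT (fun z : (TT * TT)%type => 2 * M / q * `|(z.1.1 : X)|).
  exact: measurable_funM.
have k12 : measurable_fun setT (fun z : (TT * TT)%type => L * `|(z.1.2 : X)|).
  exact: measurable_funM.
have k22 : measurable_fun setT (fun z : (TT * TT)%type => L * (1 - th) * `|(z.2.2 : X)|).
  exact: measurable_funM.
have k1112 := measurable_funD k11 k12.
have mf : measurable_fun setT f by exact: measurable_funD.
have Mf : moment_le Pi p f (2 * M / q * mom s + L * mom b + L * (1 - th) * a).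
  apply: (moment_leD p_gt1 k1112 k22 _ (moment_leZ Lth n22 M22)).
  exact: (moment_leD p_gt1 k11 k12 (moment_leZ Mq n11 M11) (moment_leZ L0 n12 M12)).
have f0 z : 0 <= f z.
  by apply: addr_ge0; [apply: addr_ge0; exact: mulr_ge0|exact: mulr_ge0].
pose e1 := e / 8 / (L + 1).
have e10 : 0 < e1 by rewrite divr_gt0.
have pointwise z : h1 z + -1 * h2 z <= L * e1 + 2 * M / q * `|psi s x| + f z.
  rewrite mulN1r; set zz := psi s x + (z.1.1 : X).
  have [zq|qz] := leP `|zz| q.
    apply: (@le_trans _ _ (L * (e1 + `|(z.1.2 : X)| + (1 - th) * `|(z.2.2 : X)|))).
      apply: (le_trans (ler_norm _)); apply: (le_trans (wL.1.2 _ _)).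
      rewrite ler_wpM2l//.
      have -> : psi (s + b) x + Y' z.1 + z.2.2 - (psi s x + z.1.1 + th *: z.2.2) =
          (psi b zz - zz) + (z.1.2 + (1 - th) *: (z.2.2 : X)).
        rewrite /Y' [psi (s + b) x + _]addrC subrK opprD addrACA scalerBl scale1r.
        by rewrite -/zz [psi b zz + _ - _]addrAC -!addrA.
      rewrite linearD; apply: (le_trans (ler_normD _ _)); rewrite -addrA; apply: lerD.
        by rewrite linearB K_psi//; exact: gb.
      apply: (le_trans (K_contr _)); apply: (le_trans (ler_normD _ _)).
      by rewrite normrZ (ger0_norm (_ : 0 <= 1 - th))// subr_ge0.
    have h3 : 0 <= 2 * M / q * (`|psi s x| + `|(z.1.1 : X)|).
      by rewrite mulr_ge0// addr_ge0.
    exact: usc_pointwise_near.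
  have : 2 * M <= 2 * M / q * (`|psi s x| + `|(z.1.1 : X)|).
    rewrite mulrAC ler_pdivlMr// ler_wpM2l ?mulr_ge0// (le_trans (ltW qz))//.
    exact: ler_normD.
  have h1M : h1 z <= M by apply: le_trans (bh1.2 z); exact: ler_norm.
  have h2M : - M <= h2 z by have := bh2.2 z; rewrite ler_norml => /andP[].
  have h3 : 0 <= L * e1 + L * `|(z.1.2 : X)| + L * (1 - th) * `|(z.2.2 : X)|.
    have e1_ge0 := ltW e10.
    by apply: addr_ge0; [apply: addr_ge0; exact: mulr_ge0|exact: mulr_ge0].
  by move=> h4; exact: usc_pointwise_far h1M h2M h4 h3.
have AA0 : 0 <= L * e1 + 2 * M / q * `|psi s x|.
  by have e1_ge0 := ltW e10; apply: addr_ge0; exact: mulr_ge0.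
have := bexp_moment (bmeasD bh1 (bmeasZ (-1) bh2)) mf AA0 f0 pointwise Mf.
rewrite (bexpD _ bh1 (bmeasZ (-1) bh2)) (bexpZ _ (-1) bh2) mulN1r lerBlDr => total.
have E1 : L * e1 <= e / 8.
  by rewrite /e1 mulrA ler_pdivrMr// [leLHS]mulrC ler_wpM2l ?(ltW e80)// lerDl.
have E2 : L * mom b <= e / 8 by apply: le_trans E1; rewrite ler_wpM2l.
have E3 : 2 * M / q * `|psi s x| + 2 * M / q * mom s <= e / 8.
  rewrite -mulrDr; apply: (@le_trans _ _ (2 * M / q * B)).
    rewrite ler_wpM2l// /B lerD2r.
    have P1 := psi_lip x 0 s0'; rewrite subr0 in P1.
    have P2 := ler_normD (psi s x - psi s 0) (psi s 0); rewrite subrK addrC in P2.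
    apply: (le_trans P2); rewrite lerD2l; apply: (le_trans P1).
    by rewrite ler_wpM2l ?expR_ge0.
  have e8 : e / 8 != 0 by rewrite gt_eqF.
  have qE : e / 8 * q = 2 * M * B + e / 8.
    by rewrite /q [e / 8 * _]mulrDr mulr1 mulrCA mulfV// mulr1.
  by rewrite mulrAC ler_pdivrMr// qE lerDl ltW.
have E4 : L * (1 - th) * a <= e / 8.
  apply: (@le_trans _ _ ((L + 1) * (d2 * ((1 + s * c) / s)) * (A + 1))).
    apply: ler_pM => //; first exact: pia.1.
      apply: ler_pM => //; first by rewrite subr_ge0.
        by rewrite lerDl.
      by apply: (le_trans thb); rewrite ler_wpM2r ?(ltW sc)// ltW.
    by apply: (le_trans aA); rewrite lerDl.
  rewrite /d2 le_eqVlt; apply/orP; left; apply/eqP; field.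
  by rewrite (gt_eqF s0) (gt_eqF A1) (gt_eqF L1) gt_eqF// ltr_pwDl// mulr_ge0.
apply: (usc_errors_total H HT _ HI (ltW e0)).
apply: (le_trans total); rewrite addrC lerD2l.
exact: usc_errors E1 E2 E3 E4.
Qed.

(** * Comparing a partition with a fine one *)

(** [I b w] dominates the average of w along the reference model, which moves w
    little on balls when b is small. *)
Lemma small_step L M r e : 0 <= L -> 0 <= r -> 0 < e -> exists2 del, 0 < del &
  forall b w, 0 <= b -> b < del -> klipb K L M w ->
    forall y, `|y| <= r -> w y <= I b w y + e.
Proof.
move=> L0 r0 e0; have L1 : 0 < 2 * (L + 1) by rewrite mulr_gt0// ltr_wpDl.
have [del del0 small] := small_time r0 (divr_gt0 e0 L1).
exists del => // b w b0 bd wL y yr; have bw := klipb_bmeas K_contr wL.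
move: b0; rewrite le_eqVlt => /predU1P[<-|bp].
  by rewrite (Iop0 y (klipb_Cbm wL)) lerDl ltW.
have [m1 /(_ y yr) m2] := small b bp bd; have b0 := ltW bp.
have := kernel_near y b0 wL; rewrite distrC ler_distl => /andP[_ H1].
apply: (le_trans H1); apply: lerD; first exact: kernel_le_Iop b0 bw.
apply: (@le_trans _ _ ((L + 1) * (2 * (e / (2 * (L + 1)))))).
  apply: ler_pM => //; first by rewrite addr_ge0// (mom_le b0).1.
    by rewrite lerDl.
  by rewrite mulr_natl mulr2n; exact: lerD.
rewrite le_eqVlt; apply/orP; left; apply/eqP; field.
by rewrite gt_eqF// ltr_wpDl.
Qed.

(** Induction on l. Let s be its first step. In the product over g, the factors up to
    the one that crosses time s merge into a single [I (s + b)], where the overshoot b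
    is smaller than the mesh of g. By upper semicontinuity it may be replaced by
    [I s], and the lost time b is put back in front of the remaining steps by
    [small_step]. These remaining steps, preceded by b, are a fine list for the tail of
    l. The intermediate functions are K-Lipschitz with a constant depending on
    total time only, and the error made under [I s] is controlled by stability. *)
Lemma refine L0 M u l : klipb K L0 M u -> all (> 0) l ->
  forall rho e, 0 <= rho -> 0 < e -> exists2 del, 0 < del &
    forall g, all (>= 0) g -> all (< del) g -> \sum_(i <- g) i = \sum_(i <- l) i ->
    forall x, `|x| <= rho -> steps g u x <= steps l u x + e.
Proof.
move=> uL; have uM := klipb_Cbm uL; have M0 := Cbm_ge0 uM.
elim: l => [_ rho e rho0 e0|s l IH /= /andP[s0 lp] rho e rho0 e0].
  exists 1 => // g g0 _; rewrite big_nil => gS x xr.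
  suff -> : steps g u x = u x by rewrite lerDl ltW.
  elim: g g0 gS {xr} => [//|q g IHg] /= /andP[q0 g0]; rewrite big_cons => S0.
  have gS0 : 0 <= \sum_(i <- g) i.
    by rewrite big_seq sumr_ge0// => i ig; exact: (allP g0).
  have q00 : q = 0.
    by apply/eqP; rewrite eq_le q0 andbT -S0 lerDl.
  move: S0; rewrite q00 add0r => S0.
  by rewrite (Iop0 x (steps_Cbm g0 uM)); exact: IHg.
have s0' := ltW s0; have {}IH := IH lp.
have l0 : all (>= 0) l by apply: sub_all lp => z /ltW.
set T := \sum_(i <- l) i in IH.
have T0 : 0 <= T by rewrite /T big_seq sumr_ge0// => i il; exact: (allP l0).
pose Lm := L0 * expR (c * (s + T)).
have Lm0 : 0 <= Lm by rewrite mulr_ge0 ?expR_ge0// uL.1.1.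
have e40 : 0 < e / 4 by rewrite divr_gt0.
have [r1 [d1 [r10 d10 st]]] := stability s0' M0 rho0 e40.
have [d2 d20 small] := small_step M Lm0 (ltW r10) d10.
have [d3 d30 HIH] := IH r1 d1 (ltW r10) d10.
have [d4 d40 usc] := Iop_usc s0 Lm0 M0 rho0 e40.
exists (Num.min d2 (Num.min d3 d4)); first by rewrite !lt_min d20 d30.
move=> g g0 gd; rewrite big_cons -/T => gS x xr.
have [P [q [rest [b [gE PS b0 bq bS]]]]] := splitting g0 s0 T0 gS.
move: g0 gd; rewrite gE !all_cat /= => /andP[P0 /andP[q0 rest0]].
move=> /andP[_ /andP[]]; rewrite !lt_min => /and3P[qd2 qd3 qd4] restd.
have bd3 := le_lt_trans bq qd3.
have rest3 : all (< d3) rest.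
  by apply: sub_all restd => z /=; rewrite !lt_min => /and3P[].
set w := steps rest u.
have wM : Cbm M w := steps_Cbm rest0 uM.
have wL : klipb K Lm M w.
  have [[wl0 wl] wn] := steps_klipb rest0 uL; split => //; split => // x1 x2.
  apply: (le_trans (wl x1 x2)); rewrite ler_wpM2r// ler_wpM2l ?uL.1.1// ler_expR.
  by rewrite ler_wpM2l// -bS addrA lerDr addr_ge0.
have PS0 : 0 <= \sum_(i <- P) i.
  by rewrite big_seq sumr_ge0// => i il; exact: (allP P0).
have H1 : steps (P ++ q :: rest) u x <= I (s + b) w x.
  rewrite -PS /steps foldr_cat /=.
  apply: le_trans (Iop_merge_Cbm x PS0 q0 wM).
  by have [_ _ _ H] := tame_steps P0; exact: (H _ _ x (Iop_Cbm q0 wM)).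
have H2 := usc b w x b0 (le_lt_trans bq qd4) wL xr.
have bwM := Iop_Cbm b0 wM.
have H3 : I s w x <= I s (I b w) x + e / 4.
  exact: (st _ (tame_I s0') w _ wM bwM (small b w b0 (le_lt_trans bq qd2) wL) x xr).
have H4 : I s (I b w) x <= I s (steps l u) x + e / 4.
  apply: (st _ (tame_I s0') (I b w) _ bwM (steps_Cbm l0 uM) _ x xr).
  apply: (HIH (b :: rest)); rewrite /= ?b0 ?bd3//.
  by rewrite big_cons.
exact: chain_quarters (ltW e0) H1 H2 H3 H4.
Qed.

(** * The two infima *)

Lemma Cb_Cbm u : Cb K u -> exists M, Cbm M u.
Proof.
case=> v vL [bd cv]; set S := ereal_sup _ in bd.
have vS n x : (`|v n x|%:E <= S)%E.
  apply: (@le_trans _ _ (supnorm (v n))).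
    by apply: ereal_sup_ubound; exists x.
  by apply: ereal_sup_ubound; exists n.
have Sfin : S \is a fin_num.
  by rewrite ge0_fin_numE//; apply: le_trans (vS 0%N 0); rewrite lee_fin.
exists (fine S) => r e r0 e0.
have /fine_cvgP[fin /cvgr_le/(_ e e0) le] := cv r (ltW r0).
have [n [nfin nle]] : exists n,
    ereal_sup [set `|u x - v n x|%:E | x in [set x | `|x| <= r]] \is a fin_num /\
    fine (ereal_sup [set `|u x - v n x|%:E | x in [set x | `|x| <= r]]) <= e.
  have : \forall n \near \oo,
    ereal_sup [set `|u x - v n x|%:E | x in [set x | `|x| <= r]] \is a fin_num /\
    fine (ereal_sup [set `|u x - v n x|%:E | x in [set x | `|x| <= r]]) <= e.
    by near=> n; split; near: n; [exact: fin|exact: le].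
  by case=> n _ Hn; exists n; exact: (Hn n (leqnn n)).
have [L [M' [vnL _]]] := Lipb_klipb (vL n).
exists L, (v n); split.
  by split => // x; rewrite -lee_fin fineK.
move=> x xr; apply: le_trans nle; rewrite -lee_fin fineK//.
by apply: ereal_sup_ubound; exists x.
Unshelve. all: by end_near. Qed.

Lemma refine_Cbm M u l x e : Cbm M u -> all (> 0) l -> 0 < e ->
  exists2 del, 0 < del & forall g, all (>= 0) g -> all (< del) g ->
    \sum_(i <- g) i = \sum_(i <- l) i -> steps g u x <= steps l u x + e.
Proof.
move=> uM lp e0; have l0 : all (>= 0) l by apply: sub_all lp => z /ltW.
have e40 : 0 < e / 4 by rewrite divr_gt0.
have t0 : 0 <= \sum_(i <- l) i by rewrite big_seq sumr_ge0// => i il; exact: (allP l0).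
have [r [d [r0 d0 st]]] := stability t0 (Cbm_ge0 uM) (normr_ge0 x) e40.
have [L [v [vL uv]]] := uM r d r0 d0; have vM := klipb_Cbm vL.
have [del del0 H] := refine vL lp (normr_ge0 x) e40.
exists del => // g g0 gd gl; have tg := tame_steps g0; rewrite gl in tg.
have H1 : steps g u x <= steps g v x + e / 4.
  apply: (st _ tg u v uM vM _ x (lexx _)) => y yr.
  by have := uv y yr; rewrite ler_distl => /andP[].
have H2 : steps l v x <= steps l u x + e / 4.
  apply: (st _ (tame_steps l0) v u vM uM _ x (lexx _)) => y yr.
  by have := uv y yr; rewrite ler_distl => /andP[+ _]; rewrite lerBlDr.
exact: chain_quarters (ltW e0) (lexx _) H1 (H g g0 gd gl x (lexx _)) H2.
Qed.

Lemma steps_nseq k h v : steps (nseq k h) v = iter k (I h) v.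
Proof. by elim: k => //= k ->. Qed.

Lemma Idyad_steps n t u (k := Num.truncn (t / 2 ^- n)) :
  Idyad p mu psi c phi n t u = steps (rcons (nseq k (2 ^- n)) (t - k%:R * 2 ^- n)) u.
Proof. by rewrite /Idyad -/k /steps foldr_rcons -/(steps _ _) steps_nseq. Qed.

Lemma Sop_le_Ipart t u x s : 0 < t -> Cb K u -> itv_partition 0 t s ->
  (Sop p mu psi c phi t u x <= (Ipart p mu psi c phi s u x)%:E)%E.
Proof.
move=> t0 uC /increments_partition [lp]; rewrite subr0 => lt; have [M uM] := Cb_Cbm uC.
apply/lee_addgt0Pr => e e0.
have [del del0 H] := refine_Cbm x uM lp e0.
have [n nd] := half_pow_lt del0.
rewrite -EFinD; apply: (@le_trans _ _ (Idyad p mu psi c phi n t u x)%:E).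
  by apply: ereal_inf_lbound; exists n.
have [g0 gd gt] := dyadic_steps (ltW t0) nd.
rewrite lee_fin.
rewrite Idyad_steps; apply: (H _ g0 gd); exact: etrans gt (esym lt).
Qed.

(** A dyadic product is the product over a partition, once a vanishing last step
    is dropped. *)
Lemma Ipart_le_Sop t u x : 0 < t -> Cb K u ->
  (ereal_inf [set (Ipart p mu psi c phi s u x)%:E | s in [set s | itv_partition 0%R t s]] <=
   Sop p mu psi c phi t u x)%E.
Proof.
move=> t0 uC; have [M uM] := Cb_Cbm uC.
apply: le_ereal_inf_tmp => _ [n _ <-]; apply: ereal_inf_lbound.
suff [l [lp lt lE]] : exists l, [/\ all (> 0) l, \sum_(i <- l) i = t &
    Idyad p mu psi c phi n t u = steps l u].
  exists (scanl +%R 0 l); first by have := scanl_partition 0 lp; rewrite lt add0r.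
  by rewrite lE /Ipart scanlK// => a b; rewrite addrC addKr.
rewrite Idyad_steps; set k := Num.truncn _; set h : R := 2 ^- n.
have h0 : 0 < h by rewrite invr_gt0 exprn_gt0.
have kh : k%:R * h <= t by rewrite -ler_pdivlMr// truncn_le// divr_ge0// ltW.
have [/eqP E|E] := boolP (k%:R * h == t).
  exists (nseq k h); split; first by rewrite all_nseq /= h0 orbT.
    by rewrite big_nseq iter_addr_0 -mulr_natl.
  rewrite /steps foldr_rcons; congr foldr; apply/funext => y.
  by rewrite E subrr (Iop0 y uM).
exists (rcons (nseq k h) (t - k%:R * h)); split => //.
- by rewrite all_rcons all_nseq /= h0 orbT subr_gt0 lt_neqAle E kh.
- by rewrite big_rcons big_nseq iter_addr_0 /= mulr_natl addrC subrK.
Qed.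

Lemma Sop_Ipart t u x : 0 < t -> Cb K u -> Sop p mu psi c phi t u x =
  ereal_inf [set (Ipart p mu psi c phi s u x)%:E | s in [set s | itv_partition 0 t s]].
Proof.
move=> t0 uC; apply/eqP; rewrite eq_le Ipart_le_Sop// andbT.
by apply: le_ereal_inf_tmp => _ [s sP <-]; exact: Sop_le_Ipart.
Qed.

End semigroup.

Theorem mainTheorem2 (R : realType) (X : completeNormedModType R)
  (X_separable : separable X)
  (K : {linear X -> X})
  (K_compact : forall r : R, 0 <= r -> compact (K @` [set x | `|x| <= r]))
  (K_dense : dense (range K))
  (K_contr : forall x, `|K x| <= `|x|)
  (p : R) (p_gt1 : 1 < p)
  (mu : R -> probability (borel X) R)
  (mu_Pp : forall t, 0 <= t -> Pp p (mu t))
  (psi : R -> X -> X)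
  (psi_continuous : forall t, 0 <= t -> continuous (psi t))
  (mu_psi : forall (s t : R) (u : X -> R) (x : X),
     0 <= s -> 0 <= t -> Cb K u ->
     (\int[mu (t + s)%R]_y (u (psi (t + s) x + (y : X))%R)%:E =
      \int[mu t]_yt \int[mu s]_ys
        (u (psi s (psi t x + (yt : X)) + (ys : X))%R)%:E)%E)
  (c : R) (c_ge0 : 0 <= c)
  (psi_lip : forall t x1 x2, 0 <= t ->
     `|psi t x1 - psi t x2| <= expR (c * t) * `|x1 - x2|)
  (K_psi : forall t x, 0 <= t -> K (psi t x) = psi t (K x))
  (psi0 : forall x, psi 0 x = x)
  (psi_cvg : forall r : R, 0 <= r ->
     ereal_sup [set `|psi h (K x) - K x|%:E | x in [set x | `|x| <= r]]
       @[h --> 0^'+] --> 0%E)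
  (mu_cvg : (\int[mu h]_y (`|y : X| `^ p)%:E)%E @[h --> 0^'+] --> 0%E)
  (phi : R -> \bar R)
  (phi_ge0 : forall v, 0 <= v -> (0 <= phi v)%E)
  (phi_convex : convex_nneg phi)
  (phi_lsc : lower_semicontinuous (phi : subspace `[0, +oo[ -> \bar R))
  (phi0 : phi 0 = 0%E)
  (phi_neq0 : exists2 v, 0 < v & phi v <> 0%E)
  (phi_pconvex : convex_nneg (fun v => phi (v `^ p^-1)))
  (t : R) (t_gt0 : 0 < t) (u : X -> R) (u_Cb : Cb K u) (x : X) :
  Sop p mu psi c phi t u x =
  ereal_inf [set (Ipart p mu psi c phi s u x)%:E
               | s in [set s | itv_partition 0 t s]].
Proof.
exact: Sop_Ipart.
Qed.
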